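(* Let $\mathfrak{g}$ be a semi-simple finite-dimensional complex Lie algebra with a fixed triangular decomposition $\mathfrak{g}=\mathfrak{n}_-\oplus\mathfrak{h}\oplus\mathfrak{n}_+$. The category $\mathscr{W}$ of Whittaker modules for $\mathfrak{g}$ is extension full in the category $U(\mathfrak{g})\text{-}\mathrm{Mod}$ of all $\mathfrak{g}$-modules.
   Context: Whittaker modules. Let $U(\mathfrak{g})$ be the universal enveloping algebra of $\mathfrak{g}$, $Z(\mathfrak{g})$ its center, and $R=Z(\mathfrak{g})U(\mathfrak{n}_+)\subset U(\mathfrak{g})$. The category $\mathscr{W}$ of Whittaker modules is the full subcategory of the category of finitely generated $U(\mathfrak{g})$-modules consisting of all modules $M$ on which the action of $R$ is locally finite, i.e. $\dim(Rv)<\infty$ for all $v\in M$. Extensions. For an Abelian category $\mathcal{A}$, objects $M,N$ and $d\ge 0$, $\mathrm{Ext}^d_{\mathcal{A}}(M,N)$ denotes the Yoneda extension group: $\mathrm{Ext}^0_{\mathcal{A}}=\mathrm{Hom}_{\mathcal{A}}$, and for $d\geq 1$ it is the set of equivalence classes of exact sequences $0\to N\to X_1\to\dots\to X_d\to M\to 0$ in $\mathcal{A}$ modulo the equivalence relation generated by morphisms of such sequences which are identities on $N$ and $M$; it is an Abelian group under Baer sum. Extension fullness. Let $\mathcal{B}$ be a full Abelian subcategory of an Abelian category $\mathcal{A}$, with Abelian structure inherited from $\mathcal{A}$ (so that the inclusion is exact). The inclusion induces homomorphisms $\iota^d_{M,N}:\mathrm{Ext}^d_{\mathcal{B}}(M,N)\to\mathrm{Ext}^d_{\mathcal{A}}(M,N)$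 for $M,N\in\mathcal{B}$, $d\ge 0$. $\mathcal{B}$ is extension full in $\mathcal{A}$ if $\iota^d_{M,N}$ is bijective for all $d\ge 0$ and all $M,N\in\mathcal{B}$. *)

(* Defs.v *)
From HB Require Import structures.
From Stdlib Require Import Relation_Operators.
From mathcomp Require Import all_boot all_order all_algebra.
From mathcomp Require Import boolp reals complex.

Set Implicit Arguments.
Unset Strict Implicit.
Unset Printing Implicit Defensive.

Import GRing.Theory.
Local Open Scope ring_scope.

HB.mixin Record Vector_isLieAlgebra (K : fieldType) g of Vector K g := {
  lieb : g -> g -> g;
  lieb_linearl : forall y : g, linear (lieb^~ y);
  lieb_linearr : forall x : g, linear (lieb x);
  liebxx : forall x : g, lieb x x = 0;
  lieb_jacobi : forall x y z : g,
    lieb x (lieb y z) + lieb y (lieb z x) + lieb z (lieb x y) = 0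
}.

#[short(type="lieAlgType")]
HB.structure Definition LieAlgebra (K : fieldType) :=
  {g of Vector_isLieAlgebra K g & Vector K g}.

Section LieAlgebras.
Variables (K : fieldType) (g : lieAlgType K).
Implicit Types (V W I H : {vspace g}).

(* By bilinearity, brackets of basis vectors span all the lieb x y with
   x in V and y in W. *)
Definition lieb_space V W : {vspace g} :=
  <<[seq lieb x y | x <- vbasis V, y <- vbasis W]>>%VS.

Fixpoint derived_series V (n : nat) : {vspace g} :=
  if n is m.+1 then lieb_space (derived_series V m) (derived_series V m) else V.

Fixpoint lower_central_series V (n : nat) : {vspace g} :=
  if n is m.+1 then lieb_space V (lower_central_series V m) else V.

Definition lie_solvable V := exists n, derived_series V n = 0%VS.
Definition lie_nilpotent V := exists n, lower_central_series V n = 0%VS.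

Definition lie_ideal I := forall x y, y \in I -> lieb x y \in I.

Definition lie_semisimple :=
  forall I, lie_ideal I -> lie_solvable I -> I = 0%VS.

Definition lie_subalgebra V :=
  forall x y, x \in V -> y \in V -> lieb x y \in V.

Definition cartan_subalgebra H :=
  [/\ lie_subalgebra H, lie_nilpotent H
    & forall x, (forall h, h \in H -> lieb x h \in H) -> x \in H].

Definition ad (x : g) : 'End(g) := linfun (lieb x).

(* {x | lieb h x = a h *: x for all h in H}; a basis of H suffices since both
   sides are linear in h. *)
Definition root_space H (a : 'Hom(subvs_of H, K^o)) : {vspace g} :=
  (\bigcap_(h <- vbasis {:subvs_of H})
     passmx.leigenspace (ad (vsval h)) (a h))%VS.

Definition is_root H (a : 'Hom(subvs_of H, K^o)) :=
  (a != 0) && (root_space a != 0%VS).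

Definition nonneg_comb H (D : seq 'Hom(subvs_of H, K^o))
    (a : 'Hom(subvs_of H, K^o)) :=
  exists c : 'I_(size D) -> nat, a = \sum_(i < size D) D`_i *+ c i.

Record triangular_decomposition := TriangularDecomposition {
  n_minus : {vspace g};
  cartan : {vspace g};
  n_plus : {vspace g};
  cartanP : cartan_subalgebra cartan;
  (* a base of the root system, and the positive roots it determines *)
  simple_roots : seq 'Hom(subvs_of cartan, K^o);
  positive_roots : seq 'Hom(subvs_of cartan, K^o);
  simple_rootsP : forall a, a \in simple_roots -> is_root a;
  simple_roots_free : free simple_roots;
  root_sign : forall a : 'Hom(subvs_of cartan, K^o), is_root a ->
    nonneg_comb simple_roots a \/ nonneg_comb simple_roots (- a);
  positive_rootsP : forall a : 'Hom(subvs_of cartan, K^o),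
    a \in positive_roots <-> is_root a /\ nonneg_comb simple_roots a;
  n_plusE : n_plus = (\sum_(a <- positive_roots) root_space a)%VS;
  n_minusE : n_minus = (\sum_(a <- positive_roots) root_space (- a))%VS;
  triangular_full : (n_minus + cartan + n_plus)%VS = fullv;
  triangular_direct : directv (n_minus + cartan + n_plus)
}.

Definition lie_morphism (A : algType K) (f : g -> A) :=
  forall x y, f (lieb x y) = f x * f y - f y * f x.

(* (U, i) is determined up to unique isomorphism by its universal property. *)
Definition universal_enveloping (U : algType K) (i : {linear g -> U}) :=
  lie_morphism i /\
  forall (A : algType K) (f : {linear g -> A}), lie_morphism f ->
    (exists F : {lrmorphism U -> A}, forall x, F (i x) = f x) /\
    (forall F G : {lrmorphism U -> A},
       (forall x, F (i x) = G (i x)) -> forall u, F u = G u).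

End LieAlgebras.

Section Whittaker.
Variables (K : fieldType) (U : algType K).

Definition central (z : U) := forall u : U, z * u = u * z.

Inductive subalgebra_gen (S : U -> Prop) : U -> Prop :=
| Gen_in u : S u -> subalgebra_gen S u
| Gen_scalar (c : K) : subalgebra_gen S c%:A
| Gen_add u v : subalgebra_gen S u -> subalgebra_gen S v ->
    subalgebra_gen S (u + v)
| Gen_mul u v : subalgebra_gen S u -> subalgebra_gen S v ->
    subalgebra_gen S (u * v).

(* A U-module is a K-vector space through c |-> c%:A.  Here P is a subspace. *)
Definition finite_dim (M : lmodType U) (P : M -> Prop) :=
  exists s : seq M, (forall w, w \in s -> P w) /\
    forall v, P v ->
      exists c : 'I_(size s) -> K, v = \sum_(i < size s) (c i)%:A *: s`_i.

Definition finitely_generated (M : lmodType U) :=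
  exists s : seq M, forall v : M,
    exists u : 'I_(size s) -> U, v = \sum_(i < size s) u i *: s`_i.

Variables (g : lieAlgType K) (i : {linear g -> U}).

(* U(n), identified with its image in U(g). *)
Definition env_of (n : {vspace g}) : U -> Prop :=
  subalgebra_gen (fun u => exists2 x, x \in n & u = i x).

(* Z(g) U(n): finite sums of products z * u. *)
Definition center_times_env (n : {vspace g}) (r : U) :=
  exists s : seq (U * U),
    (forall p, p \in s -> central p.1 /\ env_of n p.2) /\
    r = \sum_(p <- s) p.1 * p.2.

Definition whittaker (T : triangular_decomposition g) (M : lmodType U) :=
  finitely_generated M /\
  forall v : M, finite_dim
    (fun w => exists2 r, center_times_env (n_plus T) r & w = r *: v).

End Whittaker.

Section Yoneda.
Variable A : pzRingType.

Section Chains.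
Variable M : lmodType A.

(* chain d X is the type of diagrams X -> X_1 -> ... -> X_d -> M. *)
Fixpoint chain (d : nat) (X : lmodType A) : Type :=
  if d is d'.+1 then {Y : lmodType A & ({linear X -> Y} * chain d' Y)%type}
  else {linear X -> M}.

Fixpoint terms_in (P : lmodType A -> Prop) (d : nat) (X : lmodType A) :
    chain d X -> Prop :=
  if d is d'.+1 then fun c => P (tag c) /\ terms_in P (tagged c).2
  else fun=> True.

(* Exactness of ... -> X -> X_1 -> ... -> X_d -> M -> 0 at X and at every term
   to its right, where im is the image of the map arriving at X. *)
Fixpoint exact_after (d : nat) (X : lmodType A) (im : X -> Prop) :
    chain d X -> Prop :=
  if d is d'.+1 then fun c =>
    (forall x, (tagged c).1 x = 0 <-> im x) /\
    exact_after (fun y => exists x, (tagged c).1 x = y) (tagged c).2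
  else fun p =>
    (forall x, p x = 0 <-> im x) /\ (forall m, exists x, p x = m).

(* Given phi : X -> X', there are maps X_k -> X'_k which together with phi and
   the identity of M form a commutative ladder. *)
Fixpoint ladder (d : nat) (X X' : lmodType A) (phi : X -> X') :
    chain d X -> chain d X' -> Prop :=
  if d is d'.+1 then fun c c' =>
    exists psi : {linear tag c -> tag c'},
      (forall x, psi ((tagged c).1 x) = (tagged c').1 (phi x)) /\
      ladder psi (tagged c).2 (tagged c').2
  else fun p p' => forall x, p x = p' (phi x).

End Chains.

(* Exact sequences 0 -> N -> X_1 -> ... -> X_d -> M -> 0 (used for d >= 1) with
   X_1, ..., X_d in the full subcategory P. *)
Record yseq (P : lmodType A -> Prop) (M N : lmodType A) (d : nat) := YSeq {
  yseq_chain : chain M d N;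
  yseq_exact : exact_after (fun x => x = 0) yseq_chain;
  yseq_terms : terms_in P yseq_chain
}.

Definition yseq_morphism P M N d (E E' : yseq P M N d) :=
  ladder (fun x : N => x) (yseq_chain E) (yseq_chain E').

Definition yseq_equiv P M N d : yseq P M N d -> yseq P M N d -> Prop :=
  clos_refl_sym_trans _ (@yseq_morphism P M N d).

Definition yseq_class P M N d :=
  {C : yseq P M N d -> Prop | exists E, C = yseq_equiv E}.

Definition Ext (P : lmodType A -> Prop) (d : nat) (M N : lmodType A) : Type :=
  if d is d'.+1 then yseq_class P M N d'.+1 else {linear M -> N}.

Definition all_modules (M : lmodType A) := True.

Lemma terms_in_all P (M : lmodType A) d (X : lmodType A) (c : chain M d X) :
  terms_in P c -> terms_in all_modules c.
Proof. by elim: d X c => [|d IHd] X c //= [_ /IHd]. Qed.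

Definition yseq_incl P M N d (E : yseq P M N d) : yseq all_modules M N d :=
  YSeq (yseq_exact E) (terms_in_all (yseq_terms E)).

Lemma yseq_incl_equiv P M N d (E E' : yseq P M N d) :
  yseq_equiv E E' -> yseq_equiv (yseq_incl E) (yseq_incl E').
Proof.
elim=> {E E'} [E E' EE'|E|E E' _|E F G _ EF _ FG]; first exact: rst_step.
- exact: rst_refl.
- exact: rst_sym.
- exact: rst_trans EF FG.
Qed.

Definition class_incl_pred P M N d (C : yseq P M N d -> Prop) :
    yseq all_modules M N d -> Prop :=
  fun F => exists2 E, C E & yseq_equiv (yseq_incl E) F.

Lemma class_incl_subproof P M N d (C : yseq_class P M N d) :
  exists F, class_incl_pred (sval C) = yseq_equiv F.
Proof.
case: C => C [E defC] /=; rewrite defC; exists (yseq_incl E).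
apply/funext => F; apply/propext; split => [[E' EE' E'F]|EF].
  by apply: rst_trans E'F; apply: yseq_incl_equiv.
by exists E => //; apply: rst_refl.
Qed.

Definition class_incl P M N d (C : yseq_class P M N d) :
    yseq_class all_modules M N d :=
  exist _ _ (class_incl_subproof C).

Definition Ext_incl P d M N : Ext P d M N -> Ext all_modules d M N :=
  if d is d'.+1 then fun C => class_incl C else fun f => f.

(* P is a full Abelian subcategory with structure inherited from A-Mod: it
   contains, up to isomorphism, zero, direct sums, kernels and cokernels. *)
Definition abelian_subcategory (P : lmodType A -> Prop) :=
  [/\ exists2 Z : lmodType A, P Z & forall z : Z, z = 0,
      forall X Y : lmodType A, P X -> P Y ->
        exists S : lmodType A, P S /\
          exists f : {linear S -> (X * Y)%type}, bijective f,
      forall (X Y : lmodType A) (f : {linear X -> Y}), P X -> P Y ->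
        exists Z : lmodType A, P Z /\
          exists j : {linear Z -> X},
            injective j /\ forall x, f x = 0 <-> exists z, j z = x
    & forall (X Y : lmodType A) (f : {linear X -> Y}), P X -> P Y ->
        exists Z : lmodType A, P Z /\
          exists q : {linear Y -> Z},
            (forall z, exists y, q y = z) /\
            (forall y, q y = 0 <-> exists x, f x = y)].

Definition extension_full (P : lmodType A -> Prop) :=
  abelian_subcategory P /\
  forall (d : nat) (M N : lmodType A), P M -> P N ->
    bijective (@Ext_incl P d M N).

End Yoneda.

(* Main.v *)
Require Import Defs.
From HB Require Import structures.
From Stdlib Require Import Relation_Operators.
From mathcomp Require Import all_boot all_order all_algebra.
From mathcomp Require Import boolp classical_sets functions reals complex ring.
From mathcomp.multinomials Require mpoly.

Set Implicit Arguments.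
Unset Strict Implicit.
Unset Printing Implicit Defensive.


Import Order.TTheory GRing.Theory Num.Theory.
Local Open Scope ring_scope.

(** A finitely generated module is a Whittaker module exactly when it is locally finite over U(n_+)
    and every central element satisfies, on each vector, some nonzero polynomial ([whittakerE]). So
    the category sits at the bottom of a chain of classes: Whittaker modules, finitely generated
    locally n_+-finite modules, locally n_+-finite modules, all modules. In positive degree Yoneda
    Ext consists of exact sequences up to zigzags of ladders. Bijectivity of the comparison map then
    says two things: every sequence over the larger class is connected to one over the smaller
    class, and sequences over the smaller class connected inside the larger one are connected inside
    the smaller one. This property, [zz_full], is transitive and is proved for each of the three
    inclusions.

    From all modules to locally finite ones ([torsion_full]): U(g) is free as a right U(n_+)-module
    by the theorem of Poincare, Birkhoff and Witt ([pbw_free], [left_mon_free]), so the coinduced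
    module Hom(U(g), X) is injective over U(n_+) ([coind_baer]). All terms of a sequence but the
    last are replaced by coinduced modules, with pushouts, and then every term by its locally finite
    part. Exactness survives because the relevant images are acyclic: their quotient by the locally
    finite part is injective. The main input is that the locally finite part of an injective module
    is injective ([baer_locfin]). It rests on the fact that a Noetherian U(n_+)-module which is an
    essential extension of a finite-dimensional module is itself finite-dimensional
    ([fdim_of_essential]), proved along a central series of n_+.

    From locally finite to finitely generated ([zz_full_subobject], [fg_locfin_lift]): since U(g) is
    Noetherian ([noeth_enveloping]), finitely generated submodules of the terms can be chosen from
    right to left so that they form an exact sequence.

    From finitely generated to Whittaker ([zz_full_quotient], [whittaker_alg_stable]): going from
    left to right, a term Y is divided by a submodule maximal among those meeting the image of the
    preceding Whittaker module trivially. That image becomes essential, and by Fitting's lemma a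
    central polynomial that kills it has a power that kills the whole quotient.

    For [whittakerE] the center must act on such a module through a finite-dimensional algebra. This
    follows from [commutative_cofinite] once the center is Noetherian ([center_noeth]). The latter
    is an averaging argument ([reynolds]) based on invariant vectors ([invariant_functional]), which
    come from Casimir operators ([casimir]) and Cartan's criterion ([cartan_criterion]). *)

Section MakeLinear.
Variables (A : pzRingType) (M N : lmodType A).

Definition mklin (f : M -> N) (lf : linear f) : {linear M -> N} :=
  HB.pack f (GRing.isLinear.Build A M N _ f lf).

Lemma mklinE (f : M -> N) (lf : linear f) x : mklin lf x = f x.
Proof. by []. Qed.

End MakeLinear.

Lemma choice_on (T U : Type) (u0 : U) (D : T -> Prop) (R : T -> U -> Prop) :
  (forall x, D x -> exists y, R x y) -> exists f, forall x, D x -> R x (f x).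
Proof.
move=> ex; have [f fR] : {f : T -> U & forall x, D x -> R x (f x)}.
  apply: (@choice _ _ (fun x y => D x -> R x y)) => x.
  by have [/ex[y Ry]|nD] := pselect (D x); [exists y|exists u0].
by exists f.
Qed.

(** * Submodules, quotient modules, spans and Noetherian modules *)

Section Submodules.
Variables (A : pzRingType) (M : lmodType A).
Implicit Types P Q : M -> Prop.

Definition submod P := P 0 /\ forall a u v, P u -> P v -> P (a *: u + v).

Variable P : M -> Prop.
Hypothesis sP : submod P.

Lemma submodD u v : P u -> P v -> P (u + v).
Proof. by move=> Pu Pv; rewrite -[u]scale1r; apply: sP.2. Qed.

Lemma submodZ a u : P u -> P (a *: u).
Proof. by move=> Pu; rewrite -[_ *: _]addr0; apply: sP.2 => //; case: sP. Qed.

Lemma submodN u : P u -> P (- u).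
Proof. by move=> Pu; rewrite -scaleN1r; apply: submodZ. Qed.

Lemma submodB u v : P u -> P v -> P (u - v).
Proof. by move=> Pu Pv; apply: submodD => //; apply: submodN. Qed.

Lemma submod_sum (I : Type) (r : seq I) (F : I -> M) :
  (forall k, P (F k)) -> P (\sum_(k <- r) F k).
Proof.
move=> PF; elim: r => [|k r IHr]; first by rewrite big_nil; case: sP.
by rewrite big_cons; apply: submodD.
Qed.

Definition submod_pred : {pred M} := fun x => `[<P x>].

Lemma submod_pred_closed : submod_closed submod_pred.
Proof.
split=> [|a u v /asboolP Pu /asboolP Pv]; apply/asboolP; first by case: sP.
exact: sP.2.
Qed.

Lemma submodDl u v : P u -> P (u + v) <-> P v.
Proof.
move=> Pu; split=> [Puv|]; last exact: submodD.
by rewrite -(addKr u v) addrC; apply: submodB.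
Qed.

End Submodules.

Section SubmoduleType.
Variables (A : pzRingType) (M : lmodType A) (P : M -> Prop) (sP : submod P).

(** The closure proof is an argument so that the instance below can be keyed on this predicate. *)
Definition sub_pred (_ : submod P) : {pred M} := submod_pred P.

HB.instance Definition _ :=
  GRing.isSubmodClosed.Build A M (sub_pred sP) (submod_pred_closed sP).

Record subT := SubT { subT_val : M; _ : subT_val \in sub_pred sP }.

HB.instance Definition _ := [isSub for subT_val].
HB.instance Definition _ := [Choice of subT by <:].
HB.instance Definition _ := [SubChoice_isSubLmodule of subT by <:].

Definition sub_incl : {linear subT -> M} :=
  @mklin A subT M val (fun a u v => erefl).

Lemma sub_inclP x : P (sub_incl x).
Proof. by apply/asboolP; case: x. Qed.

Lemma sub_incl_inj : injective sub_incl.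
Proof. exact: val_inj. Qed.

Lemma sub_incl_ex x : P x -> exists y, sub_incl y = x.
Proof. by move=> /asboolP Px; exists (SubT Px). Qed.

Section Lift.
Variables (L : lmodType A) (f : {linear L -> M}) (fP : forall x, P (f x)).

Definition sub_lift_fun x : subT := SubT (asboolT (fP x)).

Lemma sub_lift_linear : linear sub_lift_fun.
Proof. by move=> a u v; apply: val_inj; rewrite /= linearP. Qed.

Definition sub_lift : {linear L -> subT} := mklin sub_lift_linear.

Lemma sub_liftE x : sub_incl (sub_lift x) = f x.
Proof. by []. Qed.

End Lift.

End SubmoduleType.

Section QuotientModule.
Variables (A : pzRingType) (M : lmodType A) (P : M -> Prop) (sP : submod P).

Lemma quo_ex x : exists y, `[<P (x - y)>].
Proof. by exists x; apply/asboolP; rewrite subrr; case: sP. Qed.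

(** Congruent vectors define equivalent boolean predicates in [quo_ex], and [xchoose] gives equal
    values on those. So every class has a canonical representative, and the quotient can be built as
    the subtype of vectors fixed by [quo_rep]. *)
Definition quo_rep x := xchoose (quo_ex x).

Lemma quo_repP x : P (x - quo_rep x).
Proof. exact/asboolP/(xchooseP (quo_ex x)). Qed.

Lemma quo_rep_eq x y : P (x - y) <-> quo_rep x = quo_rep y.
Proof.
split=> [Pxy|e]; last first.
  have := submodB sP (quo_repP x) (quo_repP y).
  by rewrite e opprB addrA subrK.
apply: eq_xchoose => z; apply: asbool_equiv_eq; split=> Pz.
  by have := submodB sP Pz Pxy; rewrite opprB addrC addrA subrK.
by have := submodD sP Pxy Pz; rewrite addrA subrK.
Qed.

Lemma quo_rep_id x : quo_rep (quo_rep x) = quo_rep x.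
Proof. by apply/quo_rep_eq; have := submodN sP (quo_repP x); rewrite opprB. Qed.

Record quoT := QuoT { quoT_val : M; _ : quo_rep quoT_val == quoT_val }.

HB.instance Definition _ := [isSub for quoT_val].
HB.instance Definition _ := [Choice of quoT by <:].

Definition quo_mk x : quoT := @QuoT (quo_rep x) (introT eqP (quo_rep_id x)).

Lemma quo_mk_eq x y : quo_mk x = quo_mk y <-> P (x - y).
Proof.
split=> [[/quo_rep_eq//]|Pxy]; apply: val_inj => /=.
exact/quo_rep_eq.
Qed.

Lemma quo_mk_val (x : quoT) : quo_mk (val x) = x.
Proof. by apply: val_inj => /=; case: x => x /= /eqP. Qed.

Lemma quo_mkP (x y : M) : P (x - y) -> quo_mk x = quo_mk y.
Proof. by move/quo_mk_eq. Qed.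

Lemma val_quo_mk x : P (val (quo_mk x) - x).
Proof. by rewrite /= -opprB; apply/(submodN sP)/quo_repP. Qed.

Definition quo_add (x y : quoT) := quo_mk (val x + val y).
Definition quo_opp (x : quoT) := quo_mk (- val x).
Definition quo_scale a (x : quoT) := quo_mk (a *: val x).

Lemma quo_addE x y : quo_add (quo_mk x) (quo_mk y) = quo_mk (x + y).
Proof.
by apply: quo_mkP; rewrite opprD addrACA; apply: (submodD sP); apply: val_quo_mk.
Qed.

Lemma quo_oppE x : quo_opp (quo_mk x) = quo_mk (- x).
Proof. by apply: quo_mkP; rewrite -opprD; apply/(submodN sP)/val_quo_mk. Qed.

Lemma quo_scaleE a x : quo_scale a (quo_mk x) = quo_mk (a *: x).
Proof. by apply: quo_mkP; rewrite -scalerBr; apply/(submodZ sP)/val_quo_mk. Qed.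

Lemma quo_ind (Q : quoT -> Prop) : (forall x, Q (quo_mk x)) -> forall x, Q x.
Proof. by move=> H x; rewrite -(quo_mk_val x). Qed.

Lemma quo_addA : associative quo_add.
Proof.
move=> x y z; elim/quo_ind: x => x; elim/quo_ind: y => y; elim/quo_ind: z => z.
by rewrite !quo_addE addrA.
Qed.

Lemma quo_addC : commutative quo_add.
Proof.
move=> x y; elim/quo_ind: x => x; elim/quo_ind: y => y.
by rewrite !quo_addE addrC.
Qed.

Lemma quo_add0 : left_id (quo_mk 0) quo_add.
Proof. by move=> x; elim/quo_ind: x => x; rewrite quo_addE add0r. Qed.

Lemma quo_addN : left_inverse (quo_mk 0) quo_opp quo_add.
Proof. by move=> x; elim/quo_ind: x => x; rewrite quo_oppE quo_addE addNr. Qed.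

HB.instance Definition _ :=
  GRing.isZmodule.Build quoT quo_addA quo_addC quo_add0 quo_addN.

Lemma quo_scaleA a b x : quo_scale a (quo_scale b x) = quo_scale (a * b) x.
Proof. by elim/quo_ind: x => x; rewrite !quo_scaleE scalerA. Qed.

Lemma quo_scale1 : left_id 1 quo_scale.
Proof. by move=> x; elim/quo_ind: x => x; rewrite quo_scaleE scale1r. Qed.

Lemma quo_scaleDr : right_distributive quo_scale +%R.
Proof.
move=> a x y; elim/quo_ind: x => x; elim/quo_ind: y => y.
by rewrite -[_ + _]/(quo_add _ _) quo_addE !quo_scaleE -[_ + _ in RHS]/(quo_add _ _)
  quo_addE scalerDr.
Qed.

Lemma quo_scaleDl x : {morph quo_scale^~ x : a b / a + b}.
Proof. elim/quo_ind: x => x a b.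
by rewrite !quo_scaleE -[_ + _ in RHS]/(quo_add _ _) quo_addE scalerDl. Qed.

HB.instance Definition _ := GRing.Zmodule_isLmodule.Build A quoT
  quo_scaleA quo_scale1 quo_scaleDr quo_scaleDl.

Lemma quo_mk_linear : linear quo_mk.
Proof. by move=> a u v; rewrite -quo_addE -quo_scaleE. Qed.

Definition quo_pi : {linear M -> quoT} := mklin quo_mk_linear.

Lemma quo_pi_eq0 x : quo_pi x = 0 <-> P x.
Proof. by rewrite -{2}[x]subr0; apply: quo_mk_eq. Qed.

Lemma quo_pi_surj y : exists x, quo_pi x = y.
Proof. by exists (val y); apply: quo_mk_val. Qed.

Section Lift.
Variables (N : lmodType A) (f : {linear M -> N}) (f0 : forall x, P x -> f x = 0).

Definition quo_lift_fun (y : quoT) := f (val y).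

Lemma quo_lift_funE x : quo_lift_fun (quo_mk x) = f x.
Proof. by apply/eqP; rewrite -subr_eq0 -linearB; apply/eqP/f0/val_quo_mk. Qed.

Lemma quo_lift_linear : linear quo_lift_fun.
Proof.
move=> a x y; elim/quo_ind: x => x; elim/quo_ind: y => y.
by rewrite -quo_mk_linear !quo_lift_funE linearP.
Qed.

Definition quo_lift : {linear quoT -> N} := mklin quo_lift_linear.

Lemma quo_liftE x : quo_lift (quo_pi x) = f x.
Proof. exact: quo_lift_funE. Qed.

End Lift.

End QuotientModule.

Lemma map_preimage (T U : eqType) (f : T -> U) (P : T -> Prop) (t : seq U) :
  (forall y, y \in t -> exists2 x, P x & f x = y) ->
  exists r, (forall x, x \in r -> P x) /\ map f r = t.
Proof.
elim: t => [|y t IHt] tR; first by exists [::].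
have [x Px Ex] := tR y (mem_head _ _).
have [|r [rP Er]] := IHt; first by move=> w wt; apply: tR; rewrite inE wt orbT.
exists (x :: r); rewrite /= Ex Er; split=> // w.
by rewrite inE => /predU1P[->|/rP].
Qed.

Lemma map_preimage1 (T U : eqType) (f : T -> U) (t : seq U) :
  (forall y, y \in t -> exists x, f x = y) -> exists r, map f r = t.
Proof.
move=> tR; have [|r [_ Er]] := @map_preimage _ _ f (fun=> True) t; last by exists r.
by move=> y /tR[x Ex]; exists x.
Qed.

Section Span.
Variables (A : pzRingType) (M : lmodType A).
Implicit Types (s t : seq M) (P Q : M -> Prop).

(** Recursion on the generators lets proofs peel off one generator at a time; [lspanP] recovers the
    form with coefficients. *)
Fixpoint lspan s (v : M) : Prop :=
  if s is x :: s' then exists a, lspan s' (v - a *: x) else v = 0.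

Lemma lspan_submod s : submod (lspan s).
Proof.
elim: s => [|x s [IH0 IH]].
  by split=> [|a u v /= -> ->] //; rewrite scaler0 addr0.
split=> [|a u v [b Hu] [c Hv]]; first by exists 0; rewrite scale0r subr0.
exists (a * b + c); have := IH a _ _ Hu Hv.
by rewrite scalerBr scalerDl scalerA addrACA opprD.
Qed.

Lemma lspan0 s : lspan s 0. Proof. exact: (lspan_submod s).1. Qed.

Lemma lspan_head x s : lspan (x :: s) x.
Proof. by exists 1; rewrite scale1r subrr; apply: lspan0. Qed.

Lemma lspan_tail x s v : lspan s v -> lspan (x :: s) v.
Proof. by exists 0; rewrite scale0r subr0. Qed.

Lemma lspan_mem s x : x \in s -> lspan s x.
Proof.
elim: s => //= y s IHs; rewrite inE => /predU1P[->|/IHs]; first exact: lspan_head.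
exact: lspan_tail.
Qed.

Lemma lspan_min s P v : submod P -> (forall x, x \in s -> P x) -> lspan s v -> P v.
Proof.
move=> sP; elim: s v => [|x s IHs] v /= Ps; first by move=> ->; case: sP.
move=> [a /IHs Pv]; rewrite -(subrK (a *: x) v); apply: (submodD sP).
  by apply: Pv => y ys; apply: Ps; rewrite inE ys orbT.
by apply: (submodZ sP); apply: Ps; rewrite mem_head.
Qed.

Lemma lspan_sub s t v : (forall x, x \in s -> lspan t x) -> lspan s v -> lspan t v.
Proof. by apply: lspan_min; apply: lspan_submod. Qed.

Lemma lspan_catl s t v : lspan s v -> lspan (s ++ t) v.
Proof. by apply: lspan_sub => x xs; apply: lspan_mem; rewrite mem_cat xs. Qed.

Lemma lspan_catr s t v : lspan t v -> lspan (s ++ t) v.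
Proof. by apply: lspan_sub => x xs; apply: lspan_mem; rewrite mem_cat xs orbT. Qed.

Lemma lspan_cat s t v : lspan (s ++ t) v -> exists2 u, lspan s u & lspan t (v - u).
Proof.
elim: s v => [|x s IHs] v /=; first by exists 0; rewrite ?subr0.
move=> [a /IHs[u su tu]]; exists (u + a *: x); first by exists a; rewrite addrK.
by rewrite opprD addrA addrAC.
Qed.

Lemma lspanP s v :
  lspan s v <-> exists c : 'I_(size s) -> A, v = \sum_(i < size s) c i *: s`_i.
Proof.
split.
  elim: s v => [|x s IHs] v /= => [->|[a /IHs[c Ev]]].
    by exists (fun=> 0); rewrite big_ord0.
  exists (fun i => if unlift ord0 i is Some j then c j else a).
  rewrite big_ord_recl unlift_none /=.
  rewrite (eq_bigr (fun j => c j *: s`_j)) => [|j _]; last by rewrite liftK.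
  by rewrite -Ev addrC subrK.
move=> [c ->]; apply: (submod_sum (lspan_submod s)) => k.
by apply/(submodZ (lspan_submod s))/lspan_mem/mem_nth.
Qed.

Definition fingen P :=
  exists s, (forall w, w \in s -> P w) /\ (forall v, P v -> lspan s v).

Lemma fingen_cover (P : M -> Prop) s :
  submod P -> (forall w, w \in s -> P w) -> (forall v, P v -> lspan s v) ->
  forall v, P v <-> lspan s v.
Proof. by move=> sP Ps sPs v; split=> [/sPs|] //; apply: lspan_min. Qed.

End Span.

Section SpanLinear.
Variables (A : pzRingType) (M N : lmodType A) (f : {linear M -> N}).

Lemma lspan_map s v : lspan s v -> lspan (map f s) (f v).
Proof.
elim: s v => [|x s IHs] v /= => [->|[a /IHs]]; first by rewrite linear0.
by rewrite linearB linearZ; exists a.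
Qed.

Lemma lspan_map_ex s w : lspan (map f s) w -> exists2 v, lspan s v & f v = w.
Proof.
elim: s w => [|x s IHs] w /= => [->|[a /IHs[v sv fv]]].
  by exists 0; rewrite ?linear0.
exists (v + a *: x); first by exists a; rewrite addrK.
by rewrite linearD linearZ fv /= subrK.
Qed.

Lemma submod_ker : submod (fun x => f x = 0).
Proof. by split=> [|a u v fu fv]; rewrite ?linear0 // linearP fu fv scaler0 addr0. Qed.

Lemma submod_im P : submod P -> submod (fun y => exists2 x, P x & f x = y).
Proof.
move=> [P0 sP]; split=> [|a _ _ [u Pu <-] [v Pv <-]]; first by exists 0; rewrite ?linear0.
by exists (a *: u + v); [apply: sP | rewrite linearP].
Qed.

Lemma submod_preim P : submod P -> submod (fun x => P (f x)).
Proof.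
by move=> [P0 sP]; split=> [|a u v Pu Pv]; rewrite ?linear0 ?linearP //; apply: sP.
Qed.

Lemma submod_range : submod (fun y => exists x, f x = y).
Proof.
split=> [|a _ _ [u <-] [v <-]]; first by exists 0; rewrite linear0.
by exists (a *: u + v); rewrite linearP.
Qed.

End SpanLinear.

Section SubmodOps.
Variables (A : pzRingType) (M : lmodType A).
Implicit Types P Q : M -> Prop.

Lemma submod_true : submod (fun _ : M => True). Proof. by []. Qed.

Lemma submod_zero : submod (fun x : M => x = 0).
Proof. by split=> // a u v -> ->; rewrite scaler0 addr0. Qed.

Lemma submod_and P Q : submod P -> submod Q -> submod (fun x => P x /\ Q x).
Proof.
move=> [P0 sP] [Q0 sQ]; split=> // a u v [Pu Qu] [Pv Qv].
by split; [apply: sP | apply: sQ].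
Qed.

Lemma submod_add P Q :
  submod P -> submod Q -> submod (fun x => exists2 y, P y & Q (x - y)).
Proof.
move=> [P0 sP] [Q0 sQ]; split=> [|a u v [x Px Qx] [y Py Qy]].
  by exists 0; rewrite ?subr0.
exists (a *: x + y); first exact: sP.
by have := sQ a _ _ Qx Qy; rewrite scalerBr addrACA opprD.
Qed.

End SubmodOps.

Section Noetherian.
Variable A : pzRingType.

Definition noeth (M : lmodType A) := forall P : M -> Prop, submod P -> fingen P.

(** Induction on [s]. The possible coefficients at the first generator [x] of vectors of [P] form a
    left ideal [J]. Finitely many vectors [w] of [P] realize generators of [J]; subtracting a
    combination of them from a vector of [P] leaves a vector in the span of the tail. *)
Lemma noeth_sub_span (M : lmodType A) (s : seq M) (P : M -> Prop) :
  noeth A^o -> submod P -> (forall v, P v -> lspan s v) -> fingen P.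
Proof.
move=> nA; elim: s P => [|x s IHs] P sP Ps; first by exists [::].
pose J (a : A) := exists2 v, P v & lspan s (v - a *: x).
have sJ : @submod A A^o J.
  split=> [|a u v [y Py sy] [z Pz sz]].
    by exists 0; [case: sP | rewrite scale0r subr0; apply: lspan0].
  exists (a *: y + z); first by apply: sP.2.
  have := (lspan_submod s).2 a _ _ sy sz.
  by rewrite scalerBr addrACA -opprD scalerDl scalerA.
have [r [rJ Jr]] := nA _ sJ.
have [t [tP Pt]] : fingen (fun v => P v /\ lspan s v).
  by apply: IHs => [|v []//]; apply: (submod_and sP); apply: lspan_submod.
have [w [wP wr]] : exists w : seq M, (forall v, v \in w -> P v) /\
    forall a : A, @lspan A A^o r a -> exists2 v, lspan w v & lspan s (v - a *: x).
  elim: (r) rJ => [|r0 r' IHr] rJ.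
    exists [::]; split=> // a /= ->; exists 0 => //; rewrite scale0r subr0.
    exact: lspan0.
  have [w [wP wr']] : exists w : seq M, (forall v, v \in w -> P v) /\
      forall a : A, @lspan A A^o r' a -> exists2 v, lspan w v & lspan s (v - a *: x).
    by apply: IHr => b br; apply: rJ; rewrite inE br orbT.
  have [v Pv sv] := rJ r0 (mem_head _ _).
  exists (v :: w); split=> [u|b [c /wr'[u wu su]]].
    by rewrite inE => /predU1P[->|/wP].
  exists (u + c *: v); first by exists c; rewrite addrK.
  have := submodD (lspan_submod s) su (submodZ (lspan_submod s) c sv).
  have -> // : u - (b - c * (r0 : A) : A) *: x + c *: (v - (r0 : A) *: x) = u + c *: v - b *: x.
  rewrite scalerBl scalerBr -scalerA opprB addrACA; congr (_ + _).
  by rewrite addrAC subrr add0r.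
exists (w ++ t); split; first by move=> v; rewrite mem_cat => /orP[/wP|/tP[]].
move=> v Pv.
have [a sa] := Ps v Pv.
have Ja : J a by exists v.
have [u wu su] := wr a (Jr a Ja).
have Pu : P u by apply: (lspan_min sP wP).
rewrite -(subrK u v); apply: (submodD (lspan_submod _)); last exact: lspan_catl.
apply/lspan_catr/Pt; split; first exact: submodB.
by have := submodB (lspan_submod s) sa su; rewrite opprB addrA subrK.
Qed.

End Noetherian.

(** * Comparison of zigzag equivalences on a class and on a larger class *)

Section Zigzags.
Variables (T : Type) (L : T -> T -> Prop).
Hypothesis Ltrans : forall a b c, L a b -> L b c -> L a c.

(** Every vertex of a nontrivial link has to be [ok], so a single relation [L] generates different
    equivalences over different classes. *)
Definition zigzag (ok : T -> Prop) :=
  clos_refl_sym_trans T (fun a b => [/\ ok a, ok b & L a b]).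

Lemma zigzag_step (ok : T -> Prop) a b : ok a -> ok b -> L a b -> zigzag ok a b.
Proof. by move=> *; apply: rst_step. Qed.

Lemma zigzag_ok (ok : T -> Prop) a b : zigzag ok a b -> ok a <-> ok b.
Proof. by elim=> {a b} [x y []|x|x y _ ->|x y z _ -> _ ->]. Qed.

Variables okP okQ : T -> Prop.
Hypothesis PQ : forall a, okP a -> okQ a.

(** Surjectivity and injectivity of the map from classes over [okP] to classes over [okQ]. *)
Definition zz_full :=
  (forall a, okQ a -> exists2 b, okP b & zigzag okQ a b) /\
  (forall a b, okP a -> okP b -> zigzag okQ a b -> zigzag okP a b).

(** Each vertex of a zigzag is replaced by an [okP] approximation. Along a link from [a] to [b], an
    approximation of [b] is also one of [a], and two approximations of the same vertex are joined
    through the [okP] vertex [e]. *)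
Lemma zz_full_approx :
    (forall a, okQ a -> exists2 b, okP b & L a b) ->
    (forall a b c, okQ a -> okP b -> okP c -> L a b -> L a c ->
      exists e, [/\ okP e, L e b & L e c]) ->
  zz_full.
Proof.
move=> ex amal; split=> [a oa|].
  by have [b ob Lab] := ex a oa; exists b => //; apply: zigzag_step => //; apply: PQ.
(* Quantifying over all approximations of both ends lets the induction change approximations at
   every intermediate vertex. *)
suff main a b : zigzag okQ a b -> okQ a -> forall x y, okP x -> okP y ->
    L a x -> L b y -> zigzag okP x y.
  move=> a b Pa Pb Eab; have [a' Pa' aa'] := ex a (PQ Pa).
  have [b' Pb' bb'] := ex b (PQ Pb).
  apply: (@rst_trans _ _ a a'); first exact: zigzag_step.
  apply: (@rst_trans _ _ a' b'); last by apply: rst_sym; apply: zigzag_step.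
  exact: main Eab (PQ Pa) _ _ Pa' Pb' aa' bb'.
have joint c x y : okQ c -> okP x -> okP y -> L c x -> L c y -> zigzag okP x y.
  move=> Qc Px Py cx cy; have [e [Pe ex1 ey]] := amal _ _ _ Qc Px Py cx cy.
  by apply: (@rst_trans _ _ x e); [apply: rst_sym|]; apply: zigzag_step.
elim=> {a b} [a b [Qa Qb ab]|a|a b Eab IH|a b c Eab IHab Ebc IHbc] Q0 x y.
- by move=> Px Py ax bY; apply: (joint a) => //; apply: Ltrans bY.
- exact: joint.
- by move=> Px Py bx ay *; apply: rst_sym; apply: IH => //; apply/(zigzag_ok Eab).
- move=> Px Py ax cy; have Qb : okQ b by apply/(zigzag_ok Eab).
  have [z Pz bz] := ex b Qb.
  by apply: (@rst_trans _ _ x z); [apply: IHab|apply: IHbc].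
Qed.

(** [s] carries zigzags over [okQ] to zigzags over [okP]. A general [a] is tied to [s a] only
    through [hat a], which receives links from both. *)
Lemma zz_full_retract (hat s : T -> T) :
    (forall a, okQ a -> [/\ okQ (hat a), okP (s a), L a (hat a) & L (s a) (hat a)]) ->
    (forall a b, okQ a -> okQ b -> L a b -> L (s a) (s b)) ->
    (forall a, okP a -> L a (s a)) ->
  zz_full.
Proof.
move=> hs sL Ls; split=> [a Qa|a b Pa Pb].
  have [Qh Ps ah sh] := hs a Qa; exists (s a) => //.
  apply: (@rst_trans _ _ _ (hat a)); first exact: zigzag_step.
  by apply: rst_sym; apply: zigzag_step => //; apply: PQ.
move=> Eab; have Es : zigzag okP (s a) (s b).
  elim: Eab => {a b Pa Pb} [a b [Qa Qb ab]|a|a b _|a b c _ IH1 _ IH2].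
  - have [_ Pa _ _] := hs a Qa; have [_ Pb _ _] := hs b Qb.
    by apply: zigzag_step => //; apply: sL.
  - exact: rst_refl.
  - exact: rst_sym.
  - exact: rst_trans IH1 IH2.
have Psa c : okP c -> okP (s c) by case/PQ/hs.
apply: (@rst_trans _ _ _ (s a)); first by apply: zigzag_step; auto.
by apply: rst_trans Es _; apply: rst_sym; apply: zigzag_step; auto.
Qed.

End Zigzags.

Lemma zigzag_flip T (L : T -> T -> Prop) ok a b :
  zigzag L ok a b <-> zigzag (fun x y => L y x) ok a b.
Proof.
split; elim=> {a b} [a b [? ? ?]|a|a b _|a b c _ IH1 _ IH2].
- by apply: rst_sym; apply: zigzag_step.
- exact: rst_refl.
- exact: rst_sym.
- exact: rst_trans IH1 IH2.
- by apply: rst_sym; apply: zigzag_step.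
- exact: rst_refl.
- exact: rst_sym.
- exact: rst_trans IH1 IH2.
Qed.

Lemma zz_full_flip T (L : T -> T -> Prop) okP okQ :
  zz_full (fun x y => L y x) okP okQ -> zz_full L okP okQ.
Proof.
move=> [H1 H2]; split=> [a /H1[b Pb Eab]|a b Pa Pb /zigzag_flip Eab].
  by exists b => //; apply/zigzag_flip.
by apply/zigzag_flip; apply: H2.
Qed.

Lemma zz_full_trans T (L : T -> T -> Prop) (okP okQ okR : T -> Prop) :
    (forall a, okP a -> okQ a) -> (forall a, okQ a -> okR a) ->
  zz_full L okP okQ -> zz_full L okQ okR -> zz_full L okP okR.
Proof.
move=> PQ QR [PQ1 PQ2] [QR1 QR2]; split=> [a /QR1[b /PQ1[c Pc bc] ab]|a b Pa Pb].
  exists c => //; apply: rst_trans ab _.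
  elim: bc => {c Pc} [x y [Qx Qy xy]|x|x y _|x y z _ IH1 _ IH2].
  - by apply: zigzag_step => //; apply: QR.
  - exact: rst_refl.
  - exact: rst_sym.
  - exact: rst_trans IH1 IH2.
by move=> /(QR2 _ _ (PQ _ Pa) (PQ _ Pb))/PQ2; apply.
Qed.

(** * Chains, replacement of the first map, and pushouts of exact sequences *)

Section Chains.
Variables (A : pzRingType) (M : lmodType A).

Definition lcomp (X Y Z : lmodType A) (g : {linear Y -> Z}) (f : {linear X -> Y}) :
  {linear X -> Z} := g \o f.

Definition lid (X : lmodType A) : {linear X -> X} := idfun.

Lemma ladder_comp d (X X' X'' : lmodType A) (phi : X -> X') (psi : X' -> X'')
    (c : chain M d X) (c' : chain M d X') (c'' : chain M d X'') :
  ladder phi c c' -> ladder psi c' c'' -> ladder (fun x => psi (phi x)) c c''.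
Proof.
elim: d X X' X'' phi psi c c' c'' => [|d IHd] X X' X'' phi psi c c' c'' /=.
  by move=> H1 H2 x; rewrite H1 H2.
move=> [f [fE Hf]] [g [gE Hg]]; exists (lcomp g f); split=> [x|].
  by rewrite /= fE gE.
exact: IHd Hf Hg.
Qed.

Lemma ladder_id d (X : lmodType A) (c : chain M d X) : ladder (fun x => x) c c.
Proof.
elim: d X c => [|d IHd] X c //=.
by exists (lid (tag c)); split=> //; apply: IHd.
Qed.

Lemma ladder_eq d (X X' : lmodType A) (phi psi : X -> X')
    (c : chain M d X) (c' : chain M d X') :
  phi =1 psi -> ladder phi c c' -> ladder psi c c'.
Proof. by move=> /funext ->. Qed.

Lemma exact_after_eq d (X : lmodType A) (im im' : X -> Prop) (c : chain M d X) :
  (forall x, im x <-> im' x) -> exact_after im c -> exact_after im' c.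
Proof. by move=> E; have -> : im = im' by apply/funext=> x; apply/propext. Qed.

Lemma terms_in_sub (P Q : lmodType A -> Prop) d (X : lmodType A) (c : chain M d X) :
  (forall Y, P Y -> Q Y) -> terms_in P c -> terms_in Q c.
Proof.
by move=> PQ; elim: d X c => //= d IHd X c [/PQ PY /IHd].
Qed.

(* The map out of the first term; its target is M itself when d = 0. *)
Definition cnext d : forall X : lmodType A, chain M d X ->
    {Y : lmodType A & {linear X -> Y}} :=
  if d is d'.+1 then fun X c => existT _ (tag c) (tagged c).1
  else fun X c => existT _ M c.

Definition creplace d : forall (X X' : lmodType A) (c : chain M d X),
    {linear X' -> tag (cnext c)} -> chain M d X' :=
  if d is d'.+1 then fun X X' c f => existT _ (tag c) (f, (tagged c).2)
  else fun X X' c f => f.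

Lemma exact_creplace d (X X' : lmodType A) (c : chain M d X)
    (f : {linear X' -> tag (cnext c)}) im im' :
    (forall x, f x = 0 <-> im' x) ->
    (forall y, (exists x, f x = y) <-> (exists x, tagged (cnext c) x = y)) ->
  exact_after im c -> exact_after im' (creplace f).
Proof.
case: d c f => [|d] c f /= f0 fim [_ H]; split=> //; first by move=> m; apply/fim.
by apply: exact_after_eq H => y; split=> /fim.
Qed.

Lemma terms_creplace P d (X X' : lmodType A) (c : chain M d X)
    (f : {linear X' -> tag (cnext c)}) : terms_in P c -> terms_in P (creplace f).
Proof. by case: d c f. Qed.

Lemma ladder_creplacer d (X X' : lmodType A) (c : chain M d X)
    (f : {linear X' -> tag (cnext c)}) (phi : X -> X') :
  (forall x, f (phi x) = tagged (cnext c) x) -> ladder phi c (creplace f).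
Proof.
case: d c f => [|d] c f /= fE; first by move=> x; rewrite fE.
by exists (lid (tag c)); split=> //; apply: ladder_id.
Qed.

(** The tail of the ladder is kept. Only its first square is new, and the hypothesis checks that
    square on elements of [X] having the same image. *)
Lemma ladder_creplacel d (X X' Y : lmodType A) (c : chain M d X)
    (f : {linear X' -> tag (cnext c)}) (e : chain M d Y)
    (phi : X -> Y) (phi' : X' -> Y) :
    (forall x', exists2 x, f x' = tagged (cnext c) x &
       tagged (cnext e) (phi x) = tagged (cnext e) (phi' x')) ->
  ladder phi c e -> ladder phi' (creplace f) e.
Proof.
case: d c e f => [|d] c e f /= fE.
  by move=> H x'; have [x -> E] := fE x'; rewrite H E.
move=> [g [gE Hg]]; exists g; split=> // x'.
by have [x -> E] := fE x'; rewrite gE E.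
Qed.

Lemma ladder_creplace2 d (X X' Y Y' : lmodType A) (c : chain M d X)
    (f : {linear X' -> tag (cnext c)}) (e : chain M d Y)
    (f' : {linear Y' -> tag (cnext e)}) (phi : X -> Y) (phi' : X' -> Y') :
    (forall x', exists2 x, f x' = tagged (cnext c) x &
       tagged (cnext e) (phi x) = f' (phi' x')) ->
  ladder phi c e -> ladder phi' (creplace f) (creplace f').
Proof.
case: d c e f f' => [|d] c e f f' /= fE.
  by move=> H x'; have [x -> E] := fE x'; rewrite H E.
move=> [g [gE Hg]]; exists g; split=> // x'.
by have [x -> E] := fE x'; rewrite gE E.
Qed.

Lemma ladder_next0 d (X Y : lmodType A) (c : chain M d X) (e : chain M d Y)
    (phi : X -> Y) x :
  ladder phi c e -> tagged (cnext c) x = 0 -> tagged (cnext e) (phi x) = 0.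
Proof.
case: d c e => [|d] c e /=; first by move=> -> .
by move=> [g [gE _]] cx0; rewrite -gE cx0 linear0.
Qed.

Lemma exact_next d (X : lmodType A) (c : chain M d X) im x :
  exact_after im c -> tagged (cnext c) x = 0 <-> im x.
Proof. by case: d c => [|d] c [H _]. Qed.

Section Pushout.
Variables (d : nat) (X X' : lmodType A) (phi : {linear X -> X'}).
Variable c : chain M d.+1 X.

Let Z := tag c.
Let g : {linear X -> Z} := (tagged c).1.
Let h : {linear Z -> _} := tagged (cnext (tagged c).2).

(* Restricting to h (g x) = 0, automatic when c is exact, makes the map induced
   by h on the quotient well defined for every c. *)
Definition push_rel (w : X' * Z) : Prop :=
  exists2 x, h (g x) = 0 & w = (phi x, - g x).

Lemma push_rel_submod : @submod A (X' * Z)%type push_rel.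
Proof.
split=> [|a _ _ [x hx ->] [y hy ->]].
  by exists 0; rewrite !linear0 // oppr0.
exists (a *: x + y); first by rewrite !linearP hx hy scaler0 addr0.
by congr (_, _); rewrite /= linearP //= opprD scalerN.
Qed.

Definition push_term : lmodType A := quoT push_rel_submod.

Definition push_inl : {linear X' -> push_term} :=
  @mklin A _ _ (fun x' => quo_pi push_rel_submod (x', 0)) (fun a u v =>
    eq_trans (congr1 (quo_pi push_rel_submod)
      (congr1 (fun z => (a *: u + v, z)) (esym (etrans (addr0 _) (scaler0 Z a)))))
    (linearP (quo_pi push_rel_submod) a (u, 0) (v, 0))).

Definition push_inr : {linear Z -> push_term} :=
  @mklin A _ _ (fun z => quo_pi push_rel_submod (0, z)) (fun a u v =>
    eq_trans (congr1 (quo_pi push_rel_submod)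
      (congr1 (fun x => (x, a *: u + v)) (esym (etrans (addr0 _) (scaler0 X' a)))))
    (linearP (quo_pi push_rel_submod) a (0, u) (0, v))).

Lemma push_out_linear : linear (fun w : X' * Z => h w.2).
Proof. by move=> a u v; rewrite /= linearP. Qed.

Lemma push_out0 w : push_rel w -> mklin push_out_linear w = 0.
Proof. by move=> [x hx ->] /=; rewrite linearN hx oppr0. Qed.

Definition push_out : {linear push_term -> _} := quo_lift push_rel_submod push_out0.

Definition push : chain M d.+1 X' :=
  existT _ push_term (push_inl, creplace push_out).

Lemma push_outE w : push_out (quo_pi push_rel_submod w) = h w.2.
Proof. exact: quo_liftE. Qed.

Lemma push_square x : h (g x) = 0 -> push_inl (phi x) = push_inr (g x).
Proof.
move=> hx; apply/(quo_mk_eq push_rel_submod (phi x, 0) (0, g x)).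
by exists x => //=; congr (_, _); rewrite /= ?subr0 ?sub0r.
Qed.

Lemma push_pi w :
  quo_pi push_rel_submod w = push_inl w.1 + push_inr w.2.
Proof.
case: w => u v; rewrite -[RHS](linearD (quo_pi push_rel_submod) (u, 0) (0, v)).
by congr (quo_pi _ (_, _)); rewrite /= ?addr0 ?add0r.
Qed.

Lemma push_exact im : exact_after im c ->
  exact_after (fun x' => exists2 x, im x & phi x = x') push.
Proof.
move=> [g0 ec]; have hg x : h (g x) = 0 by apply/(exact_next _ ec); exists x.
split=> [x'|] /=.
  split=> [/quo_pi_eq0[x _ [-> /esym/eqP]]|[x /g0 gx <-]].
    by rewrite oppr_eq0 => /eqP/g0; exists x.
  by apply: etrans (push_square (hg x)) _; rewrite gx; apply: (linear0 push_inr).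
apply: exact_creplace (ec) => [w|y].
  split=> [|[x' <-]]; last by rewrite push_outE linear0.
  have [[x' z] <-] := quo_pi_surj w; rewrite push_outE => /(exact_next _ ec)[x Ex].
  exists (x' + phi x); rewrite push_pi; apply: etrans (linearD push_inl _ _) _.
  by congr (_ + _); apply: etrans (push_square (hg x)) _; rewrite Ex.
split=> [[w <-]|[z <-]]; last by exists (quo_pi push_rel_submod (0, z)); rewrite push_outE.
by have [[x' z] <-] := quo_pi_surj w; exists z; rewrite push_outE.
Qed.

Lemma push_ladder im : exact_after im c -> ladder phi c push.
Proof.
move=> [g0 ec]; exists push_inr; split=> [x|].
  by rewrite -push_square //; apply/(exact_next _ ec); exists x.
by apply: ladder_creplacer => z; apply: push_outE.
Qed.

(** The universal property of the pushout: [psi'] and the first map [t] of the given ladder agree on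
    [X] and glue to a map out of [push_term]. *)
Lemma push_ladder_out (Y : lmodType A) (e : chain M d.+1 Y) im'
    (psi : {linear X -> Y}) (psi' : {linear X' -> Y}) :
    exact_after im' e -> (forall x, psi' (phi x) = psi x) ->
  ladder psi c e -> ladder psi' push e.
Proof.
move=> [_ ee] E [t [tE Ht]].
have tl : linear (fun w : X' * Z => (tagged e).1 (psi' w.1) + t w.2).
  by move=> a u v; rewrite /= !linearP /= scalerDr addrACA.
have t0 w : push_rel w -> mklin tl w = 0.
  by move=> [x _ ->] /=; rewrite E -tE -linearD subrr linear0.
exists (quo_lift push_rel_submod t0); split=> [x'|].
  by rewrite (quo_liftE push_rel_submod t0) /= linear0 addr0.
apply: ladder_creplacel Ht => w; have [[x' z] <-] := quo_pi_surj w.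
exists z; rewrite ?push_outE // (quo_liftE push_rel_submod t0) /= linearD.
(* Consecutive maps of the exact chain [e] compose to zero, so the component in [X'] contributes
   nothing. *)
suff -> : tagged (cnext (tagged e).2) ((tagged e).1 (psi' x')) = 0 by rewrite add0r.
by apply/(exact_next _ ee); exists (psi' x').
Qed.

Lemma push_terms (P : lmodType A -> Prop) :
  P push_term -> terms_in P c -> terms_in P push.
Proof. by move=> PT [_ tc]; split=> //; apply: terms_creplace. Qed.

End Pushout.

Lemma push_functor d (X X' Y Y' : lmodType A) (phi : {linear X -> X'})
    (psi : {linear Y -> Y'}) (al : X -> Y) (be : {linear X' -> Y'})
    (c : chain M d.+1 X) (e : chain M d.+1 Y) :
    (forall x, be (phi x) = psi (al x)) ->
  ladder al c e -> ladder be (push phi c) (push psi e).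
Proof.
move=> E [t [tE Ht]].
have tl : linear (fun w : X' * tag c => quo_pi (push_rel_submod psi e) (be w.1, t w.2)).
  move=> a u v; rewrite -linearP; apply: (congr1 (quo_pi (push_rel_submod psi e))).
  by congr (_, _); apply: linearP.
have t0 (w : X' * tag c) : push_rel phi w -> mklin tl w = 0.
  move=> [x hx ->] /=; apply/(quo_pi_eq0 (push_rel_submod psi e)).
  exists (al x); last by rewrite E linearN tE.
  by rewrite -tE; apply: ladder_next0 Ht hx.
exists (quo_lift (push_rel_submod phi c) t0); split=> [x'|].
  by rewrite (quo_liftE (push_rel_submod phi c) t0) /= linear0.
apply: ladder_creplace2 Ht => w; have [[x' z] <-] := quo_pi_surj w.
exists z; first exact: push_outE.
rewrite (quo_liftE (push_rel_submod phi c) t0) [RHS]push_outE.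
by [].
Qed.

End Chains.

(** * Passing from arbitrary modules to torsion modules *)

Section Replacement.
Variables (A : pzRingType) (M : lmodType A).
Variables (C : lmodType A -> lmodType A) (eta : forall X : lmodType A, {linear X -> C X}).
Variable Cmap : forall X Y : lmodType A, {linear X -> Y} -> {linear C X -> C Y}.
Hypothesis eta_natural : forall (X Y : lmodType A) (f : {linear X -> Y}) x,
  Cmap f (eta X x) = eta Y (f x).
Hypothesis eta_inj : forall X, injective (eta X).

(* Replaces each term but the last by its image under C, pushing out the
   remainder of the sequence at each step. *)
Fixpoint hat d : forall X : lmodType A, chain M d.+1 X -> chain M d.+1 X :=
  if d is d'.+1 then fun X c =>
    existT _ (C (tag c)) (lcomp (eta _) (tagged c).1, hat (push (eta _) (tagged c).2))
  else fun X c => c.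

Lemma exact_lcomp_eta d (X : lmodType A) im (c : chain M d.+2 X) :
    exact_after im c ->
  (forall x, eta _ ((tagged c).1 x) = 0 <-> im x) /\
  exact_after (fun z => exists x, lcomp (eta _) (tagged c).1 x = z)
    (push (eta (tag c)) (tagged c).2).
Proof.
move=> [c0 ec]; split=> [x|].
  rewrite -c0; split=> [E|->]; last exact: linear0.
  by apply: eta_inj; rewrite E linear0.
apply: exact_after_eq (push_exact (eta _) ec) => z; split.
  by move=> [_ [x <-] <-]; exists x.
by move=> [x <-]; exists ((tagged c).1 x) => //; exists x.
Qed.

Lemma hat_exact d (X : lmodType A) im (c : chain M d.+1 X) :
  exact_after im c -> exact_after im (hat c).
Proof.
elim: d X im c => [|d IHd] X im c ec //.
by have [c0 ec'] := exact_lcomp_eta ec; split=> //; apply: IHd.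
Qed.

Lemma hat_ladder d (X : lmodType A) im (c : chain M d.+1 X) :
  exact_after im c -> ladder (fun x => x) c (hat c).
Proof.
elim: d X im c => [|d IHd] X im c ec; first exact: ladder_id.
have [_ ec'] := exact_lcomp_eta ec; exists (eta _); split=> //.
apply: ladder_comp (IHd _ _ _ ec').
by case: ec => _; apply: push_ladder.
Qed.

Lemma hat_functor d (X Y : lmodType A) (phi : X -> Y)
    (c : chain M d.+1 X) (e : chain M d.+1 Y) :
  ladder phi c e -> ladder phi (hat c) (hat e).
Proof.
elim: d X Y phi c e => [|d IHd] X Y phi c e //= [t [tE Ht]].
exists (Cmap t); split=> [x|]; first by rewrite eta_natural tE.
by apply: IHd; apply: push_functor Ht => x; rewrite eta_natural.
Qed.

Variable G : forall X : lmodType A, X -> Prop.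
Arguments G {X}.
Hypothesis G_submod : forall X, submod (@G X).
Hypothesis G_map : forall (X Y : lmodType A) (f : {linear X -> Y}) x, G x -> G (f x).
Hypothesis G_inj : forall (X Y : lmodType A) (f : {linear X -> Y}) x, injective f -> G (f x) -> G x.

Definition is_G (X : lmodType A) := forall x : X, G x.

Definition gpart (X : lmodType A) : lmodType A := subT (G_submod X).

Definition gincl (X : lmodType A) : {linear gpart X -> X} := sub_incl (G_submod X).

Lemma gpart_G X : is_G (gpart X).
Proof.
move=> x; apply: (G_inj (f := gincl X)); first exact: sub_incl_inj.
exact: sub_inclP.
Qed.

Lemma gcomp_G (X Y Z : lmodType A) (z : {linear Z -> X}) (f : {linear X -> Y}) :
  is_G Z -> forall x, G (lcomp f z x).
Proof. by move=> GZ x; apply: G_map. Qed.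

(** A torsion module [Z] over the source [X] is carried along because the recursion moves from each
    term to its torsion part. *)
Fixpoint gchain d : forall (X Z : lmodType A) (z : {linear Z -> X}), is_G Z ->
    chain M d X -> chain M d Z :=
  if d is d'.+1 then fun X Z z GZ c =>
    existT _ (gpart (tag c)) (sub_lift (G_submod _) (gcomp_G z (tagged c).1 GZ),
      gchain (gincl _) (@gpart_G _) (tagged c).2)
  else fun X Z z GZ c => lcomp c z.

Lemma gchain_terms d (X Z : lmodType A) (z : {linear Z -> X}) (GZ : is_G Z)
    (c : chain M d X) : terms_in is_G (gchain z GZ c).
Proof. by elim: d X Z z GZ c => //= d IHd X Z z GZ c; split; first exact: gpart_G. Qed.

Lemma gchain_ladder d (X Z : lmodType A) (z : {linear Z -> X}) (GZ : is_G Z)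
    (c : chain M d X) : ladder z (gchain z GZ c) c.
Proof.
by elim: d X Z z GZ c => [|d IHd] X Z z GZ c //=; exists (gincl _); split.
Qed.

Lemma gchain_functor d (X Z X' Z' : lmodType A) (z : {linear Z -> X}) (GZ : is_G Z)
    (z' : {linear Z' -> X'}) (GZ' : is_G Z') (phi : X -> X') (psi : Z -> Z')
    (c : chain M d X) (c' : chain M d X') :
    (forall x, z' (psi x) = phi (z x)) -> ladder phi c c' ->
  ladder psi (gchain z GZ c) (gchain z' GZ' c').
Proof.
elim: d X Z X' Z' z GZ z' GZ' phi psi c c' => [|d IHd] X Z X' Z' z GZ z' GZ' phi psi c c' E /=.
  by move=> H x; rewrite H E.
move=> [t [tE Ht]].
exists (sub_lift (G_submod _) (gcomp_G (gincl _) t (@gpart_G _))); split=> [x|].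
  by apply: (@sub_incl_inj _ _ _ (G_submod _)); rewrite /= tE E.
exact: IHd Ht.
Qed.

Lemma gchain_unit d (X Z X' : lmodType A) (z : {linear Z -> X}) (GZ : is_G Z)
    (phi : X' -> X) (psi : X' -> Z) (c : chain M d X') (e : chain M d X) :
    (forall x, z (psi x) = phi x) -> terms_in is_G c -> ladder phi c e ->
  ladder psi c (gchain z GZ e).
Proof.
elim: d X Z X' z GZ phi psi c e => [|d IHd] X Z X' z GZ phi psi c e E /=.
  by move=> _ H x; rewrite H E.
move=> [Gc Tc] [t [tE Ht]].
exists (sub_lift (G_submod _) (gcomp_G (lid _) t Gc)); split=> [x|].
  by apply: (@sub_incl_inj _ _ _ (G_submod _)); rewrite /= tE E.
exact: IHd Tc Ht.
Qed.

(* K im expresses that the submodule im is acyclic for G. *)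
Variable K : forall X : lmodType A, (X -> Prop) -> Prop.
Arguments K {X}.
Hypothesis K_lift : forall (X Y : lmodType A) (f : {linear X -> Y}),
  K (fun x => f x = 0) -> forall x, G (f x) -> exists2 x', G x' & f x' = f x.
Hypothesis K_range : forall (X Y : lmodType A) (f : {linear C X -> Y}),
  K (fun x => f x = 0) -> K (fun y => exists x, f x = y).
Hypothesis K_inj : forall (X X' Y : lmodType A) (f : {linear X -> Y}) (j : {linear Y -> X'}),
  injective j -> K (fun y => exists x, f x = y) ->
  K (fun y => exists x, lcomp j f x = y).
Hypothesis K_G : forall (X Y : lmodType A) (f : {linear X -> Y}),
  is_G X -> injective f -> K (fun y => exists x, f x = y).

(** Exactness of the torsion parts means that torsion elements of an image lift to torsion elements.
    [K_lift] provides this when the kernel is acyclic. [K_range] makes the next image acyclic after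
    each coinduced term, and this also settles the last map, whose kernel is such an image; hence
    the last term can stay as it is. *)
Lemma gchain_hat_exact d (X Z : lmodType A) (z : {linear Z -> X}) (GZ : is_G Z)
    im (c : chain M d.+1 X) :
    is_G M -> exact_after im c ->
    (forall x, G x -> exists y, z y = x) ->
    (forall x, G ((tagged c).1 x) -> exists2 x', G x' & (tagged c).1 x' = (tagged c).1 x) ->
    K (fun y => exists x, (tagged c).1 x = y) ->
  exact_after (fun x => im (z x)) (gchain z GZ (hat c)).
Proof.
move=> GM; have kerE (X1 Y1 : lmodType A) (f : {linear X1 -> Y1}) im1 :
    (forall x, f x = 0 <-> im1 x) -> K im1 -> K (fun x => f x = 0).
  by move=> E; have -> // : (fun x => f x = 0) = im1; apply/funext=> x; apply/propext.
have subE (Y1 : lmodType A) (x : gpart Y1) : x = 0 <-> gincl Y1 x = 0.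
  split=> [->|]; first exact: linear0.
  by rewrite -(linear0 (gincl Y1)) => /sub_incl_inj.
elim: d X Z z GZ im c => [|d IHd] X Z z GZ im c ec zs lift Kc.
  case: ec => c0 [ec surj]; split=> [x|].
    by rewrite subE; apply: c0.
  split=> [y|m]; last first.
    have [y Ey] := surj m.
    have [y' Gy' Ey'] := K_lift (kerE _ _ _ _ ec Kc) (GM ((tagged c).2 y)).
    have [w Ew] := sub_incl_ex (G_submod _) Gy'; exists w.
    by rewrite -Ey -Ey' -Ew.
  split=> [/ec[x Ex]|[x <-]]; last by apply/ec; exists (z x).
  have [x' Gx' Ex'] : exists2 x', G x' & (tagged c).1 x' = (tagged c).1 x.
    by apply: lift; rewrite Ex; apply: sub_inclP.
  have [w Ew] := zs _ Gx'; exists w.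
  by apply: (@sub_incl_inj _ _ _ (G_submod _)); rewrite /= Ew Ex' Ex.
have [c0 ec'] := exact_lcomp_eta ec.
split=> [x|]; first by rewrite subE; apply: c0.
have ec1 := ec'.1.
(* After the pushout, the kernel of the next map is the image of [X] inside the new term, acyclic by
   [K_inj] because [eta] is injective. *)
have K1 := kerE _ _ _ _ ec1 (K_inj (@eta_inj _) Kc).
have := IHd _ _ (gincl _) (@gpart_G _) _ _ ec' _ (K_lift K1) (K_range K1).
move=> /(_ (sub_incl_ex _)); apply: exact_after_eq => y; split=> [[x Ex]|[x <-]].
  have [x' Gx' Ex'] : exists2 x', G x' & (tagged c).1 x' = (tagged c).1 x.
    apply: lift; apply: (G_inj (@eta_inj _)); rewrite -[eta _ _]/(lcomp _ _ x) Ex.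
    exact: sub_inclP.
  have [w Ew] := zs _ Gx'; exists w.
  by apply: (@sub_incl_inj _ _ _ (G_submod _)); apply: etrans Ex; rewrite /= Ew Ex'.
by exists (z x).
Qed.

(** The retraction takes the torsion parts of [hat c]. It is included in [hat c], which also
    receives [c]; and when the terms of [c] are torsion, the ladder from [c] to [hat c] factors
    through it. *)
Lemma zz_full_torsion (N : lmodType A) d : is_G M -> is_G N ->
  zz_full (@ladder A M d.+1 N N (fun x => x))
    (fun c => exact_after (fun x => x = 0) c /\ terms_in is_G c)
    (fun c => exact_after (fun x => x = 0) c /\ terms_in (@all_modules A) c).
Proof.
move=> GM GN.
have T_all (c : chain M d.+1 N) : terms_in (@all_modules A) c.
  by elim: d.+1 (N : lmodType A) c => //= n IHn X c; split.
apply: (@zz_full_retract _ _ _ _ _ (@hat d N) (fun c => gchain (lid N) GN (hat c))).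
- by move=> c [ec Tc].
- move=> c [ec _]; split; first by split; [apply: hat_exact|].
  + split; last exact: gchain_terms.
    apply: (gchain_hat_exact (z := lid N) GN (im := fun x => x = 0)) => // [x _|x _|].
      by exists x.
      by exists x.
    apply: K_G => // x y Exy; apply/eqP; rewrite -subr_eq0; apply/eqP/ec.1.
    by rewrite linearB Exy subrr.
  + exact: hat_ladder ec.
  + exact: (gchain_ladder (lid N) GN (hat c)).
- move=> a b _ _ Lab; apply: (@gchain_functor d.+1 N N N N (lid N) GN (lid N) GN (fun x => x)) => //.
  exact: hat_functor.
move=> a [ea Ta]; apply: (@gchain_unit d.+1 N N N (lid N) GN (fun x => x)) => //.
exact: hat_ladder ea.
Qed.

End Replacement.

Section PairMap.
Variables (A : pzRingType) (X Y Z : lmodType A).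

Lemma pair_linear (f : {linear X -> Y}) (g : {linear X -> Z}) :
  linear (fun x => (f x, g x)).
Proof. by move=> a u v; congr (_, _); apply: linearP. Qed.

Definition lpair f g : {linear X -> (Y * Z)%type} := mklin (pair_linear f g).

Lemma copair_linear (f : {linear Y -> X}) (g : {linear Z -> X}) :
  linear (fun w : Y * Z => f w.1 + g w.2).
Proof. by move=> a u v; rewrite /= !linearP scalerDr addrACA. Qed.

Definition lcopair f g : {linear (Y * Z)%type -> X} := mklin (copair_linear f g).

End PairMap.

Lemma zero_linear (A : pzRingType) (X Y : lmodType A) : linear (fun _ : X => 0 : Y).
Proof. by move=> a u v; rewrite scaler0 addr0. Qed.

Definition lzero (A : pzRingType) (X Y : lmodType A) : {linear X -> Y} :=
  mklin (@zero_linear A X Y).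

Lemma linear_inj (A : pzRingType) (X Y : lmodType A) (f : {linear X -> Y}) :
  (forall x, f x = 0 -> x = 0) -> injective f.
Proof.
move=> f0 x y Exy; apply/eqP; rewrite -subr_eq0; apply/eqP/f0.
by rewrite linearB Exy subrr.
Qed.

Definition ccons (A : pzRingType) (M : lmodType A) d (X Y : lmodType A)
  (f : {linear X -> Y}) (c : chain M d Y) : chain M d.+1 X := existT _ Y (f, c).

(** * Approximation of exact sequences by quotients and by subobjects *)

Section ClosureConditions.
Variables (A : pzRingType) (M : lmodType A) (P Q : lmodType A -> Prop).
Hypothesis PQ : forall X, P X -> Q X.
Hypothesis P_sub : forall (X Y : lmodType A) (f : {linear X -> Y}),
  injective f -> P Y -> P X.
Hypothesis P_img : forall (X Y : lmodType A) (f : {linear X -> Y}),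
  (forall y, exists x, f x = y) -> P X -> P Y.
Hypothesis P_prod : forall X Y : lmodType A, P X -> P Y -> P (X * Y)%type.

Section Quotients.
Hypothesis P_ext : forall (X Y Z : lmodType A) (f : {linear X -> Y})
    (g : {linear Y -> Z}), (forall y, g y = 0 -> exists x, f x = y) ->
  P X -> P Z -> P Y.
Hypothesis Q_img : forall (X Y : lmodType A) (f : {linear X -> Y}),
  (forall y, exists x, f x = y) -> Q X -> Q Y.
Hypothesis Q_prod : forall X Y : lmodType A, Q X -> Q Y -> Q (X * Y)%type.
(** A module of the larger class enters the smaller one after division by a submodule that misses
    the image of [f]. *)
Hypothesis Q_stable : forall (X Y : lmodType A) (f : {linear X -> Y}), P X -> Q Y ->
  exists K (sK : submod K), (forall x, K (f x) -> f x = 0) /\ P (quoT sK).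

(** With [b] false nothing is imposed; with [b] true, ladders to two prescribed sequences have to
    factor. One induction thus serves both for existence and for amalgamation. *)
Let target (b : bool) d (X Y : lmodType A) (phi : X -> Y) (c : chain M d X)
    (e : chain M d Y) :=
  b -> [/\ exists im, exact_after im e, terms_in P e & ladder phi c e].

(** Intersecting [K] with the kernels of [t1] and [t2] makes both maps factor through the quotient,
    which still lies in [P] since it embeds in a product of three modules of [P]. *)
Let stable2 (b : bool) (X Y Y1 Y2 : lmodType A) (f : {linear X -> Y})
    (t1 : {linear Y -> Y1}) (t2 : {linear Y -> Y2}) :
    P X -> Q Y -> (b -> P Y1 /\ P Y2) ->
  exists K (sK : submod K), [/\ forall x, K (f x) -> f x = 0, P (quoT sK) &
    b -> forall y, K y -> t1 y = 0 /\ t2 y = 0].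
Proof.
move=> PX QY; have [K [sK [Kf PK]]] := Q_stable f PX QY.
case: b => [/(_ isT)[P1 P2]|_]; last by exists K, sK.
have sK' := submod_and sK (submod_and (submod_ker t1) (submod_ker t2)).
exists _, sK'; split=> [x [/Kf]|| _ y []] //.
have h0 y : K y /\ t1 y = 0 /\ t2 y = 0 -> lpair (quo_pi sK) (lpair t1 t2) y = 0.
  by move=> [/(quo_pi_eq0 sK) Ky [t1y t2y]]; congr (_, (_, _)).
apply: (P_sub (f := quo_lift sK' h0)); last by apply: P_prod => //; apply: P_prod.
apply: linear_inj => w; have [y <-] := quo_pi_surj w; rewrite quo_liftE.
move=> Ey; apply/quo_pi_eq0; split; first exact/(quo_pi_eq0 sK y)/(congr1 fst Ey).
by split; [apply: (congr1 (fst \o snd) Ey)|apply: (congr1 (snd \o snd) Ey)].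
Qed.

(** From left to right: divide the first term by the submodule of [stable2], push out the rest along
    the projection, and recurse. The last term is in [P] by [P_ext], being squeezed between the
    image of the [P]-module on its left and [M]. *)
Lemma quotient_approx d (b : bool) (X X1 X2 : lmodType A) im (c : chain M d.+1 X)
    (phi1 : {linear X -> X1}) (phi2 : {linear X -> X2})
    (e1 : chain M d.+1 X1) (e2 : chain M d.+1 X2) :
    P M -> P X -> exact_after im c -> terms_in Q c ->
    target b phi1 c e1 -> target b phi2 c e2 ->
  exists c', [/\ exact_after im c', terms_in P c', ladder (fun x => x) c c' &
    b -> ladder phi1 c' e1 /\ ladder phi2 c' e2].
Proof.
move=> PM; elim: d X X1 X2 im c phi1 phi2 e1 e2 => [|d IHd] X X1 X2 im c phi1 phi2 e1 e2 PX ec Tc H1 H2.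
  exists c; split=> //; last by move=> tb; case: (H1 tb) => _ _ ?; case: (H2 tb).
    case: ec => c0 [ep _]; split=> //.
    by apply: (P_ext (f := (tagged c).1) (g := (tagged c).2)) => // y /ep.
  exact: ladder_id.
pose Y := tag c; pose f : {linear X -> Y} := (tagged c).1.
pose c1 : chain M d.+1 Y := (tagged c).2; pose g1 : chain M d.+1 (tag e1) := (tagged e1).2.
pose g2 : chain M d.+1 (tag e2) := (tagged e2).2.
have f0 x : f x = 0 <-> im x := ec.1 x.
have ec1 : exact_after (fun y => exists x, f x = y) c1 := ec.2.
have QY : Q Y := Tc.1; have Tc1 : terms_in Q c1 := Tc.2.
have [t1 [t1E L1]] : exists t1 : {linear Y -> tag e1},
    (b -> forall x, t1 (f x) = (tagged e1).1 (phi1 x)) /\ (b -> ladder t1 c1 g1).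
  have [/H1[_ _ [t [tE Ht]]]|/negP nb] := boolP b; [by exists t|].
  by exists (lzero _ _); split=> tb; case: nb.
have [t2 [t2E L2]] : exists t2 : {linear Y -> tag e2},
    (b -> forall x, t2 (f x) = (tagged e2).1 (phi2 x)) /\ (b -> ladder t2 c1 g2).
  have [/H2[_ _ [t [tE Ht]]]|/negP nb] := boolP b; [by exists t|].
  by exists (lzero _ _); split=> tb; case: nb.
have P12 : b -> P (tag e1) /\ P (tag e2).
  by move=> tb; have [_ [? _] _] := H1 tb; have [_ [? _] _] := H2 tb.
have [K [sK [Kf PK Kt]]] := stable2 f t1 t2 PX QY P12.
pose pi := quo_pi sK; pose f' := lcomp pi f.
have [s1 s1E] : exists s1 : {linear quoT sK -> tag e1}, b -> forall y, s1 (pi y) = t1 y.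
  have [tb|/negP nb] := boolP b; last by exists (lzero _ _) => tb; case: nb.
  have t10 y : K y -> t1 y = 0 by move=> /(Kt tb y)[].
  by exists (quo_lift sK t10) => _ y; apply: quo_liftE.
have [s2 s2E] : exists s2 : {linear quoT sK -> tag e2}, b -> forall y, s2 (pi y) = t2 y.
  have [tb|/negP nb] := boolP b; last by exists (lzero _ _) => tb; case: nb.
  have t20 y : K y -> t2 y = 0 by move=> /(Kt tb y)[].
  by exists (quo_lift sK t20) => _ y; apply: quo_liftE.
have ec1' := push_exact pi ec1.
have Tpush : terms_in Q (push pi c1).
  apply: push_terms (Tc1); apply: (Q_img (f := quo_pi _)); first exact: quo_pi_surj.
  by apply: Q_prod; [apply: PQ|have [] := Tc1].
have tgt1 : target b s1 (push pi c1) g1.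
  move=> tb; have [[im1 [_ ee]] [_ Te] _] := H1 tb; split=> //; first by eexists; apply: ee.
  by apply: (push_ladder_out ee) (L1 tb) => y; apply: s1E.
have tgt2 : target b s2 (push pi c1) g2.
  move=> tb; have [[im1 [_ ee]] [_ Te] _] := H2 tb; split=> //; first by eexists; apply: ee.
  by apply: (push_ladder_out ee) (L2 tb) => y; apply: s2E.
have [c' [ec' Tc' Lc' Le']] := IHd _ _ _ _ _ s1 s2 g1 g2 PK ec1' Tpush tgt1 tgt2.
exists (ccons f' c'); split=> //=.
- split=> [x|].
    rewrite -f0; split=> [/(quo_pi_eq0 sK)/Kf //|fx0].
    by rewrite /f' /= fx0; apply: (linear0 pi).
  apply: exact_after_eq ec' => y; split=> [[_ [x <-] <-]|[x <-]]; first by exists x.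
  by exists (f x) => //; exists x.
- exists pi; split=> //; exact: ladder_comp (push_ladder pi ec1) Lc'.
- move=> tb; have [L1' L2'] := Le' tb; split.
    by exists s1; split=> // x; rewrite -t1E // -s1E.
  by exists s2; split=> // x; rewrite -t2E // -s2E.
Qed.

Lemma zz_full_quotient (N : lmodType A) d : P M -> P N ->
  zz_full (@ladder A M d.+1 N N (fun x => x))
    (fun c => exact_after (fun x => x = 0) c /\ terms_in P c)
    (fun c => exact_after (fun x => x = 0) c /\ terms_in Q c).
Proof.
move=> PM PN; apply: zz_full_approx.
- exact: ladder_comp.
- by move=> a [ea Ta]; split=> //; apply: terms_in_sub Ta.
- move=> c [ec Tc].
  have [||c' [ec' Tc' L _]] := @quotient_approx d false _ _ _ _ c (lid N) (lid N) c c PM PN ec Tc.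
  + by [].
  + by [].
  + by exists c'.
move=> c e1 e2 [ec Tc] [ee1 T1] [ee2 T2] L1 L2.
have [||c' [ec' Tc' L]] := @quotient_approx d true _ _ _ _ c (lid N) (lid N) e1 e2 PM PN ec Tc.
- by move=> _; split=> //; exists (fun x => x = 0).
- by move=> _; split=> //; exists (fun x => x = 0).
by move=> /(_ isT)[L1' L2']; exists c'.
Qed.

End Quotients.

Section Subobjects.
Hypothesis Q_sub : forall (X Y : lmodType A) (f : {linear X -> Y}),
  injective f -> Q Y -> Q X.
Hypothesis Q_lift : forall (X Y : lmodType A) (f : {linear X -> Y}),
  (forall y, exists x, f x = y) -> Q X -> P Y ->
  exists (Z : lmodType A) (t : {linear Z -> X}), P Z /\ forall y, exists z, f (t z) = y.

Let source (b : bool) d (X Y : lmodType A) (phi : Y -> X) (e : chain M d Y)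
    (c : chain M d X) :=
  b -> [/\ P Y, terms_in P e & ladder phi e c].

(** The submodule generated by all given images. Its minimality is recorded so that a condition on
    the whole submodule can later be checked on those images. *)
Let span_images (b : bool) (X Y Z Y1 Y2 : lmodType A) (f : {linear Y -> X})
    (g : {linear Z -> X}) (t1 : {linear Y1 -> X}) (t2 : {linear Y2 -> X}) :
    P Y -> P Z -> (b -> P Y1 /\ P Y2) ->
  exists R (sR : submod R), [/\ P (subT sR), forall y, R (f y), forall z, R (g z),
    b -> (forall y, R (t1 y)) /\ (forall y, R (t2 y)) &
    forall S, submod S -> (forall y, S (f y)) -> (forall z, S (g z)) ->
      (b -> (forall y, S (t1 y)) /\ (forall y, S (t2 y))) -> forall x, R x -> S x].
Proof.
move=> PY PZ; have img (W : lmodType A) (h : {linear W -> X}) : P W ->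
    P (subT (submod_range h)).
  move=> PW; have hR x : exists y, h y = h x by exists x.
  apply: (P_img (f := sub_lift (submod_range h) hR)) PW => y.
  have [x Ex] := sub_inclP y; exists x.
  by apply: (@sub_incl_inj _ _ _ (submod_range h)); rewrite sub_liftE.
case: b => [/(_ isT)[P1 P2]|_].
  pose h := lcopair (lcopair f g) (lcopair t1 t2).
  exists _, (submod_range h); split=> //.
  - by apply: (img); do ?apply: P_prod.
  - by move=> y; exists ((y, 0), (0, 0)); rewrite /= !linear0 !addr0.
  - by move=> z; exists ((0, z), (0, 0)); rewrite /= !linear0 !(addr0, add0r).
  - move=> _; split=> y; first by exists ((0, 0), (y, 0)); rewrite /= !linear0 !(addr0, add0r).
    by exists ((0, 0), (0, y)); rewrite /= !linear0 !(addr0, add0r).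
  - move=> S sS Sf Sg /(_ isT)[S1 S2] x [w <-] /=.
    by apply: (submodD sS); apply: (submodD sS).
pose h := lcopair f g; exists _, (submod_range h); split=> //.
- by apply: (img); apply: P_prod.
- by move=> y; exists (y, 0); rewrite /= linear0 addr0.
- by move=> y; exists (0, y); rewrite /= linear0 add0r.
- by move=> S sS Sf Sg _ x [w <-]; apply: (submodD sS).
Qed.

(** The first vertical map is left open: the submodule containing its image is only fixed one step
    later in the recursion. *)
Definition ladder_lift d (X Y : lmodType A) (phi : Y -> X) (R : X -> Prop)
    (sR : submod R) (e : chain M d Y) (c : chain M d (subT sR)) :=
  forall psi : {linear Y -> subT sR}, (forall y, sub_incl sR (psi y) = phi y) ->
    ladder psi e c.

(** From right to left: the tail is approximated by the induction hypothesis, then a [P]-submodule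
    of [X] is chosen that covers the reachable part of the tail. The map [g] prescribes an image
    that the chosen submodule has to contain, namely what arrives from the left. *)
Lemma subobject_approx d (b : bool) (X X1 X2 Z : lmodType A) im (c : chain M d X)
    (phi1 : {linear X1 -> X}) (phi2 : {linear X2 -> X}) (g : {linear Z -> X})
    (e1 : chain M d X1) (e2 : chain M d X2) :
    P M -> P Z -> Q X -> exact_after im c -> terms_in Q c ->
    source b phi1 e1 c -> source b phi2 e2 c ->
  exists R (sR : submod R) (c' : chain M d (subT sR)), [/\ P (subT sR),
    exact_after (fun x => im (sub_incl sR x)) c' /\ terms_in P c',
    ladder (sub_incl sR) c' c, forall z, R (g z) &
    b -> [/\ forall x, R (phi1 x), forall x, R (phi2 x),
      ladder_lift phi1 e1 c' & ladder_lift phi2 e2 c']].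
Proof.
move=> PM; elim: d X X1 X2 Z im c phi1 phi2 g e1 e2 => [|d IHd] X X1 X2 Z im c phi1 phi2 g e1 e2 PZ QX ec Tc H1 H2.
  have [c0 cs] := ec.
  have [W [t [PW tE]]] := Q_lift cs QX PM.
  have P12 : b -> P X1 /\ P X2 by move=> tb; have [? _ _] := H1 tb; have [? _ _] := H2 tb.
  have [R [sR [PR Rt Rg R12 _]]] := span_images t g phi1 phi2 PW PZ P12.
  exists R, sR, (lcomp c (sub_incl sR)); split=> //.
    split=> //; split=> [x|m]; first exact: c0.
    have [w Ew] := tE m; have [x Ex] := sub_incl_ex sR (Rt w).
    by exists x; apply: etrans (congr1 c Ex) Ew.
  move=> tb; have [R1 R2] := R12 tb; split=> // psi Epsi x.
    by have [_ _ L] := H1 tb; apply: etrans (L x) _; rewrite -(Epsi x).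
  by have [_ _ L] := H2 tb; apply: etrans (L x) _; rewrite -(Epsi x).
pose Y := tag c; pose f : {linear X -> Y} := (tagged c).1.
pose c1 : chain M d Y := (tagged c).2; pose g1 : chain M d (tag e1) := (tagged e1).2.
pose g2 : chain M d (tag e2) := (tagged e2).2.
have f0 x : f x = 0 <-> im x := ec.1 x.
have ec1 : exact_after (fun y => exists x, f x = y) c1 := ec.2.
have QY : Q Y := Tc.1; have Tc1 : terms_in Q c1 := Tc.2.
have [t1 [t1E L1]] : exists t1 : {linear tag e1 -> Y},
    (b -> forall x, t1 ((tagged e1).1 x) = f (phi1 x)) /\ (b -> ladder t1 g1 c1).
  have [/H1[_ _ [t [tE Ht]]]|/negP nb] := boolP b; [by exists t|].
  by exists (lzero _ _); split=> tb; case: nb.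
have [t2 [t2E L2]] : exists t2 : {linear tag e2 -> Y},
    (b -> forall x, t2 ((tagged e2).1 x) = f (phi2 x)) /\ (b -> ladder t2 g2 c1).
  have [/H2[_ _ [t [tE Ht]]]|/negP nb] := boolP b; [by exists t|].
  by exists (lzero _ _); split=> tb; case: nb.
have [||R [sR [c' [PR [ec' Tc'] Lc' Rg Re']]]] :=
    IHd _ _ _ _ _ _ t1 t2 (lcomp f g) g1 g2 PZ QY ec1 Tc1.
- by move=> tb; have [_ [? ?] _] := H1 tb; split=> //; apply: L1.
- by move=> tb; have [_ [? ?] _] := H2 tb; split=> //; apply: L2.
(* For exactness the new first term has to map onto the whole part of [R] reached by [f]; [Q_lift]
   applied to its preimage provides enough elements coming from a module of [P]. *)
have sW := submod_and sR (submod_range f).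
have sX0 := submod_preim f sR.
have PW : P (subT sW).
  have WR (w : subT sW) : R (sub_incl sW w) by case: (sub_inclP w).
  apply: (P_sub (f := sub_lift sR WR)) PR => u v Euv.
  by apply: (@sub_incl_inj _ _ _ sW); rewrite -[LHS](sub_liftE sR WR) Euv.
have fW (x : subT sX0) : R (lcomp f (sub_incl sX0) x) /\ exists y, f y = lcomp f (sub_incl sX0) x.
  by split; [apply: (sub_inclP x)|exists (sub_incl sX0 x)].
have fW_surj y : exists x, sub_lift sW fW x = y.
  have [Ry [x Ex]] := sub_inclP y.
  have [|x' Ex'] := @sub_incl_ex _ _ _ sX0 x; first by rewrite /= Ex.
  by exists x'; apply: (@sub_incl_inj _ _ _ sW); rewrite sub_liftE -Ex -Ex'.
have QX0 : Q (subT sX0) by apply: (Q_sub (f := sub_incl sX0)) QX; apply: sub_incl_inj.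
have [V [t [PV tE]]] := Q_lift fW_surj QX0 PW.
have P12 : b -> P X1 /\ P X2 by move=> tb; have [? _ _] := H1 tb; have [? _ _] := H2 tb.
have [R' [sR' [PR' Rt' Rg' R12' minR']]] :=
  span_images (lcomp (sub_incl sX0) t) g phi1 phi2 PV PZ P12.
have R'R (x : subT sR') : R (lcomp f (sub_incl sR') x).
  apply: (minR' _ sX0) (sub_inclP x) => // [y|tb]; first exact: (sub_inclP (t y)).
  have [R1 R2 _ _] := Re' tb; split=> y; first by rewrite -t1E.
  by rewrite -t2E.
pose f' := sub_lift sR R'R.
exists R', sR', (ccons f' c'); split=> //=.
- split=> //; split=> [x|].
    rewrite -f0; split=> [/(congr1 (sub_incl sR))|fx0]; first by rewrite linear0.
    by apply: (@sub_incl_inj _ _ _ sR); rewrite linear0.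
  apply: exact_after_eq ec' => y; split=> [[x Ex]|[x <-]]; last by exists (sub_incl sR' x).
  have [|w Ew] := @sub_incl_ex _ _ _ sW (sub_incl sR y).
    by split; [apply: sub_inclP|exists x].
  have [v Ev] := tE w; have [x' Ex'] := sub_incl_ex sR' (Rt' v); exists x'.
  by apply: (@sub_incl_inj _ _ _ sR); rewrite -Ew -Ev; apply: etrans (congr1 f Ex') _.
- by exists (sub_incl sR).
- move=> tb; have [R1 R2 K1 K2] := Re' tb; have [R1' R2'] := R12' tb.
  split=> // psi Epsi.
    exists (sub_lift sR R1); split=> [x|]; last exact: K1.
    by apply: (@sub_incl_inj _ _ _ sR); apply: etrans (t1E tb x) _; rewrite -Epsi.
  exists (sub_lift sR R2); split=> [x|]; last exact: K2.
  by apply: (@sub_incl_inj _ _ _ sR); apply: etrans (t2E tb x) _; rewrite -Epsi.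
Qed.

Lemma subobject_approx0 (b : bool) d (N : lmodType A) (c e1 e2 : chain M d.+1 N) :
    P M -> P N -> exact_after (fun x => x = 0) c -> terms_in Q c ->
    (b -> terms_in P e1 /\ ladder (fun x => x) e1 c) ->
    (b -> terms_in P e2 /\ ladder (fun x => x) e2 c) ->
  exists c', [/\ exact_after (fun x => x = 0) c', terms_in P c',
    ladder (fun x => x) c' c &
    b -> ladder (fun x => x) e1 c' /\ ladder (fun x => x) e2 c'].
Proof.
move=> PM PN ec Tc H1 H2.
pose Y := tag c; pose f : {linear N -> Y} := (tagged c).1.
pose c1 : chain M d Y := (tagged c).2; pose g1 : chain M d (tag e1) := (tagged e1).2.
pose g2 : chain M d (tag e2) := (tagged e2).2.
have f0 x : f x = 0 <-> x = 0 := ec.1 x.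
have ec1 : exact_after (fun y => exists x, f x = y) c1 := ec.2.
have QY : Q Y := Tc.1; have Tc1 : terms_in Q c1 := Tc.2.
have [t1 [t1E L1]] : exists t1 : {linear tag e1 -> Y},
    (b -> forall x, t1 ((tagged e1).1 x) = f x) /\ (b -> ladder t1 g1 c1).
  have [/H1[_ [t [tE Ht]]]|/negP nb] := boolP b; [by exists t|].
  by exists (lzero _ _); split=> tb; case: nb.
have [t2 [t2E L2]] : exists t2 : {linear tag e2 -> Y},
    (b -> forall x, t2 ((tagged e2).1 x) = f x) /\ (b -> ladder t2 g2 c1).
  have [/H2[_ [t [tE Ht]]]|/negP nb] := boolP b; [by exists t|].
  by exists (lzero _ _); split=> tb; case: nb.
have [||R [sR [c' [PR [ec' Tc'] Lc' Rg Re']]]] :=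
    @subobject_approx d b _ _ _ _ _ _ t1 t2 f g1 g2 PM PN QY ec1 Tc1.
- by move=> tb; have [[? ?] _] := H1 tb; split=> //; apply: L1.
- by move=> tb; have [[? ?] _] := H2 tb; split=> //; apply: L2.
exists (ccons (sub_lift sR Rg) c'); split=> //=.
- split=> [x|].
    rewrite -f0; split=> [/(congr1 (sub_incl sR))|fx0]; first by rewrite linear0.
    by apply: (@sub_incl_inj _ _ _ sR); rewrite linear0.
  apply: exact_after_eq ec' => y; split=> [[x Ex]|[x <-]]; last by exists x.
  by exists x; apply: (@sub_incl_inj _ _ _ sR).
- by exists (sub_incl sR).
- move=> tb; have [R1 R2 K1 K2] := Re' tb; split.
    exists (sub_lift sR R1); split=> [x|]; last exact: K1.
    by apply: (@sub_incl_inj _ _ _ sR); rewrite /= t1E.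
  exists (sub_lift sR R2); split=> [x|]; last exact: K2.
  by apply: (@sub_incl_inj _ _ _ sR); rewrite /= t2E.
Qed.

Lemma zz_full_subobject (N : lmodType A) d : P M -> P N ->
  zz_full (@ladder A M d.+1 N N (fun x => x))
    (fun c => exact_after (fun x => x = 0) c /\ terms_in P c)
    (fun c => exact_after (fun x => x = 0) c /\ terms_in Q c).
Proof.
move=> PM PN; apply: zz_full_flip; apply: zz_full_approx.
- by move=> a b c ab bc; apply: ladder_comp bc ab.
- by move=> a [ea Ta]; split=> //; apply: terms_in_sub Ta.
- move=> c [ec Tc].
  have [||c' [ec' Tc' L _]] := @subobject_approx0 false d N c c c PM PN ec Tc.
  + by [].
  + by [].
  + by exists c'.
move=> c e1 e2 [ec Tc] [ee1 T1] [ee2 T2] L1 L2.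
have [||c' [ec' Tc' L]] := @subobject_approx0 true d N c e1 e2 PM PN ec Tc.
- by [].
- by [].
by move=> /(_ isT)[L1' L2']; exists c'.
Qed.

End Subobjects.
End ClosureConditions.

(** * Finitely generated and Noetherian modules; Fitting's lemma *)

Section NoetherianModules.
Variable A : pzRingType.

Definition fgmod (M : lmodType A) := @fingen A M (fun _ => True).

Lemma noeth_fg (M : lmodType A) : noeth A^o -> fgmod M -> noeth M.
Proof.
move=> nA [s [_ Ms]] P sP; apply: (noeth_sub_span (s := s)) => // v _.
exact: Ms.
Qed.

Lemma noeth_sub (M N : lmodType A) (f : {linear M -> N}) :
  injective f -> noeth N -> noeth M.
Proof.
move=> fI nN P sP; have [s [sQ Qs]] := nN _ (submod_im f sP).
have [t [tP Et]] := map_preimage sQ.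
exists t; split=> // v Pv.
have : lspan s (f v) by apply: Qs; exists v.
by rewrite -Et => /lspan_map_ex[u tu /fI <-].
Qed.

Lemma noeth_img (M N : lmodType A) (f : {linear M -> N}) :
  (forall y, exists x, f x = y) -> noeth M -> noeth N.
Proof.
move=> fS nM P sP; have [s [sQ Qs]] := nM _ (submod_preim f sP).
exists (map f s); split=> [_ /mapP[x /sQ Px ->]//|v Pv].
by have [u Eu] := fS v; rewrite -Eu; apply/lspan_map/Qs; rewrite Eu.
Qed.

Lemma fgmod_img (M N : lmodType A) (f : {linear M -> N}) :
  (forall y, exists x, f x = y) -> fgmod M -> fgmod N.
Proof.
move=> fS [s [_ Ms]]; exists (map f s); split=> // y _.
by have [x <-] := fS y; apply/lspan_map/Ms.
Qed.

Lemma noeth_fgmod (M : lmodType A) : noeth M -> fgmod M.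
Proof. by apply; apply: submod_true. Qed.

Lemma fgmod_ext (M N L : lmodType A) (f : {linear M -> N}) (g : {linear N -> L}) :
    (forall y, g y = 0 -> exists x, f x = y) ->
  fgmod M -> noeth L -> fgmod N.
Proof.
move=> ex [s [_ Ms]] nL.
have [t [tR Rt]] := nL _ (submod_range g).
have [r Er] := map_preimage1 tR.
exists (map f s ++ r); split=> // y _.
have : lspan t (g y) by apply: Rt; exists y.
rewrite -Er => /lspan_map_ex[z rz Ez].
have [x Ex] : exists x, f x = y - z by apply: ex; rewrite linearB Ez subrr.
rewrite -(subrK z y); apply: (submodD (lspan_submod _)); last exact: lspan_catr.
by apply: lspan_catl; rewrite -Ex; apply/lspan_map/Ms.
Qed.

Lemma fgmod_prod (M N : lmodType A) : fgmod M -> fgmod N -> fgmod (M * N)%type.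
Proof.
move=> [s [_ Ms]] [t [_ Nt]].
pose f : {linear M -> (M * N)%type} := lpair (lid M) (lzero M N).
pose g : {linear N -> (M * N)%type} := lpair (lzero N M) (lid N).
exists (map f s ++ map g t); split=> // -[x y] _.
have -> : (x, y) = f x + g y by congr (_, _); rewrite /= ?addr0 ?add0r.
apply: (submodD (lspan_submod _)).
  by apply/lspan_catl/(lspan_map f)/Ms.
by apply/lspan_catr/(lspan_map g)/Nt.
Qed.

Lemma noeth_prod (M N : lmodType A) :
  noeth A^o -> noeth M -> noeth N -> noeth (M * N)%type.
Proof. by move=> nA /noeth_fgmod fM /noeth_fgmod fN; apply/noeth_fg/fgmod_prod. Qed.

(** Without a maximal member, choice produces a strictly increasing sequence in [F]. Its union is
    finitely generated, so it is reached at a finite stage, which contradicts strictness. *)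
Lemma noeth_max (M : lmodType A) (F : (M -> Prop) -> Prop) P0 :
    noeth M -> (forall P, F P -> submod P) -> F P0 ->
  exists2 P, F P & forall Q, F Q -> (forall x, P x -> Q x) -> forall x, Q x -> P x.
Proof.
move=> nM sF FP0; apply: contrapT => noM.
pose T := {P | F P}; pose R (P Q : T) :=
  (forall x, sval P x -> sval Q x) /\ exists2 x, sval Q x & ~ sval P x.
have [f fR] : {f : T -> T & forall P, R P (f P)}.
  apply: choice => -[P FP]; apply: contrapT => noQ; apply: noM.
  exists P => // Q FQ PQ x Qx; apply: contrapT => nPx; apply: noQ.
  by exists (exist _ Q FQ); split=> //; exists x.
pose c n := iter n f (exist _ P0 FP0).
have cS n x : sval (c n) x -> sval (c n.+1) x by case: (fR (c n)) => + _; apply.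
have cle m n x : (m <= n)%N -> sval (c m) x -> sval (c n) x.
  by move=> /subnKC <-; elim: (n - m)%N => [|k IHk]; rewrite ?addn0 // addnS => /IHk/cS.
pose U x := exists n, sval (c n) x.
have sU : submod U.
  split; first by exists 0%N; case: (sF _ FP0).
  move=> a u v [m mu] [n nv]; exists (maxn m n).
  have [_ sc] := sF _ (proj2_sig (c (maxn m n))); apply: sc.
    by apply: cle mu; apply: leq_maxl.
  by apply: cle nv; apply: leq_maxr.
have [s [sU1 Us]] := nM _ sU.
have [n cn] : exists n, forall x, x \in s -> sval (c n) x.
  elim: s sU1 {Us} => [|y s IHs] sU1; first by exists 0%N.
  have [m my] := sU1 y (mem_head _ _).
  have [|n nU] := IHs; first by move=> w ws; apply: sU1; rewrite inE ws orbT.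
  exists (maxn m n) => x; rewrite inE => /predU1P[->|/nU xs].
    by apply: cle my; apply: leq_maxl.
  by apply: cle xs; apply: leq_maxr.
have [_ [x nx]] := fR (c n); apply.
apply: (lspan_min (sF _ (proj2_sig (c n))) cn); apply: Us.
by exists n.+1.
Qed.

Lemma lin_iter_linear (M : lmodType A) (f : {linear M -> M}) n : linear (iter n f).
Proof. by elim: n => // n IHn a u v; rewrite !iterS IHn linearP. Qed.

Definition lin_iter (M : lmodType A) (f : {linear M -> M}) n : {linear M -> M} :=
  mklin (lin_iter_linear f n).

(** The kernels of the iterates increase, and generators of their union are all killed by a single
    iterate. *)
Lemma fitting (M : lmodType A) (f : {linear M -> M}) : noeth M ->
  exists k, forall n x, iter n f x = 0 -> iter k f x = 0.
Proof.
move=> nM; pose U x := exists n, iter n f x = 0.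
have up m n x : (m <= n)%N -> iter m f x = 0 -> iter n f x = 0.
  by move=> /subnK <- Ex; rewrite iterD Ex; apply: (linear0 (lin_iter f _)).
have sU : submod U.
  split; first by exists 0%N.
  move=> a u v [m mu] [n nv]; exists (maxn m n).
  rewrite lin_iter_linear (up m) ?leq_maxl // (up n) ?leq_maxr //.
  by rewrite scaler0 addr0.
have [s [sU1 Us]] := nM _ sU.
have [k ks] : exists n, forall x, x \in s -> iter n f x = 0.
  elim: s sU1 {Us} => [|y s IHs] sU1; first by exists 0%N.
  have [m my] := sU1 y (mem_head _ _).
  have [|n nU] := IHs; first by move=> w ws; apply: sU1; rewrite inE ws orbT.
  exists (maxn m n) => x; rewrite inE => /predU1P[->|/nU xs].
    by rewrite (up m) ?leq_maxl.
  by rewrite (up n) ?leq_maxr.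
exists k => n x Ex; apply: (lspan_min (submod_ker (lin_iter f k)) ks).
by apply: Us; exists n.
Qed.

End NoetherianModules.

(** * Restriction of scalars, finite dimension, polynomials in one operator *)

Section RestrictScalars.
Variables (B A : pzRingType) (f : {rmorphism B -> A}).

Definition res_type of {rmorphism B -> A} := fun M : lmodType A => M : Type.

Section Instances.
Variable M : lmodType A.

HB.instance Definition _ := GRing.Zmodule.on (res_type f M).

Definition res_scale (b : B) (x : res_type f M) : res_type f M := f b *: (x : M).

Lemma res_scaleA a b x : res_scale a (res_scale b x) = res_scale (a * b) x.
Proof. by rewrite /res_scale scalerA rmorphM. Qed.

Lemma res_scale1 : left_id 1 res_scale.
Proof. by move=> x; rewrite /res_scale rmorph1 scale1r. Qed.

Lemma res_scaleDr : right_distributive res_scale +%R.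
Proof. by move=> a x y; rewrite /res_scale scalerDr. Qed.

Lemma res_scaleDl x : {morph res_scale^~ x : a b / a + b}.
Proof. by move=> a b; rewrite /res_scale rmorphD scalerDl. Qed.

HB.instance Definition _ := GRing.Zmodule_isLmodule.Build B (res_type f M)
  res_scaleA res_scale1 res_scaleDr res_scaleDl.

Definition res : lmodType B := res_type f M.

Lemma res_scaleE b (x : res) : b *: x = f b *: (x : M). Proof. by []. Qed.

Lemma res_submod (P : M -> Prop) : @submod A M P -> @submod B res P.
Proof. by move=> [P0 sP]; split=> // b u v; apply: sP. Qed.

End Instances.

Lemma resl_linear (M N : lmodType A) (g : {linear M -> N}) :
  linear (fun x : res M => g x : res N).
Proof. by move=> b u v; rewrite !res_scaleE linearP. Qed.

Definition resl (M N : lmodType A) (g : {linear M -> N}) : {linear res M -> res N} :=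
  mklin (resl_linear g).

End RestrictScalars.

Section FiniteDimension.
Variables (K : fieldType) (A : algType K).

Lemma field_noeth : noeth (K : pzRingType)^o.
Proof.
move=> P sP; have [[x Px x0]|noP] := pselect (exists2 x, P x & x != 0).
  exists [:: x]; split=> [w|v _]; first by rewrite inE => /eqP ->.
  exists ((v : K) / (x : K)) => /=.
  by rewrite [_ *: _](mulfVK x0) subrr.
exists [::]; split=> // v Pv /=.
by apply/eqP; apply: contra_notT noP => v0; exists v.
Qed.

Definition kmod (M : lmodType A) : lmodType K := res (GRing.in_alg A) M.

Lemma kmodE (M : lmodType A) (c : K) (x : kmod M) : c *: x = c%:A *: (x : M).
Proof. by []. Qed.

(** Only containment in a finite-dimensional span is asked, so the notion passes to arbitrary
    subsets; [kspan_fingen] recovers generators inside a subspace. *)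
Definition fdim (M : lmodType A) (P : M -> Prop) :=
  exists s : seq M, forall v, P v -> @lspan K (kmod M) s v.

Lemma fdim_sub (M : lmodType A) (P Q : M -> Prop) :
  (forall x, P x -> Q x) -> fdim Q -> fdim P.
Proof. by move=> PQ [s Qs]; exists s => v /PQ/Qs. Qed.

Lemma kspan_fingen (M : lmodType A) (P : M -> Prop) :
  @submod K (kmod M) P -> fdim P -> @fingen K (kmod M) P.
Proof. by move=> sP [s Ps]; apply: (noeth_sub_span field_noeth sP Ps). Qed.

Lemma lspan_kspan (M : lmodType A) (s : seq M) (v : M) :
  @lspan K (kmod M) s v -> @lspan A M s v.
Proof.
apply: (@lspan_min K (kmod M)); last exact: (@lspan_mem A M s).
exact: (res_submod (GRing.in_alg A) (lspan_submod s)).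
Qed.

Lemma fdim_img (M N : lmodType A) (f : {linear M -> N}) (P : M -> Prop) :
  fdim P -> fdim (fun y => exists2 x, P x & f x = y).
Proof.
move=> [s Ps]; exists (map f s) => _ [x Px <-].
exact: (lspan_map (resl (GRing.in_alg A) f)) (Ps x Px).
Qed.

Lemma fdim_preim (M N : lmodType A) (f : {linear M -> N}) (P : M -> Prop) :
    submod P -> fdim (fun x => P x /\ f x = 0) ->
  fdim (fun y => exists2 x, P x & f x = y) -> fdim P.
Proof.
move=> sP [s Ks] fR.
have sR : @submod K (kmod N) (fun y => exists2 x, P x & f x = y).
  exact: (res_submod (GRing.in_alg A) (submod_im f sP)).
have [t [tR Rt]] := kspan_fingen sR fR.
have [r [rP Er]] := map_preimage tR.
exists (s ++ r) => v Pv; have : @lspan K (kmod N) t (f v) by apply: Rt; exists v.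
rewrite -Er => /(lspan_map_ex (f := resl (GRing.in_alg A) f))[u ru Eu].
have Pu : P u.
  exact: (@lspan_min K (kmod M) r P u (res_submod (GRing.in_alg A) sP) rP ru).
rewrite -(subrK u v); apply: (@submodD K (kmod M) _ (lspan_submod _)); last exact: lspan_catr.
apply/lspan_catl/Ks; split; first exact: (submodB sP Pv Pu).
by apply: etrans (linearB f v u) _; apply/eqP; rewrite subr_eq0; apply/eqP/esym/Eu.
Qed.

Lemma fdim_inj (M N : lmodType A) (f : {linear M -> N}) (P : M -> Prop) :
  injective f -> fdim (fun y => exists2 x, P x & f x = y) -> fdim P.
Proof.
move=> fI [s sR].
have sQ : @submod K (kmod N) (fun y => @lspan K (kmod N) s y /\ exists x, f x = y).
  by apply: submod_and; [apply: lspan_submod | exact: (res_submod (GRing.in_alg A) (submod_range f))].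
have [|t [tR Rt]] := kspan_fingen sQ; first by exists s => v [].
have [|r Er] := @map_preimage1 _ _ f t; first by move=> y /tR[].
exists r => v Pv; have : @lspan K (kmod N) t (f v).
  by apply: Rt; split; [apply: sR; exists v | exists v].
by rewrite -Er => /(lspan_map_ex (f := resl (GRing.in_alg A) f))[u ru /fI <-].
Qed.

End FiniteDimension.

(** The coefficient matrix has one more row than columns, hence a nonzero row vector in its left
    kernel. *)
Lemma span_dependent (K : fieldType) (V : lmodType K) (s : seq V) (v : nat -> V) :
    (forall k, lspan s (v k)) ->
  exists c : 'rV[K]_(size s).+1, c != 0 /\ \sum_k c 0 k *: v k = 0.
Proof.
move=> sv; have [C EC] : {C : nat -> 'I_(size s) -> K &
    forall k, v k = \sum_j C k j *: s`_j}.
  apply: (@choice _ _ (fun k (c : 'I_(size s) -> K) => v k = \sum_j c j *: s`_j)) => k.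
  by have [c Ec] := (lspanP s (v k)).1 (sv k); exists c.
pose D := \matrix_(k < (size s).+1, j < size s) C k j.
have [c cD c0] : exists2 c : 'rV[K]_(size s).+1, (c <= kermx D)%MS & c != 0.
  apply/rowV0Pn; rewrite kermx_eq0 /row_free neq_ltn.
  by rewrite (leq_ltn_trans (rank_leq_col D)).
exists c; split=> //; move/sub_kermxP: cD => cD.
transitivity (\sum_j (c *m D) 0 j *: s`_j); last first.
  by rewrite cD big1 // => j _; rewrite mxE scale0r.
under eq_bigr => k _ do rewrite EC scaler_sumr.
rewrite exchange_big; apply: eq_bigr => j _.
rewrite mxE scaler_suml; apply: eq_bigr => k _.
by rewrite scalerA mxE.
Qed.

Section PolynomialAction.
Variables (K : fieldType) (A : algType K) (M : lmodType A) (z : A).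

Definition pact (p : {poly K}) (v : M) : M := horner_alg z p *: v.

Lemma pactM p q v : pact (p * q) v = pact p (pact q v).
Proof. by rewrite /pact rmorphM scalerA. Qed.

Lemma pactC p q v : pact p (pact q v) = pact q (pact p v).
Proof. by rewrite -!pactM mulrC. Qed.

Lemma pactXsubC c v : pact ('X - c%:P) v = z *: v - c%:A *: v.
Proof. by rewrite /pact rmorphB /= horner_algX horner_algC scalerBl. Qed.

Lemma pact_submod p (P : M -> Prop) v :
    @submod K (kmod M) P -> (forall x, P x -> P (z *: x)) -> P v -> P (pact p v).
Proof.
move=> sP zP; elim/poly_ind: p v => [|p c IHp] v Pv.
  by rewrite /pact rmorph0 scale0r; case: sP.
rewrite /pact rmorphD rmorphM /= horner_algX horner_algC scalerDl -scalerA addrC.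
by apply: (sP.2 c v _ Pv); apply/IHp/zP.
Qed.

Lemma pact_root (P : M -> Prop) v :
    @submod K (kmod M) P -> (forall x, P x -> P (z *: x)) -> fdim P -> P v ->
  exists2 p : {poly K}, p != 0 & pact p v = 0.
Proof.
move=> sP zP [s Ps] Pv; have sv k : @lspan K (kmod M) s (pact 'X^k v).
  by apply: Ps; apply: pact_submod.
have [c [c0 Ec]] := span_dependent sv.
exists (\sum_k c 0 k *: 'X^k).
  apply: contra_neq c0 => Ep; apply/rowP=> k; rewrite mxE.
  have := congr1 (fun p : {poly K} => p`_k) Ep; rewrite coef0 coef_sum.
  rewrite (bigD1 k) //= coefZ coefXn eqxx mulr1 big1 ?addr0 // => j jk.
  by rewrite coefZ coefXn eq_sym [_ == _](negbTE jk) mulr0.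
rewrite /pact linear_sum scaler_suml -[RHS]Ec; apply: eq_bigr => k _.
by rewrite linearZ /= kmodE scalerA mulr_algl.
Qed.

Lemma pact_root_seq (P : M -> Prop) :
    @submod K (kmod M) P -> (forall x, P x -> P (z *: x)) -> fdim P ->
  exists2 p : {poly K}, p != 0 & forall v, P v -> pact p v = 0.
Proof.
move=> sP zP fP; have [s [sP1 Ps]] := kspan_fingen sP fP.
have [p p0 ps] : exists2 p : {poly K}, p != 0 & forall v, v \in s -> pact p v = 0.
  elim: s sP1 {Ps} => [|v s IHs] sP1; first by exists 1; rewrite ?oner_eq0.
  have [p p0 pv] := pact_root sP zP fP (sP1 v (mem_head _ _)).
  have [|q q0 qs] := IHs; first by move=> w ws; apply: sP1; rewrite inE ws orbT.
  exists (p * q); first by rewrite mulf_neq0.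
  move=> w; rewrite inE pactM => /predU1P[->|/qs ->].
    by rewrite pactC pv /pact scaler0.
  by rewrite /pact scaler0.
exists p => // v /Ps; apply: lspan_min ps; split=> [|a u w pu pw].
  by rewrite /pact scaler0.
rewrite /pact scalerDr kmodE scalerA mulr_algr -mulr_algl -scalerA.
by rewrite -!/(pact _ _) pu pw scaler0 addr0.
Qed.

End PolynomialAction.

(** * Essential extensions over an algebra generated by a central sequence *)

Definition essential (A : pzRingType) (X : lmodType A) (N : X -> Prop) :=
  forall P, submod P -> (forall x, P x -> N x -> x = 0) -> forall x, P x -> x = 0.

Lemma essential_sub (A : pzRingType) (X Y : lmodType A) (f : {linear Y -> X})
    (N : X -> Prop) :
  injective f -> essential N -> essential (fun y => N (f y)).
Proof.
move=> fI eN P sP PN y Py; apply: fI; rewrite linear0.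
apply: (eN _ (submod_im f sP)); last by exists y.
by move=> _ [z Pz <-] Nz; rewrite (PN z) // linear0.
Qed.

(** [Y] is maximal among the submodules meeting [N] trivially. A submodule of the quotient that
    misses the image of [N] pulls back to another such submodule containing [Y]. *)
Lemma essential_quotient (A : pzRingType) (X : lmodType A) (N : X -> Prop) :
    noeth X -> submod N ->
  exists Y (sY : submod Y), (forall x, Y x -> N x -> x = 0) /\
    essential (fun w : quoT sY => exists2 x, N x & quo_pi sY x = w).
Proof.
move=> nX sN.
have sF P : submod P /\ (forall x, P x -> N x -> x = 0) -> submod P by case.
have [Y [sY YN] maxY] := noeth_max nX sF (conj (submod_zero X) (fun x x0 _ => x0)).
exists Y, sY; split=> // P sP PN w Pw; have [x Ex] := quo_pi_surj w.
rewrite -Ex; apply/quo_pi_eq0; apply: (maxY (fun x => P (quo_pi sY x))); rewrite ?Ex //.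
  split; first exact: submod_preim.
  move=> y Py Ny; apply: YN => //; apply/(quo_pi_eq0 sY)/PN => //; by exists y.
by move=> y /(quo_pi_eq0 sY) ->; case: sP.
Qed.

Section CentralSequence.
Variables (K : numClosedFieldType) (A : algType K) (zs : seq A).
Hypothesis zs_gen : forall a : A, subalgebra_gen (fun u => u \in zs) a.
(** The generators run through a central series with its deepest terms first, as in the enveloping
    algebra of a nilpotent Lie algebra. *)
Hypothesis zs_central : forall s1 z s2, zs = s1 ++ z :: s2 ->
  forall y, y \in zs -> @lspan K A s1 (z * y - y * z).

Definition acts_scalar (X : lmodType A) (a : A) :=
  exists c : K, forall x : X, a *: x = c%:A *: x.

Lemma scalarC (X : lmodType A) (c : K) a (x : X) : c%:A *: (a *: x) = a *: (c%:A *: x).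
Proof. by rewrite !scalerA mulr_algl mulr_algr. Qed.

Lemma algKv (X : lmodType A) (c : K) (x : X) : c != 0 -> c^-1%:A *: (c%:A *: x) = x.
Proof. by move=> c0; rewrite scalerA mulr_algl scalerA mulVf // !scale1r. Qed.

Lemma acts_scalar_submod (X : lmodType A) : @submod K A (acts_scalar X).
Proof.
split=> [|a u v [c Ec] [d Ed]]; first by exists 0 => x; rewrite !scale0r.
exists (a * c + d) => x; rewrite scalerDl Ed [(_ + _)%:A]scalerDl scalerDl; congr (_ + _).
by rewrite -[a *: u]mulr_algl -scalerA Ec scalerA mulr_algl scalerA.
Qed.

Lemma acts_scalar_gen (X : lmodType A) :
  (forall z, z \in zs -> acts_scalar X z) -> forall a, acts_scalar X a.
Proof.
move=> sz a; elim: (zs_gen a) => {a} [u /sz //|c|u v _ su _ sv|u v _ [c Ec] _ [d Ed]].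
- by exists c.
- by rewrite -[u]scale1r; apply: (acts_scalar_submod X).2.
- by exists (c * d) => x; rewrite -[LHS]scalerA Ed -scalarC Ec scalarC scalerA mulr_algl scalerA.
Qed.

Lemma commutes_gen (X : lmodType A) z :
    (forall y, y \in zs -> forall x : X, z *: (y *: x) = y *: (z *: x)) ->
  forall a (x : X), z *: (a *: x) = a *: (z *: x).
Proof.
move=> zC a; elim: (zs_gen a) => {a} [u /zC //|c|u v _ cu _ cv|u v _ cu _ cv] x.
- by rewrite scalarC.
- by rewrite !scalerDl scalerDr cu cv.
- by rewrite -!scalerA cu cv.
Qed.

(** Leibniz rule: when the commutator of [z] and [y] is the scalar [c], that of [p(z)] and [y] is
    [c p'(z)]. *)
Lemma pact_deriv (X : lmodType A) z y (c : K) :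
    (forall x : X, z *: (y *: x) - y *: (z *: x) = c%:A *: x) ->
  forall p (x : X), pact z p (y *: x) = y *: pact z p x + c%:A *: pact z p^`() x.
Proof.
move=> zy p; elim/poly_ind: p => [|p d IHp] x.
  by rewrite deriv0 /pact rmorph0 !scale0r !scaler0 addr0.
have E q e w : pact z (q * 'X + e%:P) w = pact z q (z *: w) + e%:A *: w.
  by rewrite /pact rmorphD rmorphM /= horner_algX horner_algC scalerDl -scalerA.
have Ed : pact z (p + p^`() * 'X) x = pact z p x + pact z p^`() (z *: x).
  by rewrite /pact rmorphD rmorphM /= horner_algX scalerDl -scalerA.
have EC w : pact z p (c%:A *: w) = c%:A *: pact z p w by rewrite /pact scalarC.
have Ezy : z *: (y *: x) = y *: (z *: x) + c%:A *: x by rewrite -zy addrC subrK.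
rewrite derivMXaddC !E Ed Ezy [pact z p (_ + _)]/pact scalerDr -!/(pact z _ _).
rewrite IHp EC.
rewrite [d%:A *: (y *: x)]scalarC !scalerDr -!addrA; congr (_ + _); rewrite addrCA [RHS]addrCA.
by congr (_ + _); rewrite addrC.
Qed.

(** By [pact_deriv], the derivative of a polynomial in [z] killing [N] also kills [N]. In
    characteristic zero this descends to a nonzero constant. *)
Lemma acts_nonzero_commutator (X : lmodType A) (N : X -> Prop) z y (c : K) :
    submod N -> fdim N -> c != 0 ->
    (forall x : X, z *: (y *: x) - y *: (z *: x) = c%:A *: x) ->
  forall x, N x -> x = 0.
Proof.
move=> sN fN c0 zy.
have [p p0 Np] := pact_root_seq (z := z) (res_submod (GRing.in_alg A) sN)
  (submodZ sN z) fN.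
have [n] := ubnP (size p); elim: n p p0 Np => // n IHn p p0 Np sp x Nx.
have [p1|p1] := leqP (size p) 1.
  move: Np p0; rewrite (size1_polyC p1) polyC_eq0 => Np p00; have := Np x Nx.
  rewrite /pact horner_algC => /(congr1 (fun v => (p`_0)^-1%:A *: v)).
  by rewrite scaler0 algKv.
have p'0 : p^`() != 0.
  apply: contra_neq p0 => p'0; apply/eqP; rewrite -lead_coef_eq0 /lead_coef.
  have := congr1 (fun q : {poly K} => q`_(size p).-2) p'0.
  rewrite coef_deriv coef0 => /eqP; rewrite mulrn_eq0 /=.
  by case: (size p) p1 => [|[|m]].
apply: (IHn p^`()) => //; last by rewrite (leq_trans (lt_size_deriv p0)).
move=> v Nv; have := pact_deriv zy p v.
rewrite !Np //; last exact: submodZ.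
rewrite scaler0 add0r => /(congr1 (fun w => c^-1%:A *: w)).
by rewrite scaler0 algKv.
Qed.

Definition central_on (X : lmodType A) (z : A) :=
  forall a (x : X), z *: (a *: x) = a *: (z *: x).

Lemma central_pact_linear (X : lmodType A) z p :
  central_on X z -> linear (fun x : X => pact z p x).
Proof.
move=> zC; have pC a (x : X) : pact z p (a *: x) = a *: pact z p x.
  elim/poly_ind: p x => [|p c IHp] x; first by rewrite /pact rmorph0 !scale0r scaler0.
  rewrite /pact rmorphD rmorphM /= horner_algX horner_algC !scalerDl -!scalerA.
  by rewrite zC -![horner_alg z p *: _]/(pact z p _) IHp scalerDr scalarC.
by move=> a u v; rewrite -pC /pact scalerDr.
Qed.

Definition pactl (X : lmodType A) z (zC : central_on X z) p : {linear X -> X} :=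
  mklin (central_pact_linear p zC).

(** Write [h] for the action of [p(z)] and take [k] from Fitting's lemma. If [h^(k+1) x] lies in
    [N], then [h] kills it, so [h^k x = 0] already. Thus the range of [h^(k+1)] meets [N] trivially,
    and it vanishes by essentiality. *)
Lemma central_pact_nilpotent (X : lmodType A) (N : X -> Prop) z p :
    noeth X -> essential N -> central_on X z -> (forall x, N x -> pact z p x = 0) ->
  exists k, forall x : X, pact z (p ^+ k) x = 0.
Proof.
move=> nX eN zC pN; have [k Hk] := fitting (pactl zC p) nX.
have iterE n x : iter n (pactl zC p) x = pact z (p ^+ n) x.
  elim: n => [|n IHn]; first by rewrite /pact expr0 rmorph1 scale1r.
  by rewrite iterS IHn exprS pactM.
exists k.+1 => y.
apply: (eN _ (submod_range (pactl zC (p ^+ k.+1)))); last by exists y.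
move=> _ [x <-] Nx; have := pN _ Nx; rewrite /= -pactM -exprS -iterE => /Hk.
by rewrite -iterE iterS => ->; apply: (linear0 (pactl zC p)).
Qed.

(** Induction along the central sequence: the generators in [s1] act as scalars, and the next one is
    shown to be central on [X] and then reduced to scalar actions on the layers of its spectral
    filtration. *)
Lemma fdim_essential s2 s1 : zs = s1 ++ s2 ->
  forall (X : lmodType A) (N : X -> Prop), noeth X -> submod N -> fdim N ->
    essential N -> (forall z, z \in s1 -> acts_scalar X z) ->
  fdim (fun _ : X => True).
Proof.
elim: s2 s1 => [|z s2 IHs] s1 Ezs X N nX sN fN eN sX.
  (* All of [A] acts through scalars now, so module generators already span over [K]. *)
  have sA a : acts_scalar X a.
    by apply: acts_scalar_gen => z; rewrite Ezs cats0; apply: sX.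
  have [s [_ Xs]] := noeth_fgmod nX; exists s => x _.
  apply: lspan_min (Xs x I); last by move=> y ys; apply: (@lspan_mem K (kmod X)).
  have sK := @lspan_submod K (kmod X) s.
  split=> [|a u v su sv]; first exact: sK.1.
  by have [c ->] := sA a; apply: sK.2 su sv.
have [N0|/existsNP[v0 /not_implyP[Nv0 v00]]] := pselect (forall x, N x -> x = 0).
  by exists [::] => x _; apply: (eN _ (submod_true X)) => // y _; apply: N0.
(* The commutators of [z] lie in the span of [s1], hence act by scalars. A nonzero scalar is
   impossible because [N] is nonzero and finite-dimensional. *)
have zC : central_on X z.
  apply: commutes_gen => y yzs x; apply/eqP; rewrite -subr_eq0; apply/eqP.
  have [c Ec] : acts_scalar X (z * y - y * z).
    by apply: lspan_min (zs_central Ezs yzs) => //; apply: acts_scalar_submod.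
  have zy (w : X) : z *: (y *: w) - y *: (z *: w) = c%:A *: w.
    by rewrite -Ec scalerBl !scalerA.
  have [c0|c0] := eqVneq c 0; first by rewrite zy c0 !scale0r.
  by case: v00; apply: acts_nonzero_commutator zy _ Nv0.
have [p p0 Np] := pact_root_seq (z := z) (res_submod (GRing.in_alg A) sN)
  (submodZ sN z) fN.
have [k pk] := central_pact_nilpotent nX eN zC Np.
have [r Er] := closed_field_poly_normal (p ^+ k).
have pactZ (c : K) q (x : X) : pact z (c *: q) x = c%:A *: pact z q x.
  by rewrite /pact linearZ /= -[c *: _]mulr_algl scalerA.
have {pk pactZ} rX (x : X) : pact z (\prod_(l <- r) ('X - l%:P)) x = 0.
  rewrite -[LHS](algKv (c := lead_coef (p ^+ k))) ?lead_coef_eq0 ?expf_neq0 //.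
  by rewrite -pactZ -Er pk scaler0.
(* Induction on the linear factors of the polynomial killing [X]. On the kernel of [z - l] the
   element [z] is a scalar and [IHs] applies; the range of [z - l] is killed by one factor fewer. *)
elim: r X N nX sN fN eN sX zC rX {v0 Nv0 v00 p p0 Np k Er} =>
    [|l r IHr] X N nX sN fN eN sX zC rX.
  by exists [::] => x _ /=; have := rX x; rewrite big_nil /pact rmorph1 scale1r.
pose h := pactl zC ('X - l%:P).
have fsub (P : X -> Prop) (sP : submod P) : fdim (fun w : subT sP => N (sub_incl sP w)).
  apply: (@fdim_inj _ _ _ _ (sub_incl sP)); first exact: sub_incl_inj.
  by apply: fdim_sub fN => _ [w Nw <-].
have noeth_subT (P : X -> Prop) (sP : submod P) : noeth (subT sP).
  by apply: (noeth_sub (f := sub_incl sP)) nX; apply: sub_incl_inj.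
have ess_subT (P : X -> Prop) (sP : submod P) :
    essential (fun w : subT sP => N (sub_incl sP w)).
  by apply: essential_sub eN; apply: sub_incl_inj.
have scal_subT (P : X -> Prop) (sP : submod P) a :
    acts_scalar X a -> acts_scalar (subT sP) a.
  move=> [c Ec]; exists c => w; apply: (@sub_incl_inj _ _ _ sP).
  by rewrite !linearZ /= Ec.
have sub_fdim (P : X -> Prop) (sP : submod P) : fdim (fun _ : subT sP => True) -> fdim P.
  move=> /(fdim_img (sub_incl sP)); apply: fdim_sub => x Px.
  by have [w Ew] := sub_incl_ex sP Px; exists w.
apply: (@fdim_preim _ _ _ _ h); first exact: submod_true.
  apply: (@fdim_sub _ _ _ _ (fun x => h x = 0)); first by move=> x [].
  apply: (sub_fdim _ (submod_ker h)).
  apply: (IHs (rcons s1 z) _ _ (fun w => N (sub_incl (submod_ker h) w))).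
  - by rewrite cat_rcons.
  - exact: noeth_subT.
  - exact: (submod_preim (sub_incl (submod_ker h)) sN).
  - exact: fsub.
  - exact: ess_subT.
  move=> y; rewrite mem_rcons inE => /predU1P[->|/sX]; last exact: scal_subT.
  exists l => w; apply: (@sub_incl_inj _ _ _ (submod_ker h)); rewrite !linearZ /=.
  have := sub_inclP w; rewrite /h /= pactXsubC => /eqP.
  by rewrite subr_eq0 => /eqP.
apply: (@fdim_sub _ _ _ _ (fun y => exists x, h x = y)); first by move=> y [x _ Ex]; exists x.
apply: (sub_fdim _ (submod_range h)).
apply: (IHr _ (fun w => N (sub_incl (submod_range h) w))).
- exact: noeth_subT.
- exact: (submod_preim (sub_incl (submod_range h)) sN).
- exact: fsub.
- exact: ess_subT.
- by move=> y /sX; apply: scal_subT.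
- by move=> a w; apply: (@sub_incl_inj _ _ _ (submod_range h)); rewrite !linearZ /= zC.
move=> w; apply: (@sub_incl_inj _ _ _ (submod_range h)).
rewrite /pact linearZ linear0; have [x <-] := sub_inclP w.
by have := rX x; rewrite big_cons mulrC pactM.
Qed.

Lemma fdim_of_essential (X : lmodType A) (N : X -> Prop) :
  noeth X -> submod N -> fdim N -> essential N -> fdim (fun _ : X => True).
Proof. by move=> *; apply: (@fdim_essential zs [::] erefl X N). Qed.

End CentralSequence.

(** * Locally finite vectors and injectivity by Baer's criterion *)

Section LocallyFinite.
Variables (K : fieldType) (B : algType K).
Hypothesis noethB : noeth (B : pzRingType)^o.

Definition locfin (X : lmodType B) (x : X) := fdim (fun y : X => exists b, y = b *: x).

Lemma fdim_add (X : lmodType B) (P Q : X -> Prop) :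
  fdim P -> fdim Q -> fdim (fun x => exists2 y, P y & Q (x - y)).
Proof.
move=> [s Ps] [t Qt]; exists (s ++ t) => x [y Py Qy].
rewrite -(subrK y x); apply: (@submodD K (kmod X) _ (lspan_submod _)).
  exact/lspan_catr/Qt.
exact/lspan_catl/Ps.
Qed.

Lemma locfin_submod (X : lmodType B) : submod (@locfin X).
Proof.
split=> [|a u v fu fv].
  by exists [::] => y [b ->]; rewrite scaler0.
apply: fdim_sub (fdim_add fu fv) => y [b ->]; exists ((b * a) *: u); first by exists (b * a).
by exists b; rewrite scalerDr scalerA addrC addKr.
Qed.

Lemma locfin_map (X Y : lmodType B) (f : {linear X -> Y}) x : locfin x -> locfin (f x).
Proof.
move=> /(fdim_img f); apply: fdim_sub => y [b ->].
by exists (b *: x); [exists b | rewrite linearZ].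
Qed.

Lemma locfin_inj (X Y : lmodType B) (f : {linear X -> Y}) x :
  injective f -> locfin (f x) -> locfin x.
Proof.
move=> fI fx; apply: fdim_inj fI _; apply: fdim_sub fx => y [z [b ->] <-].
by exists b; rewrite linearZ.
Qed.

Definition cofinite (J : B -> Prop) :=
  exists t : seq B, forall b, exists2 c, @lspan K B t c & J (b - c).

Lemma cofinite_sub (J J' : B -> Prop) : (forall b, J b -> J' b) -> cofinite J -> cofinite J'.
Proof. by move=> JJ' [t Jt]; exists t => b; have [c tc /JJ' Jc] := Jt b; exists c. Qed.

Lemma cofinite_ker (X : lmodType B) (f : B -> X) (P : X -> Prop) :
    linear (f : B -> kmod X) -> (forall b, P (f b)) -> fdim P ->
  cofinite (fun b => f b = 0).
Proof.
move=> lf Pf fP; pose g : {linear B -> kmod X} := @mklin K B (kmod X) f lf.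
have [|t [tR Rt]] := @kspan_fingen _ _ _ (fun y => exists b, g b = y) (submod_range g).
  by apply: fdim_sub fP => _ [b <-]; apply: Pf.
have [r Er] := map_preimage1 tR.
exists r => b; have : @lspan K (kmod X) t (g b) by apply: Rt; exists b.
rewrite -Er => /lspan_map_ex[c rc Ec]; exists c => //.
by have := linearB g b c; rewrite Ec subrr.
Qed.

Lemma locfin_ann (X Y : lmodType B) (f : {linear X -> Y}) x :
  locfin (f x) -> cofinite (fun b => f (b *: x) = 0).
Proof.
move=> lfx; apply: cofinite_ker lfx => [a u v|b]; last by exists b; rewrite linearZ.
by rewrite scalerDl linearD -[a *: u]mulr_algl -scalerA linearZ.
Qed.

(** [J] is finitely generated, so [J x] is finite-dimensional, and finitely many vectors [c x] with
    [c] in [t] account for the rest of [B x]. *)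
Lemma locfin_cofinite (X : lmodType B) (J : B -> Prop) (x : X) :
    @submod B (B : pzRingType)^o J -> cofinite J -> (forall j, J j -> locfin (j *: x)) ->
  locfin x.
Proof.
move=> sJ [t Jt] lJ; have [s [sJ1 Js]] := noethB sJ.
have [r Hr] : exists r : seq X, forall j, @lspan B (B : pzRingType)^o s j ->
    @lspan K (kmod X) r (j *: x).
  elim: s sJ1 {Js} => [|j0 s IHs] sJ1.
    by exists [::] => j /= ->; rewrite scale0r.
  have [|r Hr] := IHs; first by move=> w ws; apply: sJ1; rewrite inE ws orbT.
  have [r0 Hr0] := lJ j0 (sJ1 j0 (mem_head _ _)).
  exists (r0 ++ r) => j [b /Hr jr].
  have -> : j *: x = (j - b *: j0) *: x + b *: ((j0 : B) *: x).
    by rewrite scalerBl scalerA subrK.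
  apply: (@submodD K (kmod X) _ (lspan_submod _)); first exact: lspan_catr.
  by apply/lspan_catl/Hr0; exists b.
exists (r ++ map (fun c => c *: x) t) => _ [b ->].
have [c tc Jc] := Jt b; rewrite -(subrK c b) scalerDl.
apply: (@submodD K (kmod X) _ (lspan_submod _)); first exact/lspan_catl/Hr/Js.
apply: lspan_catr.
have lx : linear (fun c : B => c *: x : kmod X).
  by move=> a u v; rewrite scalerDl -[a *: u]mulr_algl -scalerA.
exact: (lspan_map (mklin lx)).
Qed.

(** A linear map out of a left ideal, encoded as a total function constrained on [J] only. *)
Definition ideal_map (J : B -> Prop) (X : lmodType B) (f : B -> X) :=
  forall b j j', J j -> J j' -> f (b * j + j') = b *: f j + f j'.

(* Baer's criterion, relative to maps with values in the submodule P. *)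
Definition baer_in (X : lmodType B) (P : X -> Prop) :=
  forall (J : B -> Prop) (f : B -> X), @submod B (B : pzRingType)^o J ->
    ideal_map J f -> (forall j, J j -> P (f j)) ->
  exists2 w, P w & forall j, J j -> f j = j *: w.

Definition baer (X : lmodType B) := baer_in (fun _ : X => True).

Lemma ideal_map0 J (X : lmodType B) (f : B -> X) :
  @submod B (B : pzRingType)^o J -> ideal_map J f -> f 0 = 0.
Proof.
move=> [J0 _] fl; have := fl 1 0 0 J0 J0; rewrite mulr0 addr0 scale1r => /esym/eqP.
by rewrite -subr_eq0 addrK => /eqP.
Qed.

Lemma ideal_mapZ J (X : lmodType B) (f : B -> X) b j :
  @submod B (B : pzRingType)^o J -> ideal_map J f -> J j -> f (b * j) = b *: f j.
Proof.
move=> sJ fl Jj; rewrite -[b * j]addr0 fl //; last by case: sJ.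
by rewrite (ideal_map0 sJ fl) addr0.
Qed.

Lemma ideal_mapB J (X : lmodType B) (f : B -> X) j j' :
  @submod B (B : pzRingType)^o J -> ideal_map J f -> J j -> J j' ->
  f (j - j') = f j - f j'.
Proof. by move=> sJ fl Jj Jj'; rewrite addrC -mulN1r fl // scaleN1r addrC. Qed.

(** A map from a left ideal to [Q] is lifted to [I] one generator at a time, the kernel of [p]
    absorbing the mismatch; Baer's criterion for [I] then applies to the lift. *)
Lemma baer_quotient (I Q : lmodType B) (p : {linear I -> Q}) :
    (forall y, exists x, p x = y) -> baer I -> baer_in (fun x => p x = 0) -> baer Q.
Proof.
move=> pS bI bP J f sJ fl _; have [s [sJ1 Js]] := noethB sJ.
have lJ (r : seq B) : (forall x, x \in r -> J x) -> forall b, @lspan B (B : pzRingType)^o r b -> J b.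
  by move=> rJ b; apply: lspan_min.
suff [g gl pg] : exists2 g : B -> I, ideal_map (@lspan B (B : pzRingType)^o s) g &
    forall b, @lspan B (B : pzRingType)^o s b -> p (g b) = f b.
  have [//|w _ gw] := bI _ g (lspan_submod s) gl.
  exists (p w) => // j Jj; rewrite -pg ?gw ?linearZ //; exact: Js.
elim: s sJ1 {Js} => [|x s IHs] sJ1.
  exists (fun=> 0) => [b j j' _ _|b /= ->]; first by rewrite scaler0 addr0.
  by rewrite linear0 (ideal_map0 sJ fl).
have sJ' y : y \in s -> J y by move=> ys; apply: sJ1; rewrite inE ys orbT.
have Jx : J x by apply: sJ1; apply: mem_head.
have [g gl pg] := IHs sJ'; set Ls := @lspan B (B : pzRingType)^o s in gl pg *.
have sLs : @submod B (B : pzRingType)^o Ls := lspan_submod s.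
have [y py] := pS (f x).
(* [A] consists of the multipliers of the new generator [x] that land in the ideal treated so far.
   On it [phi] compares the existing lift with the chosen preimage [y] of [f x], with values in the
   kernel of [p]; the correction [c] makes the two agree. *)
pose A (b : B) := Ls (b * x); pose phi b := g (b * x) - b *: y.
have sA : @submod B (B : pzRingType)^o A.
  split=> [|a u v Au Av]; first by rewrite /A mul0r; case: sLs.
  by rewrite /A mulrDl -mulrA; apply: sLs.2.
have phil : ideal_map A phi.
  move=> b j j' Aj Aj'; rewrite /phi mulrDl -mulrA gl // scalerDl scalerBr scalerA.
  by rewrite opprD addrACA.
have [|c pc phic] := bP A phi sA phil.
  move=> b Ab; rewrite linearB linearZ py pg // (ideal_mapZ _ sJ fl Jx) subrr //.
have [h hE] : exists h : B -> I, forall v, @lspan B (B : pzRingType)^o (x :: s) v ->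
    exists2 a : B, Ls (v - a * x) & h v = g (v - a * x) + a *: (y + c).
  apply: (@choice_on B I 0 _ (fun v w => exists2 a : B, Ls (v - a * x) &
    w = g (v - a * x) + a *: (y + c))) => v [a La].
  by exists (g (v - a * x) + a *: (y + c)), a.
have huniq v (a : B) : @lspan B (B : pzRingType)^o (x :: s) v -> Ls (v - a * x) ->
    h v = g (v - a * x) + a *: (y + c).
  move=> /hE[a' La' ->] La; apply/eqP; rewrite -subr_eq0 opprD addrACA.
  rewrite -(ideal_mapB sLs gl) // -scalerBl.
  have -> : v - a' * x - (v - a * x) = (a - a') * x.
    by rewrite opprB addrC mulrBl addrA subrK.
  have Aa : A (a - a').
    have := submodB sLs La' La; rewrite /A.
    by rewrite opprB addrC mulrBl addrA subrK.
  have := phic _ Aa; rewrite /phi => /eqP; rewrite subr_eq => /eqP ->.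
  by rewrite -scalerDr [c + y]addrC -[a' - a]opprB scaleNr subrr.
exists h => [b j j' Lj Lj'|v Lv].
  have [a La ->] := hE _ Lj; have [a' La' ->] := hE _ Lj'.
  rewrite (huniq _ (b * a + a')); first 1 last.
  - exact: (lspan_submod (x :: s)).2.
  - have -> : b * j + j' - (b * a + a') * x = b * (j - a * x) + (j' - a' * x).
      by rewrite mulrDl mulrBr opprD addrACA mulrA.
    exact: sLs.2.
  have -> : b * j + j' - (b * a + a') * x = b * (j - a * x) + (j' - a' * x).
    by rewrite mulrDl mulrBr opprD addrACA mulrA.
  by rewrite gl // [(b * a + a') *: _]scalerDl [b *: (_ + _)]scalerDr scalerA addrACA.
have [a La ->] := hE _ Lv; rewrite linearD pg // linearZ /= linearD py pc addr0.
have Lva : J (v - a * x) by apply: lJ La.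
rewrite -(ideal_mapZ a sJ fl Jx); have := fl 1 (v - a * x) (a * x) Lva.
rewrite mul1r scale1r subrK => -> //; exact: (submodZ sJ).
Qed.

Hypothesis fdim_essentialB : forall (X : lmodType B) (N : X -> Prop),
  noeth X -> submod N -> fdim N -> essential N -> fdim (fun _ : X => True).

(** The map [f] has finite-dimensional image. It is extended by zero to a left ideal containing a
    finite-codimensional [Y']. An element [w] of [X] representing the extension is killed by [Y'],
    hence locally finite. *)
Lemma baer_locfin (X : lmodType B) : baer X -> baer_in (@locfin X).
Proof.
move=> bX J f sJ fl fJ.
pose Bo : lmodType B := (B : pzRingType)^o.
pose J0 (b : B) := J b /\ f b = 0.
have sJ0 : @submod B Bo J0.
  split; first by split; [case: sJ|apply: ideal_map0 fl].
  move=> a u v [Ju fu] [Jv fv]; split; first exact: sJ.2.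
  by rewrite [LHS]fl // fu fv scaler0 addr0.
pose pi := quo_pi sJ0; pose N (w : quoT sJ0) := exists2 b, J b & pi b = w.
have sN : submod N := submod_im pi sJ.
have nX : noeth (quoT sJ0) by apply: noeth_img noethB; apply: quo_pi_surj.
have ffJ : fdim (fun y => exists2 j, J j & f j = y).
  have [s [sJ1 Js]] := noethB sJ.
  have [r Hr] : exists r : seq X, forall b, @lspan B Bo s b -> @lspan K (kmod X) r (f b).
    elim: s sJ1 {Js} => [|x s IHs] sJ1.
      by exists [::] => j /= ->; rewrite (ideal_map0 sJ fl).
    have sJ' y : y \in s -> J y by move=> ys; apply: sJ1; rewrite inE ys orbT.
    have Jx : J x by apply: sJ1; apply: mem_head.
    have [r Hr] := IHs sJ'; have [r0 Hr0] := fJ x Jx.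
    exists (r0 ++ r) => v [b Lv].
    have Jv : J (v - b * x) by apply: lspan_min Lv.
    have -> : f v = f (v - b * x) + b *: f x.
      have := fl 1 _ _ Jv (submodZ sJ b Jx); rewrite mul1r scale1r subrK => ->.
      by rewrite (ideal_mapZ b sJ fl Jx).
    apply: (@submodD K (kmod X) _ (lspan_submod _)); first exact/lspan_catr/Hr.
    by apply/lspan_catl/Hr0; exists b.
  by exists r => _ [j /Js/Hr jr <-].
have fN : fdim N.
  have sfJ : @submod K (kmod X) (fun y => exists2 j, J j & f j = y).
    split; first by exists 0; [case: sJ|apply: ideal_map0 fl].
    move=> a _ _ [u Ju <-] [v Jv <-]; exists (a%:A * u + v); first exact: sJ.2.
    by rewrite fl.
  have [t [tR Rt]] := kspan_fingen sfJ ffJ.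
  have [r [rJ Er]] := map_preimage tR.
  exists (map pi r) => _ [b Jb <-].
  have : @lspan K (kmod X) t (f b) by apply: Rt; exists b.
  rewrite -{t tR Rt}Er; elim: r rJ b Jb => [|x r IHr] rJ b Jb /=.
    by move=> fb; apply/(quo_pi_eq0 sJ0).
  have Jx : J x by apply: rJ; apply: mem_head.
  move=> [c rc]; exists c.
  have -> : pi b - c *: (pi x : kmod (quoT sJ0)) = pi (b - c%:A * x).
    by rewrite (linearB pi b (c%:A * x)) [pi (c%:A * x)](linearZ_LR pi c%:A).
  apply: IHr.
  - by move=> w wr; apply: rJ; rewrite inE wr orbT.
  - by apply: (submodB sJ) => //; apply: (submodZ sJ).
  - by rewrite (ideal_mapB sJ fl) // ?(ideal_mapZ _ sJ fl) //; apply: (submodZ sJ).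
(* In the quotient of [B] by the kernel of [f], the image [N] of [J] is finite-dimensional. Dividing
   further by [Y] makes it essential, so that [fdim_essentialB] bounds the whole quotient. *)
have [Y [sY [YN eN]]] := essential_quotient nX sN.
have fY : fdim (fun _ : quoT sY => True).
  apply: fdim_essentialB eN.
  - by apply: noeth_img nX; apply: quo_pi_surj.
  - exact: submod_im.
  - exact: fdim_img.
pose Y' (b : B) := Y (pi b); have sY' : @submod B Bo Y' := submod_preim pi sY.
have cY : cofinite Y'.
  have lh : linear (fun b : B => quo_pi sY (pi b) : kmod (quoT sY)).
    by move=> a u v; rewrite -[a *: u]mulr_algl; apply: (linearP (lcomp (quo_pi sY) pi) a%:A).
  apply: cofinite_sub (cofinite_ker lh _ fY) => // b /(quo_pi_eq0 sY) //.
have YJ b : Y' b -> J b -> f b = 0.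
  by move=> Yb Jb; have /(quo_pi_eq0 sJ0)[] : pi b = 0 by apply: YN => //; exists b.
(* [h] is [f] on [J] and zero on [Y']; by [YJ] this is consistent on the intersection. *)
pose J1 (b : B) := exists2 j, J j & Y' (b - j).
have sJ1 : @submod B Bo J1 := submod_add sJ sY'.
have [h hE] : exists h : B -> X, forall b, J1 b -> exists2 j, J j /\ Y' (b - j) & h b = f j.
  apply: (@choice_on B X 0 J1 (fun b w => exists2 j, J j /\ Y' (b - j) & w = f j)).
  by move=> b [j Jj Yj]; exists (f j), j.
have huniq b j : J j -> Y' (b - j) -> h b = f j.
  move=> Jj Yj; have [|j' [Jj' Yj'] ->] := hE b; first by exists j.
  apply/eqP; rewrite -subr_eq0 -(ideal_mapB sJ fl) //; apply/eqP/YJ; last exact: (submodB sJ).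
  by have := submodB sY' Yj Yj'; rewrite opprB addrC addrA subrK.
have hl : ideal_map J1 h.
  move=> b j j' /hE[i [Ji Yi] ->] /hE[i' [Ji' Yi'] ->].
  rewrite (huniq _ (b * i + i')) ?fl //; first exact: sJ.2.
  have -> : b * j + j' - (b * i + i') = b * (j - i) + (j' - i').
    by rewrite mulrBr opprD addrACA.
  exact: sY'.2.
have [//|w _ hw] := bX J1 h sJ1 hl.
exists w.
  apply: (locfin_cofinite sY' cY) => b Yb.
  have J1b : J1 b by exists 0; [case: sJ|rewrite subr0].
  rewrite -hw // (huniq b 0) ?subr0 //; last by case: sJ.
  by rewrite (ideal_map0 sJ fl); case: (locfin_submod X).
move=> j Jj; rewrite -hw; last by exists j; rewrite ?subrr //; case: sY'.
by rewrite (huniq j j) // subrr; case: sY'.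
Qed.

(** The quotient by the locally finite part is injective, [Q] being any model of that quotient. *)
Definition acyclic (X : lmodType B) := exists (Q : lmodType B) (q : {linear X -> Q}),
  [/\ forall y, exists x, q x = y, forall x, q x = 0 <-> locfin x & baer Q].

Lemma acyclic_locfin (X : lmodType B) : (forall x : X, locfin x) -> acyclic X.
Proof.
move=> lX; exists (quoT (submod_true X)), (quo_pi (submod_true X)); split.
- exact: quo_pi_surj.
- by move=> x; rewrite quo_pi_eq0; split.
move=> J f _ _ _; exists 0 => // j _; rewrite scaler0.
by have [x <-] := quo_pi_surj (f j); apply/quo_pi_eq0.
Qed.

Lemma acyclic_iso (X Y : lmodType B) (f : {linear Y -> X}) :
  injective f -> (forall x, exists y, f y = x) -> acyclic X -> acyclic Y.
Proof.
move=> fI fS [Q [q [qS q0 bQ]]]; exists Q, (lcomp q f); split=> // [y|x].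
  by have [x <-] := qS y; have [z <-] := fS x; exists z.
by rewrite q0; split; [apply: locfin_inj|apply: locfin_map].
Qed.

(** For [b] in the finite-codimensional ideal [J] the vector [b y] comes from [X]. Its class modulo
    locally finite vectors depends linearly on [b], so by injectivity it is [b] times the class of
    some [x]; then [J] moves [y - a x] into locally finite vectors. *)
Lemma acyclic_lift (X Y Z : lmodType B) (a : {linear X -> Y}) (q : {linear Y -> Z}) :
    injective a -> (forall y, q y = 0 <-> exists x, a x = y) -> acyclic X ->
  forall y, locfin (q y) -> exists2 y', locfin y' & q y' = q y.
Proof.
move=> aI q0 [Q [r [rS r0 bQ]]] y lqy.
pose J b := q (b *: y) = 0.
have sJ : @submod B (B : pzRingType)^o J.
  split=> [|b u v Ju Jv]; first by rewrite /J scale0r linear0.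
  have -> : J (b *: u + v) = (b *: q ((u : B) *: y) + q ((v : B) *: y) = 0).
    by rewrite /J scalerDl -linearP scalerA.
  by rewrite Ju Jv scaler0 addr0.
have [g gE] : exists g : B -> X, forall b, J b -> a (g b) = b *: y.
  by apply: (@choice_on B X 0 J (fun b x => a x = b *: y)) => b /q0.
have gl : ideal_map J (fun b => r (g b)).
  move=> b j j' Jj Jj'; rewrite -linearP; congr (r _); apply: aI.
  by rewrite linearP !gE //; [rewrite scalerDl -scalerA | apply: sJ.2].
have [//|w _ gw] := bQ J _ sJ gl.
have [x Ex] := rS w; exists (y - a x); last first.
  by rewrite linearB (_ : q (a x) = 0) ?subr0 //; apply/q0; exists x.
apply: (locfin_cofinite sJ (locfin_ann lqy)) => b Jb.
have -> : b *: (y - a x) = a (g b - b *: x) by rewrite linearB linearZ gE // scalerBr.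
by apply/locfin_map/r0; rewrite linearB linearZ Ex gw // subrr.
Qed.

(** By [acyclic_lift], [Y] modulo its locally finite part is [I] modulo the sum of [X] and the
    locally finite part of [I]. This sum satisfies Baer's criterion: it is an extension of the
    injective quotient of [X] by the locally finite part of [I], which is injective by
    [baer_locfin]. Then [baer_quotient] concludes. *)
Lemma acyclic_quotient (X I Y : lmodType B) (a : {linear X -> I}) (q : {linear I -> Y}) :
    injective a -> (forall y, exists x, q x = y) ->
    (forall y, q y = 0 <-> exists x, a x = y) -> acyclic X -> baer I -> acyclic Y.
Proof.
move=> aI qS q0 aX bI; have lift := acyclic_lift aI q0 aX.
have sL := locfin_submod Y.
exists (quoT sL), (quo_pi sL); split; [exact: quo_pi_surj|exact: quo_pi_eq0|].
apply: (@baer_quotient _ _ (lcomp (quo_pi sL) q)) => //.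
  move=> y; have [z <-] := quo_pi_surj y; have [x <-] := qS z; by exists x.
have kerE y : lcomp (quo_pi sL) q y = 0 <-> exists2 x, True & locfin (y - a x).
  rewrite /= quo_pi_eq0; split=> [/lift[y' ly' Ey]|[x _ ly]].
    have [x Ex] : exists x, a x = y - y' by apply/q0; rewrite linearB Ey subrr.
    by exists x => //; rewrite Ex opprB addrC subrK.
  have : locfin (q (y - a x)) by apply: locfin_map.
  by rewrite linearB (_ : q (a x) = 0) ?subr0 //; apply/q0; exists x.
have [Q [r [rS r0 bQ]]] := aX.
move=> J f sJ fl fJ.
have [k kE] : exists k : B -> X, forall b, J b -> locfin (f b - a (k b)).
  apply: (@choice_on B X 0 J (fun b x => locfin (f b - a x))) => b /fJ/kerE[x _ lx].
  by exists x.
have rP x x' : locfin (a x - a x') -> r x = r x'.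
  move=> lx; apply/eqP; rewrite -subr_eq0 -linearB; apply/eqP/r0/(locfin_inj aI).
  by rewrite linearB.
have kl : ideal_map J (fun b => r (k b)).
  move=> b j j' Jj Jj'; rewrite -linearP; apply: rP.
  have Jbj : J (b * j + j') by apply: sJ.2.
  have -> : a (k (b * j + j')) - a (b *: k j + k j') =
      (b *: (f j - a (k j)) + (f j' - a (k j'))) - (f (b * j + j') - a (k (b * j + j'))).
    by rewrite fl // linearP scalerBr addrACA -opprD opprB [RHS]addrC addrA subrK.
  apply: (submodB (locfin_submod I)); last exact: kE.
  by apply: (locfin_submod I).2; apply: kE.
have [//|w _ kw] := bQ J _ sJ kl; have [x Ex] := rS w.
have fxl : ideal_map J (fun b => f b - b *: a x).
  move=> b j j' Jj Jj'; rewrite fl // scalerDl scalerBr scalerA opprD addrACA //.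
have [|g lg fg] := baer_locfin bI sJ fxl.
  move=> j Jj; rewrite -(subrK (a (k j)) (f j)) -addrA; apply: (submodD (locfin_submod I)).
    exact: kE.
  rewrite -linearZ -linearB; apply/locfin_map/r0.
  by rewrite linearB linearZ Ex kw // subrr.
exists (a x + g).
  by apply/kerE; exists x => //; rewrite addrC addKr.
by move=> j Jj; rewrite scalerDr -fg // addrC subrK.
Qed.

End LocallyFinite.

(** * Dickson's lemma and Noetherianity of enveloping algebras *)

(** Induction on the length. A finite basis for the tails is lifted to [G], with heads bounded by
    [k0]; sequences whose head is at least [k0] are dominated through [G], and each of the finitely
    many smaller heads is treated separately. *)
Lemma dickson_seq n (L : seq nat -> Prop) : (forall s, L s -> size s = n) ->
  exists F : seq (seq nat), (forall f, f \in F -> L f) /\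
    forall s, L s -> exists2 f, f \in F & forall i, (nth 0 f i <= nth 0 s i)%N.
Proof.
elim: n L => [|n IHn] L Ln.
  have [L0|nL] := pselect (L [::]); last first.
    by exists [::]; split=> // s Ls; case: nL; rewrite -(size0nil (Ln s Ls)).
  exists [:: [::]]; split=> [f|s Ls]; first by rewrite inE => /eqP ->.
  by exists [::] => // i; rewrite nth_nil.
have [|F' [F'L LF']] := IHn (fun s => exists k, L (k :: s)).
  by move=> s [k /Ln [->]].
have [|G [GL EG]] := @map_preimage _ _ behead (fun s => L s /\ s != [::]) F'.
  by move=> s /F'L[k Lk]; exists (k :: s).
pose k0 := \max_(s <- G) head 0%N s.
have [H [HL LH]] : exists H : seq (seq nat), (forall h, h \in H -> L h) /\
    forall k s, (k < k0)%N -> L (k :: s) ->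
      exists2 h, h \in H & forall i, (nth 0 h i <= nth 0 (k :: s) i)%N.
  elim: k0 => [|k1 [H [HL LH]]]; first by exists [::].
  have [|F1 [F1L LF1]] := IHn (fun s => L (k1 :: s)); first by move=> s /Ln [->].
  exists (map (cons k1) F1 ++ H); split=> [h|k s].
    by rewrite mem_cat => /orP[/mapP[s /F1L Ls ->]|/HL].
  rewrite ltnS leq_eqVlt => /predU1P[->|kk1] Ls.
    have [f fF1 fs] := LF1 s Ls; exists (k1 :: f); last by case.
    by rewrite mem_cat map_f.
  by have [h hH hs] := LH k s kk1 Ls; exists h => //; rewrite mem_cat hH orbT.
exists (G ++ H); split=> [f|s Ls].
  by rewrite mem_cat => /orP[/GL[]|/HL].
case: s Ls => [/Ln //|k s] Ls; have [kk0|k0k] := ltnP k k0.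
  by have [h hH hs] := LH k s kk0 Ls; exists h => //; rewrite mem_cat hH orbT.
have [f fF' fs] := LF' s (ex_intro _ k Ls).
move: fF'; rewrite -EG => /mapP[[|l g] gG Ef]; first by case: (GL _ gG).
exists (l :: g); first by rewrite mem_cat gG.
move=> [|i] /=; last by rewrite -[g]/(behead (l :: g)) -Ef.
by apply: leq_trans k0k; apply: (leq_bigmax_seq (F := head 0%N) (l :: g)).
Qed.

Section Dickson.
Import mpoly.

Lemma dickson n (L : mpoly.multinom n -> Prop) :
  exists F : seq (mpoly.multinom n), (forall m, m \in F -> L m) /\
    forall m, L m -> exists2 f, f \in F & mpoly.lem f m.
Proof.
have [|F' [F'L LF']] := @dickson_seq n (fun s => exists2 m : mpoly.multinom n, L m & val (val m) = s).
  by move=> s [m _ <-]; apply: size_tuple.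
have [F [FL EF]] := map_preimage F'L; exists F; split=> // m Lm.
have [f] := LF' _ (ex_intro2 _ _ m Lm erefl).
rewrite -EF => /mapP[g gF ->] gm; exists g => //.
by apply/mpoly.mnm_lepP => i; rewrite !(mpoly.mnm_nth 0).
Qed.

End Dickson.

Section MonomialSpans.
Import mpoly.
Variables (K : fieldType) (A : algType K) (n : nat) (x : 'I_n -> A).
Hypothesis x_comm : forall i j,
  @lspan K A [seq x k | k <- enum 'I_n] (x i * x j - x j * x i).
Hypothesis x_gen : forall a : A, subalgebra_gen (fun u => exists i, u = x i) a.

Local Notation mon := (mpoly.multinom n).

Definition wmon (w : seq 'I_n) : A := \prod_(i <- w) x i.

Lemma wmon_cons i w : wmon (i :: w) = x i * wmon w.
Proof. exact: big_cons. Qed.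

Lemma wmon_nil : wmon [::] = 1.
Proof. exact: big_nil. Qed.

Lemma wmon_cat w w' : wmon (w ++ w') = wmon w * wmon w'.
Proof. exact: big_cat. Qed.

Definition wspan (D : seq 'I_n -> Prop) (a : A) :=
  exists s, (forall w, w \in s -> D w) /\ @lspan K A (map wmon s) a.

Lemma wspan_submod D : @submod K A (wspan D).
Proof.
split=> [|c u v [s [sD su]] [t [tD tv]]]; first by exists [::].
exists (s ++ t); split=> [w|]; first by rewrite mem_cat => /orP[/sD|/tD].
rewrite map_cat; have sL := @lspan_submod K A (map wmon s ++ map wmon t).
by apply: sL.2; [apply: lspan_catl|apply: lspan_catr].
Qed.

Lemma wspan_mem (D : seq 'I_n -> Prop) w : D w -> wspan D (wmon w).
Proof.
move=> Dw; exists [:: w]; split=> [v|]; first by rewrite inE => /eqP ->.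
exact: lspan_head.
Qed.

Lemma wspan_min (D : seq 'I_n -> Prop) (P : A -> Prop) a :
  @submod K A P -> (forall w, D w -> P (wmon w)) -> wspan D a -> P a.
Proof.
move=> sP DP [s [sD sa]]; apply: lspan_min sP _ sa => _ /mapP[w /sD Dw ->].
exact: DP.
Qed.

Lemma wspan_sub (D D' : seq 'I_n -> Prop) a :
  (forall w, D w -> D' w) -> wspan D a -> wspan D' a.
Proof.
move=> DD'; apply: wspan_min; first exact: wspan_submod.
by move=> w /DD'; apply: wspan_mem.
Qed.

Lemma mull_submod (P : A -> Prop) a : @submod K A P -> @submod K A (fun b => P (a * b)).
Proof.
move=> sP; split=> [|c u v Pu Pv]; first by rewrite mulr0; case: sP.
by rewrite mulrDr -scalerAr; apply: sP.2.
Qed.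

Lemma mulr_submod (P : A -> Prop) a : @submod K A P -> @submod K A (fun b => P (b * a)).
Proof.
move=> sP; split=> [|c u v Pu Pv]; first by rewrite mul0r; case: sP.
by rewrite mulrDl -scalerAl; apply: sP.2.
Qed.

Definition shorter k := wspan (fun w => (size w < k)%N).

Lemma shorter_leq k l a : (k <= l)%N -> shorter k a -> shorter l a.
Proof. by move=> kl; apply: wspan_sub => w wk; apply: leq_trans wk kl. Qed.

Lemma shorter_mull i k a : shorter k a -> shorter k.+1 (x i * a).
Proof.
apply: (@wspan_min _ (fun b => shorter k.+1 (x i * b))).
  exact/mull_submod/wspan_submod.
by move=> w wk; rewrite -wmon_cons; apply: wspan_mem.
Qed.

Lemma shorter_wmull w k a : shorter k a -> shorter (size w + k) (wmon w * a).
Proof.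
elim: w => [|i w IHw] ka; first by rewrite wmon_nil mul1r.
by rewrite wmon_cons -mulrA; apply/shorter_mull/IHw.
Qed.

Lemma shorter_wmulr w k a : shorter k a -> shorter (k + size w) (a * wmon w).
Proof.
apply: (@wspan_min _ (fun b => shorter (k + size w) (b * wmon w))).
  exact/mulr_submod/wspan_submod.
by move=> v vk; rewrite -wmon_cat; apply: wspan_mem; rewrite size_cat ltn_add2r.
Qed.

Lemma wmon_insert i w1 w2 :
  shorter (size w1 + size w2).+1 (wmon (i :: w1 ++ w2) - wmon (w1 ++ i :: w2)).
Proof.
elim: w1 => [|j w1 IHw]; first by rewrite subrr; case: (wspan_submod (fun w => size w < (size w2).+1)%N).
have -> : wmon (i :: (j :: w1) ++ w2) - wmon ((j :: w1) ++ i :: w2) =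
    (x i * x j - x j * x i) * wmon (w1 ++ w2)
    + x j * (wmon (i :: w1 ++ w2) - wmon (w1 ++ i :: w2)).
  rewrite !cat_cons !wmon_cons mulrBl mulrBr !mulrA addrA; congr (_ - _).
  by rewrite subrK.
apply: (submodD (wspan_submod _)); last first.
  by apply: shorter_leq (shorter_mull _ IHw); rewrite addSn.
apply: (@lspan_min _ _ _ (fun b => wspan _ (b * wmon (w1 ++ w2))) _ _ _ (x_comm i j)).
  exact/mulr_submod/wspan_submod.
move=> _ /mapP[k _ ->].
by rewrite -wmon_cons; apply: wspan_mem; rewrite /= size_cat addSn.
Qed.

(** Exchanging two letters costs a combination of words with one letter less, since commutators of
    letters are combinations of letters. *)
Lemma wmon_perm w w' : perm_eq w w' -> shorter (size w) (wmon w - wmon w').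
Proof.
elim: w w' => [|i w IHw] w' ww'.
  rewrite perm_sym in ww'; rewrite (perm_nilP ww') subrr.
  by case: (wspan_submod (fun w => size w < 0)%N).
have iw' : i \in w' by rewrite -(perm_mem ww') mem_head.
case/splitPr: iw' ww' => w1 w2 ww'.
have {}ww' : perm_eq w (w1 ++ w2).
  by rewrite -(perm_cons i) (perm_trans ww') // -[i :: w2]cat1s perm_catCA.
have -> : wmon (i :: w) - wmon (w1 ++ i :: w2) =
    x i * (wmon w - wmon (w1 ++ w2)) + (wmon (i :: w1 ++ w2) - wmon (w1 ++ i :: w2)).
  by rewrite !wmon_cons mulrBr addrA subrK.
apply: (submodD (wspan_submod _)); first exact/shorter_mull/IHw.
by rewrite /= (perm_size ww') size_cat; apply: wmon_insert.
Qed.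

Definition mword (m : mon) : seq 'I_n := flatten [seq nseq (m i) i | i <- enum 'I_n].

Lemma count_mword m i : count_mem i (mword m) = m i.
Proof.
rewrite /mword count_flatten -map_comp.
rewrite (eq_map (g := fun j => ((j == i) * m j)%N)); last first.
  by move=> j /=; rewrite count_nseq /=.
rewrite sumnE big_map big_enum /= (bigD1 i) //= eqxx mul1n big1 ?addn0 //.
by move=> j /negbTE ->.
Qed.

Lemma size_mword m : size (mword m) = mpoly.mdeg m.
Proof.
rewrite mpoly.mdegE /mword size_flatten /shape -map_comp sumnE big_map big_enum /=.
by apply: eq_bigr => i _; rewrite size_nseq.
Qed.

Definition wmult (w : seq 'I_n) : mon :=
  mpoly.Multinom [tuple (count_mem i w)%N | i < n].

Lemma wmultE w i : wmult w i = count_mem i w.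
Proof. exact: mpoly.mnmE. Qed.

Lemma perm_mword w : perm_eq w (mword (wmult w)).
Proof. by apply/allP => i _; rewrite /= count_mword wmultE. Qed.

Definition emon (m : mon) : A := wmon (mword m).

Definition espan (D : mon -> Prop) (a : A) :=
  exists s, (forall m, m \in s -> D m) /\ @lspan K A (map emon s) a.

Lemma espan_submod D : @submod K A (espan D).
Proof.
split=> [|c u v [s [sD su]] [t [tD tv]]]; first by exists [::].
exists (s ++ t); split=> [w|]; first by rewrite mem_cat => /orP[/sD|/tD].
rewrite map_cat; have sL := @lspan_submod K A (map emon s ++ map emon t).
by apply: sL.2; [apply: lspan_catl|apply: lspan_catr].
Qed.

Lemma espan_mem (D : mon -> Prop) m : D m -> espan D (emon m).
Proof.
move=> Dm; exists [:: m]; split=> [v|]; first by rewrite inE => /eqP ->.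
exact: lspan_head.
Qed.

Lemma espan_min (D : mon -> Prop) (P : A -> Prop) a :
  @submod K A P -> (forall m, D m -> P (emon m)) -> espan D a -> P a.
Proof.
move=> sP DP [s [sD sa]]; apply: lspan_min sP _ sa => _ /mapP[w /sD Dw ->].
exact: DP.
Qed.

Lemma espan_sub (D D' : mon -> Prop) a :
  (forall m, D m -> D' m) -> espan D a -> espan D' a.
Proof.
move=> DD'; apply: espan_min; first exact: espan_submod.
by move=> m /DD'; apply: espan_mem.
Qed.

Lemma shorter_espan k a : shorter k a -> espan (fun m => (mpoly.mdeg m < k)%N) a.
Proof.
elim: k a => [|k IHk] a.
  by apply: wspan_min => //; apply: espan_submod.
apply: wspan_min => [|w wk]; first exact: espan_submod.
rewrite -(subrK (emon (wmult w)) (wmon w)); apply: (submodD (espan_submod _)).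
  apply: (@espan_sub (fun m => mpoly.mdeg m < k)%N); first by move=> m /leqW.
  apply: IHk; apply: shorter_leq (wmon_perm (perm_mword w)).
  by rewrite -ltnS.
by apply: espan_mem; rewrite -size_mword -(perm_size (perm_mword w)).
Qed.

Lemma wspan_full a : wspan (fun _ => True) a.
Proof.
elim: (x_gen a) => {a} [_ [i ->]|c|u v _ su _ sv|u v _ su _ sv].
- by rewrite -[x i]mulr1 -wmon_nil -wmon_cons; apply: wspan_mem.
- apply: (submodZ (wspan_submod _)).
  by rewrite -wmon_nil; apply: wspan_mem.
- exact: (submodD (wspan_submod _)).
apply: (@wspan_min _ (fun b => wspan _ (b * v)) _ _ _ su) => [|w _].
  exact/mulr_submod/wspan_submod.
apply: (@wspan_min _ (fun b => wspan _ (wmon w * b)) _ _ _ sv) => [|w' _].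
  exact/mull_submod/wspan_submod.
by rewrite -wmon_cat; apply: wspan_mem.
Qed.

Lemma espan_full a : espan (fun _ => True) a.
Proof.
apply: wspan_min (wspan_full a) => [|w _]; first exact: espan_submod.
have : shorter (size w).+1 (wmon w) by apply: wspan_mem.
by move=> /shorter_espan; apply: espan_sub.
Qed.

(** The order on exponents compares degrees first, so shorter words count as lower terms. *)
Definition below (m : mon) := espan (fun m' => (m' < m)%O).

Lemma shorter_below m a : shorter (mpoly.mdeg m) a -> below m a.
Proof. by move=> /shorter_espan; apply: espan_sub => m'; apply: mpoly.lt_mdeg_ltmc. Qed.

Lemma emonM m m' : shorter (mpoly.mdeg (mpoly.mnm_add m m'))
  (emon m * emon m' - emon (mpoly.mnm_add m m')).
Proof.
rewrite /emon -wmon_cat mpoly.mdegD -!size_mword -size_cat; apply: wmon_perm.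
by apply/allP => i _; rewrite /= count_cat !count_mword mpoly.mnmDE.
Qed.

Lemma emonM_below m m' : below (mpoly.mnm_add m m')
  (emon m * emon m' - emon (mpoly.mnm_add m m')).
Proof. exact/shorter_below/emonM. Qed.

Lemma below_mull m m' a : below m a -> below (mpoly.mnm_add m' m) (emon m' * a).
Proof.
apply: (@espan_min _ (fun b => below (mpoly.mnm_add m' m) (emon m' * b))) => [|d dm].
  exact/mull_submod/espan_submod.
rewrite -(subrK (emon (mpoly.mnm_add m' d)) (_ * _)).
apply: (submodD (espan_submod _)).
  apply: espan_sub (emonM_below m' d) => e /Order.POrderTheory.lt_trans; apply.
  by rewrite mpoly.ltmc_add2r.
by apply: espan_mem; rewrite mpoly.ltmc_add2r.
Qed.

Lemma espan_top (D : mon -> Prop) a : espan D a -> a <> 0 -> exists2 m', D m' &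
  exists c, below m' (a - c *: emon m').
Proof.
move=> [s [sD sa]] a0.
have [m' m's allm'] : exists2 m', m' \in s & forall d, d \in s -> (d <= m')%O.
  case: s sD sa => [|m1 s] _; first by move=> sa; case: a0.
  move=> _; elim: s => [|d s [m' m's IHs]].
    by exists m1 => [|d]; rewrite inE // => /eqP ->.
  have [dm|md] := Order.TotalTheory.leP d m'.
    exists m' => [|e]; first by move: m's; rewrite !inE => /orP[->|->]; rewrite ?orbT.
    rewrite !inE orbCA => /predU1P[->//|es]; exact: IHs.
  exists d => [|e]; first by rewrite !inE eqxx orbT.
  rewrite !inE orbCA => /predU1P[->|es]; first exact: Order.POrderTheory.lexx.
  by apply: Order.POrderTheory.le_trans (Order.POrderTheory.ltW md); apply: IHs.
exists m'; first exact: sD.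
have : espan (fun d => d <= m')%O a by exists s.
apply: (espan_min (P := fun a => exists c, below m' (a - c *: emon m'))) => [|d].
  split=> [|b u v [c uc] [e ve]].
    by exists 0; rewrite scale0r subr0; case: (espan_submod (fun d => d < m')%O).
  exists (b * c + e); have := (espan_submod (fun d => d < m')%O).2 b _ _ uc ve.
  by rewrite scalerBr scalerA addrACA -opprD -scalerDl.
rewrite Order.POrderTheory.le_eqVlt => /predU1P[->|dm'].
  by exists 1; rewrite scale1r subrr; case: (espan_submod (fun d => d < m')%O).
by exists 0; rewrite scale0r subr0; apply: espan_mem.
Qed.

(** A Groebner basis argument: Dickson's lemma gives finitely many leading exponents [F] of elements
    of [J], and well-founded reduction by the elements [G f] brings every element of [J] to zero.
    Leading terms refer to some expression in ordered monomials. *)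
Theorem noeth_enveloping : noeth (A : pzRingType)^o.
Proof.
move=> J sJ.
pose L m := exists2 u, J u & below m (u - emon m).
have [F [FL LF]] := dickson L.
have [G GP] : exists G : mon -> A, forall m, L m -> J (G m) /\ below m (G m - emon m).
  apply: (@choice_on mon A 0 L (fun m u => J u /\ below m (u - emon m))) => m [u Ju um].
  by exists u.
exists (map G F); split=> [_ /mapP[m /FL/GP[Jm _] ->]//|].
have step m' c a : (forall b, J b -> below m' b -> @lspan A (A : pzRingType)^o (map G F) b) ->
    J a -> below m' (a - c *: emon m') -> @lspan A (A : pzRingType)^o (map G F) a.
  move=> IHm Ja ac; have [c0|c0] := eqVneq c 0.
    by apply: IHm => //; move: ac; rewrite c0 scale0r subr0.
  have Lm' : L m'.
    exists (c^-1 *: a); first by rewrite -mulr_algl; apply: (submodZ sJ).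
    have := submodZ (espan_submod (fun d => d < m')%O) c^-1 ac.
    by rewrite scalerBr scalerA mulVf // scale1r.
  have [f fF fm'] := LF _ Lm'; have [Jf fb] := GP f (FL f fF).
  (* The exponent [f] divides [m'], so a left multiple of [G f] by the monomial of the quotient
     cancels the leading term of [a], up to lower terms. *)
  pose d := mpoly.mnm_sub m' f.
  have Ed : mpoly.mnm_add d f = m' by apply: mpoly.submK.
  pose b := c *: emon d.
  have Lb : @lspan A (A : pzRingType)^o (map G F) (b * G f).
    by apply: (submodZ (lspan_submod _)); apply: lspan_mem; apply: map_f.
  rewrite -(subrK (b * G f) a); apply: (submodD (lspan_submod _)) => //.
  apply: IHm.
    by apply: (submodB sJ) => //; apply: (submodZ sJ).
  have -> : a - b * G f = (a - c *: emon m')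
      - c *: (emon d * (G f - emon f) + (emon d * emon f - emon m')).
    rewrite mulrBr addrA subrK scalerBr opprB addrA subrK /b scalerAl //.
  apply: (submodB (espan_submod _)) => //; apply: (submodZ (espan_submod _)).
  by apply: (submodD (espan_submod _)); rewrite -Ed; [apply: below_mull|apply: emonM_below].
have red m : forall a, J a -> below m a -> @lspan A (A : pzRingType)^o (map G F) a.
  elim/(@mpoly.ltmwf n): m => m IHm a Ja am.
  have [->|/eqP a0] := eqVneq a 0; first exact: lspan0.
  have [m' m'm [c ac]] := espan_top am a0.
  by apply: step ac => //; apply: IHm.
move=> a Ja; have [->|/eqP a0] := eqVneq a 0; first exact: lspan0.
have [m' _ [c ac]] := espan_top (espan_full a) a0.
by apply: step ac => //; apply: red.
Qed.

End MonomialSpans.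

(** * Linear extension, subalgebras, endomorphism algebras and coinduced modules *)

Section LinearExtension.
Variables (K : fieldType) (V W : lmodType K).

(** Zorn's lemma gives [Q] maximal among the subspaces meeting [P] trivially. Adjoining a vector
    outside the sum of [P] and [Q] would enlarge it. *)
Lemma submod_complement (P : V -> Prop) : submod P ->
  exists Q, [/\ submod Q, forall x, P x -> Q x -> x = 0 &
    forall x, exists2 y, P y & Q (x - y)].
Proof.
move=> sP; pose T := {Q : V -> Prop | submod Q /\ forall x, P x -> Q x -> x = 0}.
pose R (Q Q' : T) := `[< forall x, sval Q x -> sval Q' x >].
have t0 : T by exists (fun x => x = 0); split=> //; apply: submod_zero.
have [|||q maxQ] := @ZL_preorder T t0 R.
- by move=> Q; apply/asboolP.
- by move=> Q1 Q2 Q3 /asboolP H1 /asboolP H2; apply/asboolP => x /H1/H2.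
- move=> C totC; have [[q0 Cq0]|nC] := pselect (exists q, C q); last first.
    by exists t0 => s Cs; case: nC; exists s.
  pose U x := exists2 q, C q & sval q x.
  have UT : submod U /\ forall x, P x -> U x -> x = 0.
    split; last by move=> x Px [q Cq qx]; apply: (proj2_sig q).2.
    split; first by exists q0 => //; case: (proj2_sig q0) => -[].
    move=> a u v [q Cq qu] [q' Cq' q'v].
    have [/asboolP qq'|/asboolP q'q] := totC q q' Cq Cq'.
      by exists q' => //; apply: (proj2_sig q').1.2 => //; apply: qq'.
    by exists q => //; apply: (proj2_sig q).1.2 => //; apply: q'q.
  by exists (exist _ U UT) => s Cs; apply/asboolP => x sx; exists s.
have [sQ QP] := proj2_sig q; set Q := sval q in sQ QP *.
exists Q; split=> // x; apply: contrapT => nx.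
pose Q' y := exists2 z, Q z & exists c : K, y - z = c *: x.
have sQ' : submod Q'.
  split; first by exists 0; [case: sQ|exists 0; rewrite subr0 scale0r].
  move=> a u v [z Qz [c Ec]] [z' Qz' [d Ed]]; exists (a *: z + z'); first exact: sQ.2.
  exists (a * c + d); rewrite scalerDl -scalerA -Ec -Ed scalerBr opprD.
  by rewrite addrACA.
have Q'P y : P y -> Q' y -> y = 0.
  move=> Py [z Qz [c Ec]]; have [c0|c0] := eqVneq c 0.
    by move: Ec Qz; rewrite c0 scale0r => /eqP; rewrite subr_eq0 => /eqP <- ; apply: QP.
  case: nx; exists (c^-1 *: y); first exact: submodZ.
  have -> : x = c^-1 *: (y - z) by rewrite Ec scalerA mulVf // scale1r.
  by rewrite scalerBr addrC addKr; apply/(submodN sQ)/(submodZ sQ).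
have Q'Q : forall y, Q' y -> Q y.
  apply/asboolP; apply: (maxQ (exist _ Q' (conj sQ' Q'P))); apply/asboolP => y Qy.
  by exists y => //; exists 0; rewrite subrr scale0r.
case: nx; exists 0; first by case: sP.
rewrite subr0; apply: Q'Q; exists 0; first by case: sQ.
by exists 1; rewrite subr0 scale1r.
Qed.

Lemma linear_extension (P : V -> Prop) (f : V -> W) : submod P ->
    (forall a u v, P u -> P v -> f (a *: u + v) = a *: f u + f v) ->
  exists g : {linear V -> W}, forall x, P x -> g x = f x.
Proof.
move=> sP fl; have [Q [sQ QP PQ]] := submod_complement sP.
have [p pP] : exists p : V -> V, forall x, True -> P (p x) /\ Q (x - p x).
  apply: (@choice_on V V 0 (fun _ => True) (fun x y => P y /\ Q (x - y))) => x _.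
  by have [y] := PQ x; exists y.
have pu x y : P y -> Q (x - y) -> p x = y.
  move=> Py Qy; have [Pp Qp] := pP x I; apply/eqP; rewrite -subr_eq0; apply/eqP/QP.
    exact: submodB.
  by have := submodB sQ Qy Qp; rewrite opprB addrC addrA subrK.
have gl : linear (fun x => f (p x)).
  move=> a u v; have [Pu Qu] := pP u I; have [Pv Qv] := pP v I.
  rewrite (pu _ (a *: p u + p v)) ?fl //; first exact: sP.2.
  by rewrite opprD addrACA -scalerBr; apply: sQ.2.
exists (mklin gl) => x Px /=; rewrite (pu x x) // subrr.
by case: sQ.
Qed.

End LinearExtension.

Section Subalgebra.
Variables (K : fieldType) (U : algType K) (S : U -> Prop).

Definition subalg_pred : {pred U} := fun u => `[< subalgebra_gen S u >].

Lemma subalg_pred_closed : subalg_closed subalg_pred.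
Proof.
split=> [|c u v /asboolP Su /asboolP Sv|u v /asboolP Su /asboolP Sv]; apply/asboolP.
- by rewrite -[1]scale1r; apply: Gen_scalar.
- apply: Gen_add => //; rewrite -mulr_algl; apply: Gen_mul => //.
  exact: Gen_scalar.
- exact: Gen_mul.
Qed.

HB.instance Definition _ := GRing.isSubalgClosed.Build K U subalg_pred subalg_pred_closed.

Record subalg := Subalg { subalg_val : U; _ : subalg_val \in subalg_pred }.

HB.instance Definition _ := [isSub for subalg_val].
HB.instance Definition _ := [Choice of subalg by <:].
HB.instance Definition _ := [SubChoice_isSubAlgebra of subalg by <:].

Definition subalg_incl_fun (x : subalg) : U := val x.

Fact subalg_incl_linear : linear subalg_incl_fun.
Proof. by []. Qed.

Fact subalg_incl_monoid : monoid_morphism subalg_incl_fun.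
Proof. by []. Qed.

HB.instance Definition _ :=
  GRing.isLinear.Build K subalg U _ subalg_incl_fun subalg_incl_linear.
HB.instance Definition _ :=
  GRing.isMonoidMorphism.Build subalg U subalg_incl_fun subalg_incl_monoid.

Definition subalg_incl : {lrmorphism subalg -> U} := subalg_incl_fun.

Lemma subalg_inclE x : subalg_incl x = val x. Proof. by []. Qed.

Lemma subalg_incl_gen x : subalgebra_gen S (subalg_incl x).
Proof. by apply/asboolP; case: x. Qed.

Definition subalg_in u (Su : subalgebra_gen S u) : subalg := Subalg (asboolT Su).

Lemma subalg_gen (x : subalg) : subalgebra_gen (fun y : subalg => S (val y)) x.
Proof.
suff H u (Su : subalgebra_gen S u) : forall x : subalg, val x = u ->
    subalgebra_gen (fun y : subalg => S (val y)) x.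
  exact: H (subalg_incl_gen x) _ erefl.
elim: Su => {u x} [u Su|c|u v Su IHu Sv IHv|u v Su IHu Sv IHv] x Ex.
- by apply: Gen_in; rewrite Ex.
- rewrite (_ : x = c%:A); first exact: Gen_scalar.
  by apply: val_inj; rewrite Ex.
- rewrite (_ : x = subalg_in Su + subalg_in Sv); last exact: val_inj.
  by apply: Gen_add; [apply: IHu|apply: IHv].
- rewrite (_ : x = subalg_in Su * subalg_in Sv); last exact: val_inj.
  by apply: Gen_mul; [apply: IHu|apply: IHv].
Qed.

End Subalgebra.

Section LinearEndomorphisms.
Variables (K : fieldType) (V : lmodType K) (v0 : V) (v00 : v0 != 0).

(** The proof that [v0] is nonzero is a parameter because the algebra structure below requires
    [1 != 0]. *)
Record lend (w : v0 != 0) := Lend { lend_fun :> V -> V; lend_linear : linear lend_fun }.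

Notation E := (lend v00).

Lemma lendP (f g : E) : f =1 g -> f = g.
Proof.
case: f g => [f lf] [g lg] /= /funext Efg; subst g.
by congr Lend; apply: Prop_irrelevance.
Qed.

HB.instance Definition _ := gen_eqMixin E.
HB.instance Definition _ := gen_choiceMixin E.

Definition lend_lin (f : E) : {linear V -> V} := mklin (lend_linear f).

Lemma lend_add_linear (f g : E) : linear (fun v => f v + g v).
Proof. by move=> a u v; rewrite !lend_linear scalerDr addrACA. Qed.
Lemma lend_opp_linear (f : E) : linear (fun v => - f v).
Proof. by move=> a u v; rewrite lend_linear opprD scalerN. Qed.
Lemma lend_zero_linear : linear (fun _ : V => 0 : V).
Proof. exact: zero_linear. Qed.
Lemma lend_scale_linear (c : K) (f : E) : linear (fun v => c *: f v).
Proof. by move=> a u v; rewrite lend_linear scalerDr !scalerA mulrC. Qed.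
Lemma lend_one_linear : linear (fun v : V => v).
Proof. by []. Qed.
Lemma lend_mul_linear (f g : E) : linear (fun v => f (g v)).
Proof. by move=> a u v; rewrite !lend_linear. Qed.

Definition lend_add (f g : E) : E := Lend v00 (lend_add_linear f g).
Definition lend_opp (f : E) : E := Lend v00 (lend_opp_linear f).
Definition lend_zero : E := Lend v00 lend_zero_linear.
Definition lend_scale c (f : E) : E := Lend v00 (lend_scale_linear c f).
Definition lend_one : E := Lend v00 lend_one_linear.
Definition lend_mul (f g : E) : E := Lend v00 (lend_mul_linear f g).

Fact lend_addA : associative lend_add.
Proof. by move=> f g h; apply: lendP => v; apply: addrA. Qed.
Fact lend_addC : commutative lend_add.
Proof. by move=> f g; apply: lendP => v; apply: addrC. Qed.
Fact lend_add0 : left_id lend_zero lend_add.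
Proof. by move=> f; apply: lendP => v; apply: add0r. Qed.
Fact lend_addN : left_inverse lend_zero lend_opp lend_add.
Proof. by move=> f; apply: lendP => v; apply: addNr. Qed.

HB.instance Definition _ :=
  GRing.isZmodule.Build E lend_addA lend_addC lend_add0 lend_addN.

Fact lend_mulA : associative lend_mul.
Proof. by move=> f g h; apply: lendP. Qed.
Fact lend_mul1 : left_id lend_one lend_mul.
Proof. by move=> f; apply: lendP. Qed.
Fact lend_1mul : right_id lend_one lend_mul.
Proof. by move=> f; apply: lendP. Qed.
Fact lend_mulDl : left_distributive lend_mul +%R.
Proof. by move=> f g h; apply: lendP. Qed.
Fact lend_mulDr : right_distributive lend_mul +%R.
Proof. by move=> f g h; apply: lendP => v; apply: (linearD (lend_lin f)). Qed.
Fact lend_1neq0 : lend_one != 0.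
Proof. by apply: contra_neq v00 => /(congr1 (fun f : E => f v0)). Qed.

HB.instance Definition _ := GRing.Zmodule_isNzRing.Build E
  lend_mulA lend_mul1 lend_1mul lend_mulDl lend_mulDr lend_1neq0.

Fact lend_scaleA a b (f : E) : lend_scale a (lend_scale b f) = lend_scale (a * b) f.
Proof. by apply: lendP => v; apply: scalerA. Qed.
Fact lend_scale1 : left_id 1 lend_scale.
Proof. by move=> f; apply: lendP => v; apply: scale1r. Qed.
Fact lend_scaleDr : right_distributive lend_scale +%R.
Proof. by move=> a f g; apply: lendP => v; apply: scalerDr. Qed.
Fact lend_scaleDl f : {morph lend_scale^~ f : a b / a + b}.
Proof. by move=> a b; apply: lendP => v; apply: scalerDl. Qed.

HB.instance Definition _ := GRing.Zmodule_isLmodule.Build K E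
  lend_scaleA lend_scale1 lend_scaleDr lend_scaleDl.

Fact lend_scaleAl c (f g : E) : c *: (f * g) = c *: f * g.
Proof. by apply: lendP. Qed.
HB.instance Definition _ := GRing.Lmodule_isLalgebra.Build K E lend_scaleAl.
Fact lend_scaleAr c (f g : E) : c *: (f * g) = f * (c *: g).
Proof. by apply: lendP => v; rewrite /= [RHS](linearZ_LR (lend_lin f)). Qed.
HB.instance Definition _ := GRing.Lalgebra_isAlgebra.Build K E lend_scaleAr.

End LinearEndomorphisms.

Section Coinduced.
Variables (K : fieldType) (A : algType K).

(** The coinduced module Hom(A, X) of linear maps over the field, on which [a] acts by
    [(a f)(u) = f(u a)]. The unit sends [x] to [u] maps to [u x]. *)
Record coind (X : lmodType A) := Coind {
  coind_fun :> A -> kmod X; coind_linear : linear coind_fun }.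

Section Instances.
Variable X : lmodType A.

Lemma coindP (f g : coind X) : f =1 g -> f = g.
Proof.
case: f g => [f lf] [g lg] /= /funext Efg; subst g.
by congr Coind; apply: Prop_irrelevance.
Qed.

HB.instance Definition _ := gen_eqMixin (coind X).
HB.instance Definition _ := gen_choiceMixin (coind X).

Lemma coind_add_linear (f g : coind X) : linear (fun v => f v + g v).
Proof. by move=> a u v; rewrite !coind_linear scalerDr addrACA. Qed.
Lemma coind_opp_linear (f : coind X) : linear (fun v => - f v).
Proof. by move=> a u v; rewrite coind_linear opprD scalerN. Qed.
Lemma coind_zero_linear : linear (fun _ : A => 0 : kmod X).
Proof. exact: zero_linear. Qed.
Lemma coind_scale_linear (a : A) (f : coind X) : linear (fun u => f (u * a)).
Proof. by move=> c u v; rewrite mulrDl -scalerAl coind_linear. Qed.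

Definition coind_add (f g : coind X) := Coind (coind_add_linear f g).
Definition coind_opp (f : coind X) := Coind (coind_opp_linear f).
Definition coind_zero := Coind coind_zero_linear.
Definition coind_scale a (f : coind X) := Coind (coind_scale_linear a f).

Fact coind_addA : associative coind_add.
Proof. by move=> f g h; apply: coindP => v; apply: addrA. Qed.
Fact coind_addC : commutative coind_add.
Proof. by move=> f g; apply: coindP => v; apply: addrC. Qed.
Fact coind_add0 : left_id coind_zero coind_add.
Proof. by move=> f; apply: coindP => v; apply: add0r. Qed.
Fact coind_addN : left_inverse coind_zero coind_opp coind_add.
Proof. by move=> f; apply: coindP => v; apply: addNr. Qed.

HB.instance Definition _ :=
  GRing.isZmodule.Build (coind X) coind_addA coind_addC coind_add0 coind_addN.

Definition coind_lin (f : coind X) : {linear A -> kmod X} := mklin (coind_linear f).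

Fact coind_scaleA a b (f : coind X) :
  coind_scale a (coind_scale b f) = coind_scale (a * b) f.
Proof. by apply: coindP => v; rewrite /= mulrA. Qed.
Fact coind_scale1 : left_id 1 coind_scale.
Proof. by move=> f; apply: coindP => v; rewrite /= mulr1. Qed.
Fact coind_scaleDr : right_distributive coind_scale +%R.
Proof. by move=> a f g; apply: coindP. Qed.
Fact coind_scaleDl f : {morph coind_scale^~ f : a b / a + b}.
Proof.
by move=> a b; apply: coindP => v; rewrite /= mulrDr; apply: (linearD (coind_lin f)).
Qed.

HB.instance Definition _ := GRing.Zmodule_isLmodule.Build A (coind X)
  coind_scaleA coind_scale1 coind_scaleDr coind_scaleDl.

Lemma coind_scaleE a (f : coind X) u : (a *: f) u = f (u * a).
Proof. by []. Qed.

Lemma coind_addE (f g : coind X) u : (f + g) u = f u + g u.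
Proof. by []. Qed.

Lemma coind_unit_linear (x : X) : linear (fun u : A => u *: x : kmod X).
Proof. by move=> c u v; rewrite scalerDl -[c *: u]mulr_algl -scalerA. Qed.

Lemma coind_unit_lin : linear (fun x : X => Coind (coind_unit_linear x)).
Proof. by move=> a x y; apply: coindP => u; rewrite /= scalerDr scalerA. Qed.

Definition coind_unit : {linear X -> coind X} := mklin coind_unit_lin.

Lemma coind_unit_inj : injective coind_unit.
Proof. by move=> x y /(congr1 (fun f : coind X => f 1)); rewrite /= !scale1r. Qed.

End Instances.

Lemma coind_map_linear (X Y : lmodType A) (h : {linear X -> Y}) (f : coind X) :
  linear (fun u => h (f u) : kmod Y).
Proof. by move=> c u v; rewrite coind_linear; apply: (linearP h). Qed.

Lemma coind_map_lin (X Y : lmodType A) (h : {linear X -> Y}) :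
  linear (fun f : coind X => Coind (coind_map_linear h f)).
Proof. by move=> a f g; apply: coindP => u /=; apply: (linearD h). Qed.

Definition coind_map (X Y : lmodType A) (h : {linear X -> Y}) :
  {linear coind X -> coind Y} := mklin (coind_map_lin h).

Lemma coind_unit_natural (X Y : lmodType A) (h : {linear X -> Y}) x :
  coind_map h (coind_unit X x) = coind_unit Y (h x).
Proof. by apply: coindP => u /=; apply: linearZ_LR. Qed.

Section Baer.
Variables (B : algType K) (io : {lrmorphism B -> A}) (T : eqType) (m : T -> A).
Hypothesis m_span : forall a, exists (s : seq T) (b : T -> B),
  uniq s /\ a = \sum_(t <- s) m t * io (b t).
Hypothesis m_free : forall (s : seq T) (b : T -> B), uniq s ->
  \sum_(t <- s) m t * io (b t) = 0 -> forall t, t \in s -> b t = 0.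

(* A is free as a right B-module with basis m. *)
Lemma coind_baer (X : lmodType A) : baer (res io (coind X)).
Proof.
(* [c a t] is the coordinate of [a] at the basis element [m t], extended by zero off a finite
   support so that different supports can be compared. *)
have [c cP] : exists c : A -> T -> B, forall a, True -> exists s, [/\ uniq s,
    (forall t, t \notin s -> c a t = 0) & a = \sum_(t <- s) m t * io (c a t)].
  apply: (@choice_on A (T -> B) (fun=> 0) _ (fun a b => exists s, [/\ uniq s,
    (forall t, t \notin s -> b t = 0) & a = \sum_(t <- s) m t * io (b t)])) => a _.
  have [s [b [us Ea]]] := m_span a.
  exists (fun t => if t \in s then b t else 0), s; split=> // [t /negbTE -> //|].
  by rewrite Ea; apply: eq_big_seq => t ->.
have extend (s s' : seq T) (b : T -> B) : uniq s -> uniq s' ->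
    (forall t, t \notin s -> b t = 0) -> {subset s <= s'} ->
    \sum_(t <- s') m t * io (b t) = \sum_(t <- s) m t * io (b t).
  move=> us us' b0 ss'.
  rewrite (bigID (fun t => t \in s)) /= [X in _ + X]big1 => [|t /b0 ->]; last first.
    by rewrite rmorph0 mulr0.
  rewrite addr0 -big_filter; apply: perm_big; apply: uniq_perm => //.
    exact: filter_uniq.
  by move=> t; rewrite mem_filter; case ts: (t \in s) => //=; rewrite ss'.
have c_uniq a (s : seq T) (b : T -> B) : uniq s -> (forall t, t \notin s -> b t = 0) ->
    a = \sum_(t <- s) m t * io (b t) -> c a =1 b.
  move=> us b0 Ea t; have [s' [us' c0 Ec]] := cP a I.
  pose r := undup (s ++ s').
  have ur : uniq r := undup_uniq _.
  have rs t' : t' \in s -> t' \in r by rewrite mem_undup mem_cat => ->.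
  have rs' t' : t' \in s' -> t' \in r by rewrite mem_undup mem_cat orbC => ->.
  have E0 : \sum_(t <- r) m t * io (c a t - b t) = 0.
    under eq_bigr do rewrite rmorphB mulrBr.
    by rewrite sumrB (extend s' r (c a)) // (extend s r b) // -Ec -Ea subrr.
  have [tr|tr] := boolP (t \in r).
    by apply/eqP; rewrite -subr_eq0; apply/eqP; apply: m_free ur E0 t tr.
  rewrite b0 ?c0 //; first by apply: contra tr => /rs'.
  by apply: contra tr => /rs.
have c_lin x u v t : c (x *: u + v) t = x *: c u t + c v t.
  have [s [us c0 Eu]] := cP u I; have [s' [us' c0' Ev]] := cP v I.
  apply: (c_uniq _ (undup (s ++ s')) (fun t => x *: c u t + c v t)).
  - exact: undup_uniq.
  - move=> t'; rewrite mem_undup mem_cat negb_or => /andP[/c0 -> /c0' ->].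
    by rewrite scaler0 addr0.
  rewrite {1}Eu {1}Ev.
  have ioZ t' : m t' * io (x *: c u t' + c v t') = x *: (m t' * io (c u t')) + m t' * io (c v t').
    by rewrite linearP mulrDr -scalerAr.
  under [RHS]eq_bigr do rewrite ioZ.
  rewrite big_split /= -scaler_sumr; congr (_ *: _ + _); apply/esym.
    apply: (extend s (undup (s ++ s')) (c u)); rewrite ?undup_uniq // => t' ts.
    by rewrite mem_undup mem_cat ts.
  apply: (extend s' (undup (s ++ s')) (c v)); rewrite ?undup_uniq // => t' ts.
  by rewrite mem_undup mem_cat ts orbT.
have c_mulr u b t : c (u * io b) t = c u t * b.
  have [s [us c0 Eu]] := cP u I.
  apply: (c_uniq _ s (fun t => c u t * b)) => // [t' /c0 ->|]; first by rewrite mul0r.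
  rewrite {1}Eu mulr_suml; apply: eq_bigr => t' _.
  by rewrite rmorphM mulrA.
move=> J f sJ fl _.
have sJK : @submod K B J.
  by case: sJ => J0 sJ; split=> // a u v Ju Jv; rewrite -[a *: u]mulr_algl; apply: sJ.
(* Extending linearly over the field suffices here; linearity over [B] is rebuilt through the
   basis. *)
have [h hf] : exists h : {linear B -> kmod (coind X)}, forall j, J j -> h j = f j.
  apply: (@linear_extension K B (kmod (coind X)) J f sJK) => a u v Ju Jv.
  rewrite -[a *: u]mulr_algl fl //; congr (_ + _).
  by transitivity (io a%:A *: (f u : coind X)) => //; rewrite linearZ_LR rmorph1.
have [S SP] : exists S : A -> seq T, forall a, True -> [/\ uniq (S a),
    (forall t, t \notin S a -> c a t = 0) & a = \sum_(t <- S a) m t * io (c a t)].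
  by apply: (@choice_on A (seq T) [::] _ (fun a s => [/\ uniq s,
    (forall t, t \notin s -> c a t = 0) & a = \sum_(t <- s) m t * io (c a t)])).
(* On [m t * io b] the functional is [h b] evaluated at [m t]. For [j] in [J], [B]-linearity of [f]
   on [J] then gives [w0 (u * io j) = f j u]. *)
pose w0 (a : A) : kmod X := \sum_(t <- S a) (h (c a t) : coind X) (m t).
have w0E a (s : seq T) : uniq s -> (forall t, t \notin s -> c a t = 0) ->
    w0 a = \sum_(t <- s) (h (c a t) : coind X) (m t).
  move=> us c0; have [uS S0 _] := SP a I.
  have ext (s1 s2 : seq T) : uniq s1 -> uniq s2 -> (forall t, t \notin s1 -> c a t = 0) ->
      {subset s1 <= s2} -> \sum_(t <- s2) (h (c a t) : coind X) (m t) =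
      \sum_(t <- s1) (h (c a t) : coind X) (m t).
    move=> us1 us2 b0 ss'.
    rewrite (bigID (fun t => t \in s1)) /= [X in _ + X]big1 => [|t /b0 ->]; last first.
      by rewrite linear0.
    rewrite addr0 -big_filter; apply: perm_big; apply: uniq_perm => //.
      exact: filter_uniq.
    by move=> t; rewrite mem_filter; case ts: (t \in s1) => //=; rewrite ss'.
  rewrite /w0 -(ext _ (undup (S a ++ s))) ?undup_uniq //; last first.
    by move=> t ts; rewrite mem_undup mem_cat ts.
  rewrite -(ext s (undup (S a ++ s))) ?undup_uniq //.
  by move=> t ts; rewrite mem_undup mem_cat ts orbT.
have w0l : linear w0.
  move=> a u v; have [uS1 S1 _] := SP u I; have [uS2 S2 _] := SP v I.
  pose r := undup (S u ++ S v); have ur : uniq r := undup_uniq _.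
  have r1 t : t \notin r -> c u t = 0.
    by rewrite mem_undup mem_cat negb_or => /andP[/S1].
  have r2 t : t \notin r -> c v t = 0.
    by rewrite mem_undup mem_cat negb_or => /andP[_ /S2].
  rewrite (w0E u r) // (w0E v r) // (w0E _ r) //; last first.
    by move=> t tr; rewrite c_lin r1 // r2 // scaler0 addr0.
  rewrite scaler_sumr -big_split; apply: eq_bigr => t _ /=.
  rewrite c_lin linearP.
  apply: etrans (coind_addE (a%:A *: (h (c u t) : coind X)) (h (c v t)) (m t)) _.
  by congr (_ + _); rewrite coind_scaleE mulr_algr; apply: (linearZ_LR (coind_lin _)).
exists (Coind w0l : res io (coind X)) => // j Jj; apply: (@coindP X) => u.
transitivity (w0 (u * io j)) => //; have [uS S0 Eu] := SP u I.
rewrite (w0E _ (S u)) // => [|t /S0 c0]; last by rewrite c_mulr c0 mul0r.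
rewrite {1}Eu; apply: etrans (linear_sum (coind_lin (f j : coind X)) _ _ _) _.
apply: eq_bigr => t _; rewrite c_mulr hf; last exact: (submodZ sJ).
by rewrite (ideal_mapZ _ sJ fl).
Qed.

End Baer.
End Coinduced.

(** * Functionals on words and their shuffle products *)

Section WordFunctionals.
Variables (K : numFieldType) (n : nat) (gam : 'I_n -> 'I_n -> 'I_n -> K).
Implicit Types (phi psi : seq 'I_n -> K) (w : seq 'I_n).

(* The functionals on words that descend to the enveloping algebra of the Lie
   algebra with structure constants gam. *)
Definition word_rel phi := forall a i j b,
  phi (a ++ i :: j :: b) = phi (a ++ j :: i :: b) + \sum_k gam i j k * phi (a ++ k :: b).

(** The product dual to the coproduct for which letters are primitive: each letter of the word goes
    to one of the two factors. *)
Fixpoint shuffle phi psi w : K :=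
  if w is i :: w' then
    shuffle (fun v => phi (i :: v)) psi w' + shuffle phi (fun v => psi (i :: v)) w'
  else phi [::] * psi [::].

Lemma shuffleC phi psi w : shuffle phi psi w = shuffle psi phi w.
Proof.
elim: w phi psi => [|i w IHw] phi psi /=; first exact: mulrC.
by rewrite addrC; congr (_ + _); apply: IHw.
Qed.

Lemma shuffle_sum (c : 'I_n -> K) phi (F : 'I_n -> seq 'I_n -> K) psi w :
  shuffle (fun v => phi v + \sum_k c k * F k v) psi w =
  shuffle phi psi w + \sum_k c k * shuffle (F k) psi w.
Proof.
elim: w phi F psi => [|i w IHw] phi F psi /=.
  by rewrite mulrDl mulr_suml; congr (_ + _); apply: eq_bigr => k _; rewrite mulrA.
rewrite (IHw _ (fun k v => F k (i :: v))) IHw addrACA -big_split; congr (_ + _).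
by apply: eq_bigr => k _; rewrite mulrDr.
Qed.

Lemma word_rel_shift phi i : word_rel phi -> word_rel (fun v => phi (i :: v)).
Proof. by move=> rphi a; apply: (rphi (i :: a)). Qed.

(** Dual to the compatibility of that coproduct with the relations of the enveloping algebra. *)
Lemma shuffle_rel phi psi : word_rel phi -> word_rel psi -> word_rel (shuffle phi psi).
Proof.
move=> + + a; elim: a phi psi => [|l a IHa] phi psi rphi rpsi i j b /=; last first.
  rewrite (IHa (fun v => phi (l :: v)) psi) //; last exact: word_rel_shift.
  rewrite (IHa phi (fun v => psi (l :: v))) //; last exact: word_rel_shift.
  by rewrite addrACA -big_split; congr (_ + _); apply: eq_bigr => k _; rewrite mulrDr.
have Ephi : (fun v => phi (i :: j :: v)) =
    (fun v => phi (j :: i :: v) + \sum_k gam i j k * phi (k :: v)).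
  by apply/funext => v; apply: (rphi [::]).
have Epsi : (fun v => psi (i :: j :: v)) =
    (fun v => psi (j :: i :: v) + \sum_k gam i j k * psi (k :: v)).
  by apply/funext => v; apply: (rpsi [::]).
rewrite Ephi Epsi (shuffle_sum _ _ (fun k v => phi (k :: v))).
rewrite [shuffle phi _ b]shuffleC (shuffle_sum _ _ (fun k v => psi (k :: v))).
under [\sum_k _ * (_ + _)]eq_bigr do rewrite mulrDr.
rewrite big_split /= [shuffle phi (fun v => psi (j :: i :: v)) b]shuffleC.
have E (x1 x2 x3 x4 s1 s2 : K) :
    x1 + s1 + x2 + (x3 + (x4 + s2)) = x1 + x3 + (x2 + x4) + (s1 + s2) by ring.
rewrite E; congr (_ + (_ + _)); apply: eq_bigr => k _; by rewrite shuffleC.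
Qed.

Definition vanishes k phi := forall w, (size w < k)%N -> phi w = 0.

Lemma vanishes_shift k phi i : vanishes k phi -> vanishes k.-1 (fun v => phi (i :: v)).
Proof. by move=> vphi w wk; apply: vphi; case: k wk. Qed.

(** A word of length less than [a + b] cannot give [a] letters to one factor and [b] to the
    other. *)
Lemma shuffle_vanishes a b phi psi :
  vanishes a phi -> vanishes b psi -> vanishes (a + b) (shuffle phi psi).
Proof.
move=> va vb w; elim: w a b phi psi va vb => [|i w IHw] a b phi psi va vb /= wab.
  case: a va wab => [|a] va wab; first by rewrite (vb [::]) ?mulr0.
  by rewrite (va [::]) ?mul0r.
rewrite (IHw a.-1 b) ?(IHw a b.-1) ?addr0 //; try exact: vanishes_shift; move: wab.
  by case: b {vb} => [|b]; rewrite ?addnS // addn0 => /ltnW.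
by case: a {va} => [|a] //=; rewrite add0n => /ltnW.
Qed.

Lemma shuffle_head b phi psi w :
  vanishes b psi -> size w = b -> shuffle phi psi w = phi [::] * psi w.
Proof.
elim: w b phi psi => [|i w IHw] [|b] phi psi vb //= [wb].
have v0 f : vanishes 0 f by [].
rewrite (shuffle_vanishes (v0 _) vb) ?wb // add0r (IHw b) //.
exact: (@vanishes_shift b.+1).
Qed.

Variable t : 'I_n -> seq 'I_n -> K.
Hypothesis t_rel : forall i, word_rel (t i).
Hypothesis t_nil : forall i, t i [::] = 0.
Hypothesis t_coord : forall i j, t i [:: j] = (i == j)%:R.

Lemma t_vanishes i : vanishes 1 (t i).
Proof. by case. Qed.

Definition tprod v := foldr (fun i psi => shuffle (t i) psi) (fun w => (w == [::])%:R) v.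

Lemma tprod_rel v : word_rel (tprod v).
Proof.
elim: v => [|i v IHv]; last exact: shuffle_rel.
by move=> [|l a] i j b /=; rewrite big1 ?addr0 // => k _; rewrite mulr0.
Qed.

Lemma tprod_vanishes v : vanishes (size v) (tprod v).
Proof.
elim: v => //= i v IHv; apply: (@shuffle_vanishes 1 (size v)) => //.
exact: t_vanishes.
Qed.

(** On words of length [b.+1] only the splittings that give a single letter to [t i] survive, and
    that letter has to be [i]. The values are natural numbers, so no cancellation occurs in
    characteristic zero. *)
Lemma shuffle_coord i b psi (P : seq 'I_n -> Prop) :
    vanishes b psi ->
    (forall w, size w = b -> exists2 c : nat, psi w = c%:R & (0 < c)%N <-> P w) ->
  forall w, size w = b.+1 -> exists2 c : nat, shuffle (t i) psi w = c%:R &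
    (0 < c)%N <-> exists w1 w2, w = w1 ++ i :: w2 /\ P (w1 ++ w2).
Proof.
move=> vb psiP w; elim: w b psi P vb psiP => [|j w IHw] b psi P vb psiP // [wb] /=.
rewrite (shuffle_head _ vb) // t_coord; have [c -> cP] := psiP w wb.
have [c' -> c'P] : exists2 c' : nat, shuffle (t i) (fun v => psi (j :: v)) w = c'%:R &
    (0 < c')%N <-> exists w1 w2, w = w1 ++ i :: w2 /\ P (j :: w1 ++ w2).
  case: b wb vb psiP => [|b] wb vb psiP.
    rewrite (size0nil wb) /= t_nil mul0r; exists 0%N => //; split=> //.
    by move=> [[|? ?] [? [//]]].
  apply: (IHw b (fun v => psi (j :: v)) (fun v => P (j :: v))) => //.
    exact: (@vanishes_shift b.+1).
  by move=> v vb'; apply: psiP; rewrite /= vb'.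
exists ((i == j) * c + c')%N; first by rewrite natrD natrM.
rewrite addn_gt0 muln_gt0 lt0b; split=> [/orP[/andP[/eqP -> /cP Pw]|/c'P[w1 [w2 [-> Pw]]]]|].
- by exists [::], w.
- by exists (j :: w1), w2.
move=> [[|l w1] [w2 [[Ej Ew] Pw]]].
  by rewrite Ej eqxx /=; move: Pw => /=; rewrite -Ew => /cP ->.
apply/orP; right; apply/c'P; exists w1, w2.
by split; rewrite // Ej.
Qed.

(** In top degree the pairing counts the matchings between equal letters of [v] and [w]. Together
    with [tprod_vanishes] this is the triangularity behind the linear independence of ordered
    monomials. *)
Lemma tprodP v w : size w = size v ->
  exists2 c : nat, tprod v w = c%:R & (0 < c)%N <-> perm_eq v w.
Proof.
elim: v w => [|i v IHv] w wv; first by rewrite (size0nil wv); exists 1%N.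
have [c Ec cP] := shuffle_coord i (@tprod_vanishes v) IHv wv.
exists c => //; rewrite cP; split=> [[w1 [w2 [-> vw]]]|ivw].
  by rewrite perm_sym -[i :: w2]cat1s perm_catCA /= perm_cons perm_sym.
have iw : i \in w by rewrite -(perm_mem ivw) mem_head.
case/splitPr: iw ivw => w1 w2 ivw; exists w1, w2; split=> //.
by rewrite -(perm_cons i) (perm_trans ivw) // -[i :: w2]cat1s perm_catCA.
Qed.

End WordFunctionals.

Section CoordinateFunctionals.
Variables (K : numFieldType) (n : nat) (gam : 'I_n -> 'I_n -> 'I_n -> K).
Variables (N : nat) (D : 'I_n -> 'M[K]_N).
Hypothesis D_comm : forall i j,
  D i *m D j = D j *m D i + \sum_k gam i j k *: D k.
Hypothesis D_free : forall (c0 : K) (c : 'I_n -> K),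
  c0%:M + \sum_k c k *: D k = 0 -> forall k, c k = 0.

(** By [D_free] there are linear forms on matrices that kill the identity and are dual to the [D k];
    they are evaluated on the product of matrices attached to a word. *)
Lemma coordinate_functionals : exists t : 'I_n -> seq 'I_n -> K,
  [/\ forall i, word_rel gam (t i), forall i, t i [::] = 0 &
      forall i j, t i [:: j] = (i == j)%:R].
Proof.
have xi_ex i : exists y : 'cV[K]_(N * N), [/\ mxvec 1%:M *m y = 0,
    mxvec (D i) *m y = 1%:M & forall k, k != i -> mxvec (D k) *m y = 0].
  pose R := \matrix_k (if k == i then 0 else mxvec (D k)).
  pose S := col_mx (mxvec 1%:M) R.
  (* A matrix outside the span of the identity and of the other [D k] is detected by a column of the
     cokernel matrix, which is rescaled to value 1. *)
  have nS : ~~ (mxvec (D i) <= S)%MS.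
    apply/negP => /submxP[u]; rewrite -[u]hsubmxK mul_row_col.
    set u1 := lsubmx u; set u2 := rsubmx u => E.
    have {}E : mxvec ((u1 0 0)%:M + \sum_k (if k == i then -1 else u2 0 k) *: D k) = 0.
      have E1 : mxvec ((u1 0 0)%:M : 'M_N) = u1 *m mxvec (1%:M : 'M_N).
        by rewrite -[(u1 0 0)%:M]mulmx1 mul_scalar_mx linearZ /= -mul_scalar_mx -mx11_scalar.
      have E2 : mxvec (\sum_k (if k == i then -1 else u2 0 k) *: D k) =
          u2 *m R - mxvec (D i).
        rewrite linear_sum mulmx_sum_row (bigD1 i) //= [in RHS](bigD1 i) //= eqxx.
        rewrite scaleN1r linearN rowK eqxx scaler0 add0r addrC; congr (_ - _).
        by apply: eq_bigr => k /negbTE ki; rewrite rowK ki linearZ.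
      rewrite linearD; apply: etrans (congr2 +%R E1 E2) _.
      by rewrite E addrA subrr.
    have /D_free/(_ i) : (u1 0 0)%:M + \sum_k (if k == i then -1 else u2 0 k) *: D k = 0.
      by rewrite -[LHS]mxvecK E linear0.
    by rewrite eqxx => /eqP; rewrite oppr_eq0 oner_eq0.
  have : mxvec (D i) *m cokermx S != 0 by apply: contra nS => /eqP E; rewrite submxE E.
  case/matrix0Pn=> z [j]; rewrite ord1 => {z} nz.
  have Sc : S *m cokermx S = 0 := mulmx_coker S.
  have mul_col (v : 'rV[K]_(N * N)) : v *m col j (cokermx S) = ((v *m cokermx S) 0 j)%:M.
    by rewrite colE mulmxA -colE [LHS]mx11_scalar mxE.
  have sc0' : ((0 : 'rV[K]_(N * N)) 0 j)%:M = 0 :> 'M_1.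
    by apply/matrixP => a b; rewrite !mxE mul0rn.
  exists (((mxvec (D i) *m cokermx S) 0 j)^-1 *: col j (cokermx S)).
  split=> [||k ki]; rewrite -scalemxAr mul_col.
  - have -> : mxvec 1%:M *m cokermx S = 0; last by rewrite sc0' scaler0.
    by move: Sc; rewrite mul_col_mx -[X in _ = X]col_mx0 => /eq_col_mx[].
  - by rewrite -[X in X%:M]mulr1 -scale_scalar_mx scalerA mulVf // scale1r.
  - have -> : mxvec (D k) *m cokermx S = 0; last by rewrite sc0' scaler0.
    move: Sc; rewrite mul_col_mx -[X in _ = X]col_mx0 => /eq_col_mx[_].
    by move=> /(congr1 (row k)); rewrite row_mul rowK (negbTE ki) linear0.
have [y yP] : exists y : 'I_n -> 'cV[K]_(N * N), forall i, True ->
    [/\ mxvec 1%:M *m y i = 0, mxvec (D i) *m y i = 1%:M &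
      forall k, k != i -> mxvec (D k) *m y i = 0].
  by apply: (@choice_on _ _ 0 (fun _ => True) (fun i (y : 'cV[K]_(N * N)) =>
    [/\ mxvec 1%:M *m y = 0, mxvec (D i) *m y = 1%:M &
      forall k, k != i -> mxvec (D k) *m y = 0])).
pose Dw := foldr (fun j (M : 'M[K]_N) => D j *m M) 1%:M.
have Dw_cat a b : Dw (a ++ b) = Dw a *m Dw b.
  by elim: a => [|j a IHa] /=; rewrite ?mul1mx // IHa mulmxA.
exists (fun i w => (mxvec (Dw w) *m y i) 0 0); split.
- move=> i a j k b; rewrite !Dw_cat /= !mulmxA -(mulmxA _ (D j)) D_comm mulmxDr mulmxDl.
  rewrite !mulmxA linearD mulmxDl mxE; congr (_ + _).
  rewrite mulmx_sumr mulmx_suml linear_sum mulmx_suml summxE; apply: eq_bigr => l _.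
  by rewrite Dw_cat /= -scalemxAr -scalemxAl linearZ -scalemxAl mxE mulmxA.
- by move=> i /=; have [-> _ _] := yP i I; rewrite mxE.
- move=> i j /=; rewrite mulmx1; have [_ yi yk] := yP i I.
  have [<-|ji] := eqVneq i j; first by rewrite yi mxE eqxx.
  by rewrite yk ?mxE // eq_sym.
Qed.

End CoordinateFunctionals.

Lemma lspan_fsum (A : pzRingType) (M : lmodType A) (T : eqType) (f : T -> M) s a :
  lspan (map f s) a -> exists c : T -> A, a = \sum_(t <- undup s) c t *: f t.
Proof.
elim: s a => [|t s IHs] a /=; first by move=> ->; exists (fun=> 0); rewrite big_nil.
case=> k /IHs[c Ec]; have {Ec}-> : a = k *: f t + \sum_(t <- undup s) c t *: f t.
  by rewrite -Ec addrC subrK.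
exists (fun u => (if u == t then k else 0) + if u \in s then c u else 0).
have E : \sum_(u <- undup s) c u *: f u =
    \sum_(u <- undup s) (if u \in s then c u else 0) *: f u.
  by rewrite !big_seq; apply: eq_bigr => u; rewrite mem_undup => ->.
rewrite E; case: ifP => ts.
  under [RHS]eq_bigr do rewrite scalerDl.
  rewrite big_split /=; congr (_ + _).
  rewrite (bigD1_seq t) ?mem_undup ?undup_uniq //= eqxx big1 ?addr0 // => u /negbTE ->.
  exact: scale0r.
rewrite big_cons eqxx ts addr0; congr (_ + _); rewrite !big_seq.
apply: eq_bigr => u; rewrite mem_undup => us; case: eqP => [ut|_]; last by rewrite add0r.
by rewrite ut ts in us.
Qed.

(** * Bilinearity of the bracket; the Poincare-Birkhoff-Witt theorem *)

Section LieBracket.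
Variables (K : fieldType) (g : lieAlgType K).
Implicit Types x y z : g.

Lemma lieb_antisym (x y : g) : lieb x y = - lieb y x.
Proof.
apply/eqP; rewrite -addr_eq0; apply/eqP; have := liebxx (x + y).
have lD (a b c : g) : lieb (a + b) c = lieb a c + lieb b c.
  by have := lieb_linearl c 1 a b; rewrite !scale1r.
have rD (a b c : g) : lieb c (a + b) = lieb c a + lieb c b.
  by have := lieb_linearr c 1 a b; rewrite !scale1r.
by rewrite lD !rD !liebxx addr0 add0r.
Qed.

Definition adr (y : g) : {linear g -> g} := @mklin K g g _ (lieb_linearl y).
Definition adl (x : g) : {linear g -> g} := @mklin K g g _ (lieb_linearr x).

Lemma lieb_suml I (r : seq I) (P : pred I) (F : I -> g) y :
  lieb (\sum_(j <- r | P j) F j) y = \sum_(j <- r | P j) lieb (F j) y.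
Proof. exact: (linear_sum (adr y)). Qed.
Lemma lieb_sumr I (r : seq I) (P : pred I) (F : I -> g) x :
  lieb x (\sum_(j <- r | P j) F j) = \sum_(j <- r | P j) lieb x (F j).
Proof. exact: (linear_sum (adl x)). Qed.
Lemma liebZl a x y : lieb (a *: x) y = a *: lieb x y.
Proof. exact: (linearZ_LR (adr y)). Qed.
Lemma liebZr a x y : lieb x (a *: y) = a *: lieb x y.
Proof. exact: (linearZ_LR (adl x)). Qed.
Lemma liebDl x y z : lieb (x + y) z = lieb x z + lieb y z.
Proof. exact: (linearD (adr z)). Qed.
Lemma liebDr x y z : lieb x (y + z) = lieb x y + lieb x z.
Proof. exact: (linearD (adl x)). Qed.
Lemma liebNr x y : lieb x (- y) = - lieb x y.
Proof. exact: (linearN (adl x)). Qed.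
Lemma liebNl x y : lieb (- x) y = - lieb x y.
Proof. exact: (linearN (adr y)). Qed.
Lemma lieb0r x : lieb x 0 = 0.
Proof. exact: (linear0 (adl x)). Qed.
Lemma lieb0l x : lieb 0 x = 0.
Proof. exact: (linear0 (adr x)). Qed.

Lemma lieb_der x y z : lieb x (lieb y z) = lieb (lieb x y) z + lieb y (lieb x z).
Proof.
have := lieb_jacobi x y z; rewrite [lieb z x]lieb_antisym liebNr.
rewrite [lieb z (lieb _ _)]lieb_antisym => /eqP; rewrite subr_eq0 subr_eq => /eqP ->.
by [].
Qed.

End LieBracket.

Section Enveloping.
Variables (K : numFieldType) (g : lieAlgType K) (U : algType K) (i : {linear g -> U}).
Hypothesis hU : universal_enveloping i.

(** The universal property maps [U] to the subalgebra generated by the image of [g]. Followed by the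
    inclusion, this map is the identity by uniqueness. *)
Lemma env_gen u : subalgebra_gen (fun v => exists x, v = i x) u.
Proof.
pose S v := exists x, v = i x; pose f x : subalg S := subalg_in (Gen_in (ex_intro _ x erefl : S (i x))).
have fl : linear f by move=> a x y; apply: val_inj; rewrite /= linearP.
have [] := hU.2 _ (mklin fl) => [x y|[F Fi] _]; first by apply: val_inj; apply: hU.1.
have [_ uniqU] := hU.2 _ i hU.1.
pose G : {lrmorphism U -> U} := subalg_incl S \o F.
have /(_ u) <- : forall v, G v = v.
  by apply: (uniqU G (idfun : {lrmorphism U -> U})) => x; rewrite /= Fi.
exact: subalg_incl_gen.
Qed.

Variables (n : nat) (e : n.-tuple g).
Hypothesis eB : basis_of fullv e.

Definition env_letter (k : 'I_n) : U := i (e`_k).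
Definition structure_const (a b k : 'I_n) : K := coord e k (lieb e`_a e`_b).
Local Notation gam := structure_const.

Lemma basis_sum x : x = \sum_k coord e k x *: e`_k.
Proof. exact: coord_basis eB (memvf x). Qed.

Lemma env_letter_sum x : i x = \sum_k coord e k x *: env_letter k.
Proof. by rewrite {1}(basis_sum x) linear_sum; apply: eq_bigr => k _; rewrite linearZ. Qed.

Lemma env_comm a b : env_letter a * env_letter b - env_letter b * env_letter a =
  \sum_k gam a b k *: env_letter k.
Proof. by rewrite /env_letter -hU.1 env_letter_sum. Qed.

Lemma env_comm_span a b : @lspan K U [seq env_letter k | k <- enum 'I_n]
  (env_letter a * env_letter b - env_letter b * env_letter a).
Proof.
have sL := @lspan_submod K U [seq env_letter k | k <- enum 'I_n].
rewrite env_comm; apply: (submod_sum sL) => k.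
apply: (submodZ sL); apply: lspan_mem; apply: map_f.
by rewrite mem_enum.
Qed.

Lemma env_letter_gen u : subalgebra_gen (fun v => exists k, v = env_letter k) u.
Proof.
elim: (env_gen u) => {u} [_ [x ->]|c|u v _ su _ sv|u v _ su _ sv].
- rewrite env_letter_sum; elim/big_rec: _ => [|k v _ sv].
    by rewrite -[0](scale0r 1); apply: Gen_scalar.
  apply: Gen_add => //; rewrite -mulr_algl; apply: Gen_mul; first exact: Gen_scalar.
  by apply: Gen_in; exists k.
- exact: Gen_scalar.
- exact: Gen_add.
- exact: Gen_mul.
Qed.

Lemma noeth_env : noeth (U : pzRingType)^o.
Proof. exact: noeth_enveloping env_comm_span env_letter_gen. Qed.

Local Notation fV := (seq 'I_n -> K^o).

Lemma word_rel_submod : @submod K fV (word_rel gam).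
Proof.
split=> [a j k b|c u v ru rv a j k b].
  by rewrite big1 ?addr0 // => l _; rewrite mulr0.
have E w : (c *: u + v) w = c * u w + v w by [].
rewrite !E ru rv mulrDr addrACA mulr_sumr -big_split /=; congr (_ + _).
by apply: eq_bigr => l _; rewrite E mulrDr mulrCA.
Qed.

Local Notation V := (subT word_rel_submod).

(** The counit, equal to 1 on the empty word and 0 elsewhere; it is the nonzero vector required by
    [lend]. *)
Definition word_unit : V := SubT (asboolT (@tprod_rel K n gam (fun _ _ => 0)
  (fun j a b c d => ltac:(by rewrite big1 ?addr0 // => l _; rewrite mulr0)) [::])).

Lemma word_unit_neq0 : word_unit != 0.
Proof.
apply/eqP => /(congr1 (fun v : V => val v [::])) /=.
by apply/eqP; apply: oner_neq0.
Qed.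

Lemma word_act_rel (phi : V) x :
  word_rel gam (fun w => \sum_k coord e k x * val phi (rcons w k)).
Proof.
have rphi : word_rel gam (val phi) := sub_inclP phi.
move=> a j k b; under [X in _ = _ + X]eq_bigr do rewrite mulr_sumr.
rewrite [X in _ = _ + X]exchange_big -big_split; apply: eq_bigr => l _ /=.
rewrite -!cats1 -!catA /= rphi mulrDr mulr_sumr; congr (_ + _).
by apply: eq_bigr => m _; rewrite -cats1 -catA /= mulrCA.
Qed.

(** The transpose of right multiplication by [x], so that products act in the correct order. *)
Definition word_act x (phi : V) : V := SubT (asboolT (word_act_rel phi x)).

Lemma word_act_linear x : linear (word_act x).
Proof.
move=> c phi psi; apply: val_inj; apply/funext => w.
transitivity (c * \sum_k coord e k x * val phi (rcons w k) +
  \sum_k coord e k x * val psi (rcons w k)) => //=.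
rewrite mulr_sumr -big_split; apply: eq_bigr => k _ /=.
by rewrite -mulrCA -mulrDr.
Qed.

Definition word_rep x : lend word_unit_neq0 := Lend word_unit_neq0 (word_act_linear x).

Lemma word_rep_linear : linear word_rep.
Proof.
move=> c x y; apply: lendP => phi; apply: val_inj; apply/funext => w.
transitivity (c * \sum_k coord e k x * val phi (rcons w k) +
  \sum_k coord e k y * val phi (rcons w k)) => //=.
rewrite mulr_sumr -big_split; apply: eq_bigr => k _ /=.
by rewrite linearP mulrDl mulrA.
Qed.

Lemma word_rep_morphism : lie_morphism word_rep.
Proof.
move=> x y; apply: lendP => phi; apply: val_inj; apply/funext => w.
have rphi : word_rel gam (val phi) := sub_inclP phi.
transitivity (\sum_k coord e k x * (\sum_l coord e l y * val phi (rcons (rcons w k) l)) -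
  \sum_k coord e k y * (\sum_l coord e l x * val phi (rcons (rcons w k) l))) => //=.
have E k l : val phi (rcons (rcons w k) l) - val phi (rcons (rcons w l) k) =
    \sum_m gam k l m * val phi (rcons w m).
  rewrite -!cats1 -!catA /= rphi addrC addKr.
  by apply: eq_bigr => m _; rewrite cats1.
have -> : (\sum_k coord e k x * (\sum_l coord e l y * val phi (rcons (rcons w k) l)) -
    \sum_k coord e k y * (\sum_l coord e l x * val phi (rcons (rcons w k) l))) =
    \sum_k \sum_l \sum_m coord e k x * (coord e l y * (gam k l m * val phi (rcons w m))).
  transitivity (\sum_k \sum_l coord e k x * (coord e l y * val phi (rcons (rcons w k) l)) -
    \sum_k \sum_l coord e k y * (coord e l x * val phi (rcons (rcons w k) l))).
    by congr (_ - _); apply: eq_bigr => k _; rewrite mulr_sumr.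
  rewrite [X in _ - X]exchange_big -sumrB; apply: eq_bigr => k _.
  rewrite -sumrB; apply: eq_bigr => l _ /=.
  by rewrite [coord e l y * (coord e k x * _)]mulrCA -mulrBr -mulrBr E !mulr_sumr.
have -> : lieb x y = \sum_k \sum_l (coord e k x * coord e l y) *: lieb e`_k e`_l.
  rewrite {1}(basis_sum x) lieb_suml; apply: eq_bigr => k _.
  rewrite {1}(basis_sum y) lieb_sumr; apply: eq_bigr => l _.
  by rewrite liebZl liebZr scalerA.
transitivity (\sum_m \sum_k \sum_l
    coord e k x * (coord e l y * (gam k l m * val phi (rcons w m)))).
  apply: eq_bigr => m _; rewrite linear_sum mulr_suml; apply: eq_bigr => k _.
  rewrite linear_sum mulr_suml; apply: eq_bigr => l _.
  by rewrite linearZ -!mulrA.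
rewrite exchange_big; apply: eq_bigr => k _; exact: exchange_big.
Qed.

Lemma word_eval_linear (f : V) w (c : K) (u v : lend word_unit_neq0) :
  sub_incl word_rel_submod (lend_fun (c *: u + v) f) w =
  c * sub_incl word_rel_submod (lend_fun u f) w + sub_incl word_rel_submod (lend_fun v f) w.
Proof.
transitivity (sub_incl word_rel_submod (c *: lend_fun u f + lend_fun v f) w).
  by [].
by [].
Qed.

(** The representation [word_rep] extends to [U]; the functional sends [u] to the value at the empty
    word of [u] applied to [phi]. *)
Lemma word_functional (phi : seq 'I_n -> K) : word_rel gam phi ->
  exists L : {linear U -> K^o}, forall w, L (wmon env_letter w) = phi w.
Proof.
move=> rphi; have [[F Fi] _] := hU.2 _ (mklin word_rep_linear) word_rep_morphism.
pose f : V := SubT (asboolT rphi).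
pose L0 (u : U) : K^o := sub_incl word_rel_submod (lend_fun (F u) f) [::].
have Ll : linear L0.
  move=> c u v; rewrite /L0.
  have -> : F (c *: u + v) = c *: F u + F v by apply: linearP.
  exact: word_eval_linear.
exists (mklin Ll) => w.
transitivity (L0 (wmon env_letter w)) => //.
suff E v : sub_incl word_rel_submod (lend_fun (F (wmon env_letter w)) f) v = phi (v ++ w).
  by rewrite /L0 E.
have Ei k (h : V) v' : val (F (env_letter k) h) v' = val h (rcons v' k).
  rewrite Fi /= (bigD1 k) //= coord_free ?(basis_free eB) // eqxx mul1r big1 ?addr0 //.
  by move=> l lk; rewrite coord_free ?(basis_free eB) // eq_sym (negbTE lk) mul0r.
elim: w v => [|k w IHw] v; first by rewrite wmon_nil rmorph1 cats0.
rewrite wmon_cons rmorphM; transitivity (val (F (env_letter k) (F (wmon env_letter w) f)) v) => //.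
by rewrite Ei IHw -cats1 -catA.
Qed.

Lemma seq_argmax (T : eqType) (f : T -> nat) (s : seq T) x : x \in s ->
  exists2 y, y \in s & forall z, z \in s -> (f z <= f y)%N.
Proof.
elim: s x => //= a s IHs x _; case: s IHs => [_|b s IHs].
  by exists a; rewrite ?mem_head // => z; rewrite inE => /eqP ->.
have [y ys ymax] := IHs b (mem_head _ _).
have [ay|ya] := leqP (f a) (f y).
  by exists y; rewrite 1?inE ?ys ?orbT // => z; rewrite inE => /predU1P[->|/ymax].
exists a; rewrite ?mem_head // => z; rewrite inE => /predU1P[->|/ymax zy] //.
exact: leq_trans zy (ltnW ya).
Qed.

Section PoincareBirkhoffWitt.
Import mpoly.
Hypothesis g_center : forall x : g, (forall y, lieb x y = 0) -> x = 0.

(** Adjoint matrices satisfy the freeness condition: if [ad x] is minus the scalar [c0], evaluation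
    at [x] gives [c0 x = 0], so [x] is zero or central, hence zero since the center is trivial. *)
Lemma ad_coordinates : exists t : 'I_n -> seq 'I_n -> K,
  [/\ forall a, word_rel gam (t a), forall a, t a [::] = 0 &
      forall a b, t a [:: b] = (a == b)%:R].
Proof.
pose D (k : 'I_n) : 'M[K]_n := \matrix_(a, b) coord e a (lieb e`_k e`_b).
have DM k l : D k *m D l = \matrix_(a, b) coord e a (lieb e`_k (lieb e`_l e`_b)).
  apply/matrixP => a b; rewrite !mxE {1}(basis_sum (lieb e`_l e`_b)) lieb_sumr linear_sum.
  by apply: eq_bigr => c _; rewrite !mxE liebZr linearZ mulrC.
apply: (coordinate_functionals (D := D)) => [k l|c0 c E].
  rewrite !DM; apply/matrixP => a b; rewrite !mxE lieb_der linearD addrC; congr (_ + _).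
  rewrite {1}(basis_sum (lieb e`_k e`_l)) lieb_suml linear_sum summxE.
  by apply: eq_bigr => m _; rewrite !mxE liebZl linearZ.
pose x := \sum_k c k *: e`_k.
have Eb y : lieb x y = - (c0 *: y).
  apply/eqP; rewrite -addr_eq0 addrC; apply/eqP.
  suff Ee (b : 'I_n) : c0 *: e`_b + lieb x e`_b = 0 :> g.
    rewrite (basis_sum y) lieb_sumr scaler_sumr -big_split big1 // => b _ /=.
    by rewrite liebZr scalerA mulrC -scalerA -scalerDr Ee scaler0.
  rewrite (basis_sum (_ + _)) big1 // => a _; rewrite [coord _ _ _](_ : _ = 0) ?scale0r //.
  move/matrixP/(_ a b): E; rewrite !mxE => E; rewrite -[RHS]E linearD linearZ /=.
  rewrite (coord_free b) ?(basis_free eB) //.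
  congr (_ + _); first by rewrite mulr_natr eq_sym.
  rewrite lieb_suml linear_sum summxE; apply: eq_bigr => k _.
  by rewrite !mxE liebZl linearZ.
have x0 : x = 0.
  have [c00|c00] := eqVneq c0 0; first by apply: g_center => y; rewrite Eb c00 scale0r oppr0.
  by move/eqP: (Eb x); rewrite liebxx eq_sym oppr_eq0 scaler_eq0 (negbTE c00) => /eqP.
by move=> k; rewrite -(coord_sum_free c k (basis_free eB)) -/x x0 linear0.
Qed.

(** Among the monomials with nonzero coefficient choose [m0] of maximal degree. The functional built
    from the word of [m0] kills shorter words and the other monomials of the same degree, and is a
    positive integer on [m0]. *)
Lemma pbw_free (s : seq (mpoly.multinom n)) (c : mpoly.multinom n -> K) : uniq s ->
  \sum_(m <- s) c m *: emon env_letter m = 0 -> forall m, m \in s -> c m = 0.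
Proof.
move=> us E m ms; apply/eqP; apply: contraT => cm.
have [t [t_rel t_nil t_coord]] := ad_coordinates.
have m_in : m \in [seq m' <- s | c m' != 0] by rewrite mem_filter cm.
have [m0] := seq_argmax (fun m => size (mword m)) m_in.
rewrite mem_filter => /andP[cm0 m0s] max0.
have [L LE] := word_functional (tprod_rel t_rel (mword m0)).
have LZ a m1 : L (a *: emon env_letter m1) = a * tprod t (mword m0) (mword m1).
  by rewrite linearZ /= LE.
have := congr1 L E; rewrite linear0 linear_sum /= (bigD1_seq m0) //= big_seq_cond big1.
  rewrite addr0 LZ.
  have [k -> [_ kP]] := tprodP t_nil t_coord (erefl (size (mword m0))).
  move=> /eqP; rewrite mulf_eq0 (negbTE cm0) pnatr_eq0 => /eqP k0.
  by move: (kP (perm_refl _)); rewrite k0.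
move=> m' /andP[m's m'm0]; rewrite LZ.
have [->|cm'] := eqVneq (c m') 0; first by rewrite mul0r.
have := max0 m'; rewrite mem_filter cm' m's leq_eqVlt => /(_ isT)/predU1P[Es|lt]; last first.
  by rewrite (tprod_vanishes t_nil) ?mulr0 //.
have [k -> [kP _]] := tprodP t_nil t_coord Es.
case: k kP => [|k] kP; first by rewrite mulr0.
case/negP: m'm0; apply/eqP/mpoly.mnmP => a.
by rewrite -!count_mword; apply/esym/permP/kP.
Qed.

End PoincareBirkhoffWitt.
End Enveloping.

(** * Freeness of U(g) over the enveloping algebra of a subalgebra *)

Section SubalgebraBasis.
Import mpoly.
Variables (K : numFieldType) (g : lieAlgType K) (U : algType K) (i : {linear g -> U}).
Hypothesis hU : universal_enveloping i.
Hypothesis g_center : forall x : g, (forall y, lieb x y = 0) -> x = 0.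
Variables (W : {vspace g}).
Hypothesis W_sub : lie_subalgebra W.

Definition env_pred (u : U) := exists2 x, x \in W & u = i x.
Definition env_sub := subalg env_pred.
Definition env_incl : {lrmorphism env_sub -> U} := subalg_incl env_pred.
Local Notation B := env_sub.
Local Notation io := env_incl.
Local Notation n1 := (\dim (W^C)%VS).
Local Notation n2 := (\dim W).

(** The complement of [W] comes first, so an ordered monomial factors as a monomial in the
    complement times one in [W]; this is freeness as a right module. *)
Definition adapted_basis : (n1 + n2).-tuple g :=
  cat_tuple (vbasis (W^C)%VS) (vbasis W).

Lemma adapted_basisP : basis_of fullv adapted_basis.
Proof.
rewrite -(addv_complf W) addvC; apply: cat_basis; try exact: vbasisP.
by apply/directv_addP; rewrite capvC capv_compl.
Qed.

Local Notation x := (env_letter i adapted_basis).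

Lemma sub_letter_mem (k : 'I_n2) : (vbasis W)`_k \in W.
Proof. by apply: vbasis_mem; rewrite memt_nth. Qed.

Lemma sub_letter_pred (k : 'I_n2) : env_pred (i (vbasis W)`_k).
Proof. by exists (vbasis W)`_k => //; apply: sub_letter_mem. Qed.

Definition sub_letter (k : 'I_n2) : B := subalg_in (Gen_in (sub_letter_pred k)).
Local Notation y := sub_letter.

Lemma io_sub_letter k : io (y k) = x (rshift n1 k).
Proof.
rewrite /env_letter /= nth_cat size_tuple ltnNge leq_addr /=.
by rewrite addKn.
Qed.

Lemma io_inj : injective io.
Proof. exact: val_inj. Qed.

Lemma sub_letter_sum z : z \in W -> i z = io (\sum_k coord (vbasis W) k z *: y k).
Proof.
move=> zW; rewrite {1}(coord_vbasis zW) linear_sum [RHS]linear_sum.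
by apply: eq_bigr => k _; rewrite linearZ [RHS]linearZ.
Qed.

Lemma sub_letter_comm a b : @lspan K B [seq y k | k <- enum 'I_n2] (y a * y b - y b * y a).
Proof.
have -> : y a * y b - y b * y a =
    \sum_k coord (vbasis W) k (lieb (vbasis W)`_a (vbasis W)`_b) *: y k.
  apply: io_inj; rewrite -sub_letter_sum ?hU.1 //.
  by apply: W_sub; apply: sub_letter_mem.
have sL := @lspan_submod K B [seq y k | k <- enum 'I_n2].
by apply: (submod_sum sL) => k; apply: (submodZ sL); apply: lspan_mem; apply: map_f; rewrite mem_enum.
Qed.

Lemma sub_letter_gen (u : B) : subalgebra_gen (fun v => exists k, v = y k) u.
Proof.
elim: (subalg_gen u) => {u} [u [z zW Eu]|c|u v _ su _ sv|u v _ su _ sv].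
- have -> : u = \sum_k coord (vbasis W) k z *: y k.
    by apply: io_inj; rewrite -sub_letter_sum.
  elim/big_rec: _ => [|k v _ sv].
    by rewrite -[0](scale0r 1); apply: Gen_scalar.
  apply: Gen_add => //; rewrite -mulr_algl; apply: Gen_mul; first exact: Gen_scalar.
  by apply: Gen_in; exists k.
- exact: Gen_scalar.
- exact: Gen_add.
- exact: Gen_mul.
Qed.

Lemma noeth_env_sub : noeth (B : pzRingType)^o.
Proof. exact: noeth_enveloping sub_letter_comm sub_letter_gen. Qed.

Definition mcat (m1 : 'X_{1..n1}) (m2 : 'X_{1..n2}) : 'X_{1..(n1 + n2)} :=
  [multinom (match fintype.split k with inl a => m1 a | inr b => m2 b end) | k < n1 + n2].
Definition mleft (m : 'X_{1..(n1 + n2)}) : 'X_{1..n1} := [multinom m (lshift n2 k) | k < n1].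
Definition mright (m : 'X_{1..(n1 + n2)}) : 'X_{1..n2} := [multinom m (rshift n1 k) | k < n2].

Lemma mcatK m : mcat (mleft m) (mright m) = m.
Proof. by apply/mnmP => k; rewrite mnmE; case: split_ordP => a ->; rewrite mnmE. Qed.
Lemma mleftK m1 m2 : mleft (mcat m1 m2) = m1.
Proof. by apply/mnmP => k; rewrite !mnmE; case: split_ordP => a /eqP; rewrite eq_shift // => /eqP ->. Qed.
Lemma mrightK m1 m2 : mright (mcat m1 m2) = m2.
Proof. by apply/mnmP => k; rewrite !mnmE; case: split_ordP => a /eqP; rewrite eq_shift // => /eqP ->. Qed.

Lemma enum_ord_shift a b : enum 'I_(a + b) = map (@lshift a b) (enum 'I_a) ++ map (@rshift a b) (enum 'I_b).
Proof.
apply: (inj_map (@ord_inj (a + b))); transitivity (iota 0 (a + b)); first exact: val_enum_ord.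
rewrite map_cat -[map _ (map (@lshift a b) _)]map_comp -[map _ (map (@rshift a b) _)]map_comp iotaD add0n; congr (_ ++ _).
  by rewrite -[in LHS]val_enum_ord; apply: eq_map.
rewrite -[X in iota X _](addn0 a) iotaDl; transitivity (map (addn a) (map val (enum 'I_b))).
  by rewrite val_enum_ord.
by rewrite -[LHS]map_comp; apply: eq_map.
Qed.

Lemma mword_mcat m1 m2 :
  mword (mcat m1 m2) = map (@lshift n1 n2) (mword m1) ++ map (@rshift n1 n2) (mword m2).
Proof.
rewrite /mword enum_ord_shift map_cat flatten_cat !map_flatten.
do 4! rewrite -[map _ (map _ _)]map_comp.
congr (flatten _ ++ flatten _); apply: eq_map => k /=; rewrite map_nseq mnmE.
  by case: split_ordP => a /eqP; rewrite eq_shift // => /eqP ->.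
by case: split_ordP => a /eqP; rewrite eq_shift // => /eqP ->.
Qed.

Definition left_mon (m1 : 'X_{1..n1}) : U := wmon x (map (@lshift n1 n2) (mword m1)).

Lemma emon_mcat m1 m2 : emon x (mcat m1 m2) = left_mon m1 * io (emon y m2).
Proof.
rewrite /emon mword_mcat wmon_cat; congr (_ * _).
elim: (mword m2) => [|k w IHw]; first by rewrite !wmon_nil rmorph1.
by rewrite map_cons !wmon_cons -io_sub_letter IHw -rmorphM.
Qed.

Lemma left_mon_span a : exists (s : seq 'X_{1..n1}) (b : 'X_{1..n1} -> B),
  uniq s /\ a = \sum_(t <- s) left_mon t * io (b t).
Proof.
have [s [_ /lspan_fsum[c Ea]]] := espan_full (env_comm_span hU adapted_basisP)
  (env_letter_gen hU adapted_basisP) a.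
exists (undup (map mleft (undup s))).
exists (fun t => \sum_(m <- undup s) (if mleft m == t then c m *: emon y (mright m) else 0)).
split; first exact: undup_uniq.
under eq_bigr do rewrite linear_sum mulr_sumr.
rewrite exchange_big Ea !big_seq; apply: eq_bigr => m ms /=.
rewrite (bigD1_seq (mleft m)) ?undup_uniq ?mem_undup ?map_f //= eqxx big1 => [|t /negbTE tm].
  by rewrite addr0 linearZ -scalerAr -emon_mcat mcatK.
by rewrite eq_sym tm linear0 mulr0.
Qed.

Lemma left_mon_free (s : seq 'X_{1..n1}) (b : 'X_{1..n1} -> B) : uniq s ->
  \sum_(t <- s) left_mon t * io (b t) = 0 -> forall t, t \in s -> b t = 0.
Proof.
move=> us E.
have [r rP] : exists r : 'X_{1..n1} -> seq 'X_{1..n2}, forall t, True ->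
    exists c : 'X_{1..n2} -> K, b t = \sum_(m <- undup (r t)) c m *: emon y m.
  apply: (@choice_on _ _ [::] (fun _ => True) (fun t r =>
    exists c : 'X_{1..n2} -> K, b t = \sum_(m <- undup r) c m *: emon y m)) => t _.
  have [r [_ /lspan_fsum[c Eb]]] := espan_full sub_letter_comm sub_letter_gen (b t).
  by exists r, c.
have [c cP] : exists c : 'X_{1..n1} -> 'X_{1..n2} -> K, forall t, True ->
    b t = \sum_(m <- undup (r t)) c t m *: emon y m.
  by apply: (@choice_on _ _ (fun _ => 0) (fun _ => True) (fun t c =>
    b t = \sum_(m <- undup (r t)) c m *: emon y m)).
pose L := [seq mcat t m | t <- s, m <- undup (r t)].
have uL : uniq L.
  apply: allpairs_uniq_dep => // [t _|]; first exact: undup_uniq.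
  move=> [t m] [t' m'] _ _ /= Em; have := congr1 mleft Em; rewrite !mleftK => Et; subst t'.
  by have := congr1 mright Em; rewrite !mrightK => ->.
have E0 : \sum_(m <- L) c (mleft m) (mright m) *: emon x m = 0.
  rewrite -[RHS]E big_allpairs_dep; apply: eq_bigr => t _.
  rewrite (cP t I) linear_sum mulr_sumr; apply: eq_bigr => m _.
  by rewrite mleftK mrightK linearZ -scalerAr emon_mcat.
move=> t ts; rewrite (cP t I) big_seq big1 // => m mr.
have := pbw_free hU adapted_basisP g_center uL E0 (m := mcat t m).
by rewrite mleftK mrightK => ->; rewrite ?scale0r //; apply: allpairs_f_dep.
Qed.

Lemma env_coind_baer (X : lmodType U) : baer (res io (coind X)).
Proof. exact: coind_baer left_mon_span left_mon_free X. Qed.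

End SubalgebraBasis.

(** * Generalized eigenvectors and a trace criterion for nilpotency *)

Section OperatorPolynomials.
Variables (K : fieldType) (V : lmodType K) (v0 : V) (v00 : v0 != 0) (F : lend v00).

Definition opoly (p : {poly K}) (v : V) : V := lend_fun (horner_alg F p) v.

Lemma opolyM p q v : opoly (p * q) v = opoly p (opoly q v).
Proof. by rewrite /opoly rmorphM. Qed.

Lemma opolyD p q v : opoly (p + q) v = opoly p v + opoly q v.
Proof. by rewrite /opoly rmorphD. Qed.

Lemma opolyN p v : opoly (- p) v = - opoly p v.
Proof. by rewrite /opoly rmorphN. Qed.

Lemma opoly_const c v : opoly c%:P v = c *: v.
Proof. by rewrite /opoly horner_algC. Qed.

Lemma opoly1 v : opoly 1 v = v.
Proof. by rewrite opoly_const scale1r. Qed.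

Lemma opolyX v : opoly 'X v = F v.
Proof. by rewrite /opoly horner_algX. Qed.

Lemma opoly_XsubC c v : opoly ('X - c%:P) v = F v - c *: v.
Proof. by rewrite opolyD opolyN opolyX opoly_const. Qed.

Lemma opoly_linear p : linear (opoly p).
Proof. exact: lend_linear. Qed.

Lemma opoly0r p : opoly p 0 = 0.
Proof. exact: (linear0 (mklin (opoly_linear p))). Qed.

Lemma opolyC p q v : opoly p (opoly q v) = opoly q (opoly p v).
Proof. by rewrite -!opolyM mulrC. Qed.

Lemma opoly_submod (P : V -> Prop) p v :
  submod P -> (forall u, P u -> P (F u)) -> P v -> P (opoly p v).
Proof.
move=> sP FP; elim/poly_ind: p v => [|p c IHp] v Pv.
  by rewrite /opoly rmorph0; case: sP.
rewrite opolyD opolyM opolyX opoly_const.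
by apply: (submodD sP); [apply/IHp/FP|apply: (submodZ sP)].
Qed.

Lemma opoly_coprime p q v : coprimep p q -> opoly p v = 0 -> opoly q v = 0 -> v = 0.
Proof.
move=> /Bezout_eq1_coprimepP[[a b] /= E] pv qv.
by rewrite -[v]opoly1 -E opolyD !opolyM pv qv !opoly0r addr0.
Qed.

End OperatorPolynomials.

Section GeneralizedEigenvectors.
Variables (K : closedFieldType) (V : lmodType K) (v0 : V) (v00 : v0 != 0) (F : lend v00).

(** One root at a time is split off by a Bezout relation between its power in [p] and the remaining
    factor. The components are polynomials in the operator applied to [v], so they stay in [P]. *)
Lemma opoly_decomp (P : V -> Prop) (p : {poly K}) v :
    submod P -> (forall u, P u -> P (F u)) -> p != 0 -> opoly F p v = 0 -> P v ->
  exists s : seq (K * V), v = \sum_(cw <- s) cw.2 /\ forall cw, cw \in s ->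
    P cw.2 /\ exists k, opoly F (('X - cw.1%:P) ^+ k) cw.2 = 0.
Proof.
move=> sP FP; have [m] := ubnP (size p); elim: m p v => // m IHm p v sp p0 pv Pv.
have [sp1|sp1] := eqVneq (size p) 1.
  have /size_poly1P[c c0 Ep] := introT eqP sp1.
  exists [::]; split=> //; rewrite big_nil.
  by apply/eqP; move/eqP: pv; rewrite Ep opoly_const scaler_eq0 (negbTE c0).
have [a ra] := closed_rootP p sp1.
have [k [q]] := multiplicity_XsubC p a; rewrite p0 /= => rq Ep.
have cq : coprimep q (('X - a%:P) ^+ k) by rewrite coprimep_expr // coprimep_XsubC.
have /Bezout_eq1_coprimepP[[u w] /= E] := cq.
have q0 : q != 0 by apply: contraNneq rq => ->; rewrite root0.
have k0 : (0 < k)%N.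
  by case: k Ep cq E => // Ep; move: ra; rewrite Ep expr0 mulr1 (negbTE rq).
have sq : (size q < m)%N.
  have Xk0 : ('X - a%:P) ^+ k != 0 by rewrite expf_neq0 ?polyXsubC_eq0.
  move: sp; rewrite Ep size_mul // size_exp_XsubC addnS ltnS; apply: leq_trans.
  by rewrite -addn1 leq_add2l.
pose v1 := opoly F (u * q) v; pose v2 := opoly F (w * ('X - a%:P) ^+ k) v.
have [||||s [Es sPk]] := IHm q v2 => //.
- by rewrite /v2 -opolyM mulrCA -Ep opolyM pv opoly0r.
- exact: opoly_submod.
exists ((a, v1) :: s); split.
  by rewrite big_cons -Es -opolyD E opoly1.
move=> cw; rewrite inE => /predU1P[->|/sPk //]; split; first exact: opoly_submod.
by exists k; rewrite /= /v1 -opolyM mulrCA [_ * q]mulrC -Ep opolyM pv opoly0r.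
Qed.

(** Chinese remaindering: the interpolant for [s] is corrected at the new node by a multiple of the
    product of the previous moduli. *)
Lemma hermite_interpolation (s : seq K) (N : nat) (f : K -> K) : uniq s ->
  exists q : {poly K}, forall c, c \in s -> ('X - c%:P) ^+ N %| q - (f c)%:P.
Proof.
elim: s => [_|a s IHs /= /andP[as_ us]]; first by exists 0.
have [q qP] := IHs us; pose m := \prod_(c <- s) ('X - c%:P) ^+ N.
have : coprimep m (('X - a%:P) ^+ N).
  rewrite coprimep_expr // coprimep_XsubC /m rootE horner_prod prodf_seq_neq0.
  apply/allP => c cs /=; rewrite horner_exp !hornerE expf_neq0 // subr_eq0.
  by apply: contraNneq as_ => ->.
move=> /Bezout_eq1_coprimepP[[u w] /= E].
exists (q + ((f a)%:P - q) * (u * m)) => c; rewrite inE => /predU1P[->|cs].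
  have -> : q + ((f a)%:P - q) * (u * m) - (f a)%:P =
      (q - (f a)%:P) * (w * ('X - a%:P) ^+ N).
    have -> : w * ('X - a%:P) ^+ N = 1 - u * m by rewrite -E addrAC subrr add0r.
    ring.
  by rewrite mulrA dvdp_mull.
rewrite addrAC dvdp_addr ?qP // !mulrA dvdp_mull //.
by rewrite /m (big_rem c) //= dvdp_mulr.
Qed.

End GeneralizedEigenvectors.

Section VectLspan.
Variables (K : fieldType) (V : vectType K).

Lemma vect_lspan (v : V) : lspan (vbasis {:V}) v.
Proof.
have sL := @lspan_submod K V (vbasis {:V}).
rewrite (coord_vbasis (memvf v)); apply: (submod_sum sL) => k; apply: (submodZ sL).
by apply: lspan_mem; rewrite memt_nth.
Qed.

Lemma opoly_root (v0 : V) (v00 : v0 != 0) (F : lend v00) v :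
  exists2 p : {poly K}, p != 0 & opoly F p v = 0.
Proof.
have [c [c0 Ec]] := span_dependent (fun k => vect_lspan (opoly F 'X^k v)).
exists (\sum_k c 0 k *: 'X^k).
  apply: contra_neq c0 => Ep; apply/rowP=> k; rewrite mxE.
  have := congr1 (fun p : {poly K} => p`_k) Ep; rewrite coef0 coef_sum.
  rewrite (bigD1 k) //= coefZ coefXn eqxx mulr1 big1 ?addr0 // => j jk.
  by rewrite coefZ coefXn eq_sym [_ == _](negbTE jk) mulr0.
rewrite -[RHS]Ec; elim/big_rec2: _ => [|k w p _ <-]; first by rewrite /opoly rmorph0.
by rewrite opolyD -mul_polyC opolyM opoly_const.
Qed.

End VectLspan.

Section MatrixCommutators.
Variables (C : numClosedFieldType) (n : nat).
Local Notation A := 'M[C]_n.+1.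
Implicit Types (x b w : A).

Lemma mx1_neq0 : (1 : A) != 0.
Proof. exact: oner_neq0. Qed.

Lemma mulx_linear x : linear (fun w : A => x * w).
Proof. by move=> a u v; rewrite mulrDr -scalerAr. Qed.
Lemma adx_linear x : linear (fun b : A => x * b - b * x).
Proof.
move=> a u v; rewrite mulrDr mulrDl -scalerAr -scalerAl scalerBr opprD addrACA //.
Qed.

(** Left multiplication on the matrix algebra stands in for the action on column vectors, so that it
    lives on the same space as [adx]. *)
Definition mulx x : lend mx1_neq0 := Lend mx1_neq0 (mulx_linear x).
Definition adx x : lend mx1_neq0 := Lend mx1_neq0 (adx_linear x).

Lemma opoly_mulx x p w : opoly (mulx x) p w = horner_mx x p * w.
Proof.
elim/poly_ind: p w => [|p c IHp] w; first by rewrite /opoly rmorph0 rmorph0 mul0r.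
rewrite opolyD opolyM opolyX opoly_const IHp rmorphD rmorphM /= horner_mx_X horner_mx_C.
by rewrite mulrDl -mulrA [c%:M * w]mul_scalar_mx.
Qed.

(** Since [x (b w) = [x, b] w + b (x w)], each factor [x - (d + c)] uses up one power on either
    side, and [k + k'] factors exhaust one of them. *)
Lemma mulx_adx_shift x b w c d k k' :
    opoly (adx x) (('X - c%:P) ^+ k') b = 0 -> opoly (mulx x) (('X - d%:P) ^+ k) w = 0 ->
  opoly (mulx x) (('X - (d + c)%:P) ^+ (k + k')) (b * w) = 0.
Proof.
move Em: (k + k')%N => m; elim: m k k' b w Em => [|m IHm] k k' b w.
  by case: k => // _ _; rewrite expr0 !opoly1 => ->; rewrite mulr0.
case: k k' => [|k] [|k'] // Em; try by rewrite expr0 !opoly1 => ->; rewrite ?mulr0 ?mul0r opoly0r.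
  by move=> _; rewrite expr0 !opoly1 => ->; rewrite ?mulr0 ?mul0r opoly0r.
move=> bk wk; have E : opoly (mulx x) ('X - (d + c)%:P) (b * w) =
    1 *: (opoly (adx x) ('X - c%:P) b * w) + b * opoly (mulx x) ('X - d%:P) w.
  rewrite !opoly_XsubC /= scale1r mulrBl mulrBl mulrBr -!scalerAl -scalerAr scalerDl.
  by rewrite !mulrA opprD addrA -[RHS]addrA [X in _ = _ + X]addrC !addrA subrK.
rewrite exprSr opolyM E opoly_linear scale1r.
rewrite (IHm k.+1 k' _ w) ?(IHm k k'.+1 b) ?addr0 //.
- by move: Em; rewrite addSn => -[].
- by rewrite -opolyM -exprSr.
- by move: Em; rewrite addnS => -[].
- by rewrite -opolyM -exprSr.
Qed.

Variables (x : A) (t : 'I_n.+1 -> C).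
Hypothesis x_t : horner_mx x (\prod_i ('X - (t i)%:P)) = 0.

(** Interpolating complex conjugation at the eigenvalues to order [n.+1] makes [q(x)] act on each
    generalized eigenspace as the conjugate eigenvalue. It plays the part of the conjugate of the
    semisimple component of [x]. *)
Lemma conj_interpolation : exists q : {poly C},
  (forall i, q.[t i] = (t i)^*) /\
  forall d k w, opoly (mulx x) (('X - d%:P) ^+ k) w = 0 -> opoly (mulx x) q w = d^* *: w.
Proof.
have [q qP] := @hermite_interpolation C (undup (codom t)) n.+1 (fun c => c^*) (undup_uniq _).
have tin i : t i \in undup (codom t) by rewrite mem_undup codom_f.
exists q; split=> [i|d k w wk].
  have /dvdpP[r Er] := qP _ (tin i).
  have := congr1 (fun p => p.[t i]) Er; rewrite !hornerE subrr.
  by rewrite expr0n /= mulr0 => /eqP; rewrite subr_eq0 => /eqP.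
pose p := \prod_i ('X - (t i)%:P).
have p0 : p != 0 by apply/prodf_neq0 => i _; rewrite polyXsubC_eq0.
have [m [Q]] := multiplicity_XsubC p d; rewrite p0 /= => rQ Ep.
have pw : opoly (mulx x) p w = 0 by rewrite opoly_mulx x_t mul0r.
have wm : opoly (mulx x) (('X - d%:P) ^+ m) w = 0.
  apply: (@opoly_coprime _ _ _ _ (mulx x) Q (('X - d%:P) ^+ k)).
  - by rewrite coprimep_expr // coprimep_XsubC.
  - by rewrite -opolyM -Ep.
  - by rewrite opolyC wk opoly0r.
case: m => [|m] in Ep wm; first by move: wm; rewrite expr0 opoly1 => ->; rewrite scaler0 opoly0r.
have : root p d by rewrite Ep rootM root_exp_XsubC eqxx orbT.
rewrite /p rootE horner_prod => /prodf_eq0[i _]; rewrite !hornerE subr_eq0 => /eqP Ed.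
have Q0 : Q != 0 by apply: contraNneq rQ => ->; rewrite root0.
have mn : (m.+1 <= n.+1)%N.
  have : size p = n.+2 by rewrite /p -big_enum size_prod_XsubC size_enum_ord.
  rewrite Ep size_mul ?expf_neq0 ?polyXsubC_eq0 // size_exp_XsubC addnS /=.
  move: Q0; rewrite -size_poly_gt0; case: (size Q) => // l _.
  by rewrite addSn => -[<-]; rewrite leq_addl.
have /dvdpP[r Er] := qP d (eq_ind_r (fun d => d \in _) (tin i) Ed).
have E : opoly (mulx x) q w - d^* *: w = opoly (mulx x) (q - (d^*)%:P) w.
  by rewrite opolyD opolyN opoly_const.
apply/eqP; rewrite -subr_eq0 E Er.
have -> : ('X - d%:P) ^+ n.+1 = ('X - d%:P) ^+ (n.+1 - m.+1) * ('X - d%:P) ^+ m.+1.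
  by rewrite -exprD subnK.
by rewrite mulrA opolyM wm opoly0r.
Qed.

(** The identity matrix decomposes into generalized eigenvectors [w] of left multiplication. If [w]
    has eigenvalue [d], then [b w] has eigenvalue [d + c], and conjugating leaves the difference
    [c^*]. *)
Lemma conj_adx (q : {poly C}) c k b :
    (forall d k w, opoly (mulx x) (('X - d%:P) ^+ k) w = 0 -> opoly (mulx x) q w = d^* *: w) ->
    opoly (adx x) (('X - c%:P) ^+ k) b = 0 ->
  horner_mx x q * b - b * horner_mx x q = c^* *: b.
Proof.
move=> qP bk; have p1 : opoly (mulx x) (\prod_i ('X - (t i)%:P)) 1 = 0.
  by rewrite opoly_mulx x_t mul0r.
have p0 : \prod_i ('X - (t i)%:P) != 0 by apply/prodf_neq0 => i _; rewrite polyXsubC_eq0.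
have [s [E1 sP]] := opoly_decomp (F := mulx x) (@submod_true C A) (fun _ _ => I) p0 p1 I.
rewrite -[LHS]mulr1 -[RHS]mulr1 E1 !mulr_sumr !big_seq; apply: eq_bigr => dw dws.
have [_ [k' wk']] := sP dw dws.
have := qP _ _ _ wk'; rewrite opoly_mulx => yw.
have := qP _ _ _ (mulx_adx_shift bk wk'); rewrite opoly_mulx => ybw.
by rewrite mulrBl -!mulrA ybw yw rmorphD scalerDl -scalerAr addrAC subrr add0r scalerAl.
Qed.

(** [L] contains the generalized [ad x] components of [b], and bracketing with [q(x)] is a scalar on
    each of them. *)
Lemma bracket_conj (L : A -> Prop) (q : {poly C}) b :
    (forall d k w, opoly (mulx x) (('X - d%:P) ^+ k) w = 0 -> opoly (mulx x) q w = d^* *: w) ->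
    @submod C A L -> (forall u v, L u -> L v -> L (u * v - v * u)) -> L x -> L b ->
  L (horner_mx x q * b - b * horner_mx x q).
Proof.
move=> qP sL LL Lx Lb; have [p p0 pb] := opoly_root (adx x) b.
have [s [Eb sP]] := opoly_decomp (F := adx x) sL (fun u Lu => LL x u Lx Lu) p0 pb Lb.
rewrite Eb mulr_sumr mulr_suml -sumrB big_seq.
elim/big_rec: _ => [|cw v cws Lv]; first by case: sL.
have [Lw [k wk]] := sP cw cws; apply: (submodD sL) => //.
by rewrite (conj_adx qP wk); apply: (submodZ sL).
Qed.

End MatrixCommutators.

Section TraceCriterion.
Variable C : numClosedFieldType.

Lemma trig_mul n (S T : 'M[C]_n) : is_trig_mx S -> is_trig_mx T ->
  is_trig_mx (S *m T) /\ forall i, (S *m T) i i = S i i * T i i.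
Proof.
move=> /is_trig_mxP St /is_trig_mxP Tt; split=> [|i].
  apply/is_trig_mxP => i j ij; rewrite mxE big1 // => k _.
  have [ik|ki] := ltnP i k; first by rewrite St ?mul0r.
  by rewrite Tt ?mulr0 // (leq_ltn_trans ki).
rewrite mxE (bigD1 i) //= big1 ?addr0 // => k ki.
have [ik|] := ltnP i k; first by rewrite St ?mul0r.
by rewrite leq_eqVlt => /predU1P[/val_inj Ek|/Tt ->]; [rewrite Ek eqxx in ki|rewrite mulr0].
Qed.

Lemma trig_horner n (T : 'M[C]_n.+1) p : is_trig_mx T ->
  is_trig_mx (horner_mx T p) /\ forall i, (horner_mx T p) i i = p.[T i i].
Proof.
move=> Tt; elim/poly_ind: p => [|p c [IHt IHd]].
  rewrite rmorph0; split=> [|i]; first exact: mx0_is_trig.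
  by rewrite mxE horner0.
have [Mt Md] := trig_mul IHt Tt; rewrite rmorphD rmorphM /= horner_mx_X horner_mx_C.
split=> [|i]; last by rewrite mxE Md IHd !hornerE mxE eqxx.
apply/is_trig_mxP => i j ij; rewrite mxE.
have -> : (horner_mx T p * T) i j = 0 by apply: (is_trig_mxP Mt).
by rewrite mxE -val_eqE (ltn_eqF ij) addr0.
Qed.

(** The trace of [x q(x)] is the sum of the squared moduli of the eigenvalues. As [x] is a sum of
    commutators, that trace is also a sum of terms pairing an element of [L] with a bracket by
    [q(x)], which stays in [L]; so it is zero. *)
Lemma trace_nilpotent n (L : 'M[C]_n.+1 -> Prop) (r : seq ('M[C]_n.+1 * 'M[C]_n.+1)) :
    @submod C 'M[C]_n.+1 L -> (forall u v, L u -> L v -> L (u * v - v * u)) ->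
    (forall u v, L u -> L v -> \tr (u *m v) = 0) ->
    (forall uv, uv \in r -> L uv.1 /\ L uv.2) ->
  (\sum_(uv <- r) (uv.1 * uv.2 - uv.2 * uv.1)) ^+ n.+1 = 0.
Proof.
move=> sL LL Ltr rL; set x := \sum_(uv <- r) _.
have Lx : L x.
  rewrite /x big_seq; elim/big_rec: _ => [|uv v uvr Lv]; first by case: sL.
  by apply: (submodD sL) => //; have [] := rL uv uvr; apply: LL.
have [P Pu] := Schur x isT; rewrite /similar_to => Tt.
have Pun : P \in unitmx by apply: unitarymx_unit.
set T := conjmx P x in Tt.
have Ex : x = invmx P *m T *m P by rewrite -(conjmxK x Pun) conjumx ?unitmx_inv // invmxK.
have Ep p : horner_mx x p = invmx P *m horner_mx T p *m P.
  by rewrite Ex horner_mx_uconjC.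
have chiT : char_poly T = \prod_i ('X - (T i i)%:P) by apply: char_poly_trig.
have xt : horner_mx x (\prod_i ('X - (T i i)%:P)) = 0.
  by rewrite -chiT Ep Cayley_Hamilton mulmx0 mul0mx.
have [q [qt qP]] := conj_interpolation xt.
have Etr : \tr (x *m horner_mx x q) = \sum_i T i i * (T i i)^*.
  have -> : x *m horner_mx x q = horner_mx x ('X * q) by rewrite rmorphM /= horner_mx_X.
  rewrite Ep.
  rewrite -mulmxA mxtrace_mulC -mulmxA mulmxV // mulmx1; apply: eq_bigr => i _.
  have [_ ->] := trig_horner ('X * q) Tt.
  by rewrite hornerM hornerX qt.
have tr0 : \tr (x *m horner_mx x q) = 0.
  rewrite /x mulmx_suml raddf_sum big_seq big1 //= => uv /rL[Lu Lv].
  rewrite -/x [_ *m _]mulrBl raddfB /= -!mulrA.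
  rewrite [\tr (uv.2 * _)]mxtrace_mulC -mulmxA -raddfB /= -mulrBr.
  rewrite -opprB mulrN raddfN /= Ltr ?oppr0 //.
  exact: (bracket_conj (t := fun i => T i i)).
have T0 i : T i i = 0.
  have /psumr_eq0P : \sum_i T i i * (T i i)^* = 0 by rewrite -Etr.
  move=> /(_ (fun i _ => mul_conjC_ge0 _)) /(_ i isT) /eqP.
  by rewrite mul_conjC_eq0 => /eqP.
have := Ep ('X ^+ n.+1); rewrite rmorphXn /= horner_mx_X => ->.
suff -> : horner_mx T ('X ^+ n.+1) = 0 by rewrite mulmx0 mul0mx.
rewrite -(Cayley_Hamilton T) chiT (eq_bigr (fun=> 'X)) => [|i _]; last by rewrite T0 subr0.
by rewrite prodr_const card_ord.
Qed.

(* Subspaces, ideals, Engel's theorem and Cartan's criterion *)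
End TraceCriterion.

Section VspaceLemmas.
Variables (K : fieldType) (V : vectType K).

Lemma vspace_of (P : V -> Prop) : submod P -> exists W : {vspace V}, forall v, v \in W <-> P v.
Proof.
move=> sP; have [s [sP1 Ps]] := noeth_sub_span (@field_noeth K) sP (fun v _ => vect_lspan v).
exists <<s>>%VS => v; split=> [|/Ps].
  move=> vs; rewrite (coord_span (X := in_tuple s) vs); apply: (submod_sum sP) => k.
  by apply: (submodZ sP); apply: sP1; apply: mem_nth.
have sS : submod (fun w : V => w \in <<s>>%VS).
  by split=> [|a u w us ws]; rewrite ?mem0v // memvD ?memvZ.
by apply: (lspan_min sS) => w; apply: memv_span.
Qed.

Lemma vspace_max (Q : {vspace V} -> Prop) W0 : Q W0 ->
  exists W, Q W /\ forall W', Q W' -> (W <= W')%VS -> W' = W.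
Proof.
have [m] := ubnP (\dim {:V} - \dim W0)%N; elim: m W0 => // m IHm W0 Wm QW0.
have [[W' [QW' WW' nW]]|nW] := pselect (exists W', [/\ Q W', (W0 <= W')%VS & W' <> W0]).
  have ltW : (\dim W0 < \dim W')%N.
    rewrite ltn_neqAle dimvS // andbT; apply/eqP => Ed; apply: nW; apply/esym/eqP.
    by rewrite eqEdim WW' Ed /=.
  apply: (IHm W') => //; rewrite ltnS in Wm.
  apply: leq_trans Wm; apply: ltn_sub2l => //.
  by apply: leq_trans ltW _; apply: dimvS; apply: subvf.
exists W0; split=> // W' QW' WW'; apply: contrapT => nW'; case: nW.
by exists W'.
Qed.

Lemma vspace_descending (f : nat -> {vspace V}) : (forall m, (f m.+1 <= f m)%VS) ->
  exists m, f m.+1 = f m.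
Proof.
move=> fS; apply: contrapT => nf.
have lt m : (\dim (f m.+1) < \dim (f m))%N.
  rewrite ltn_neqAle dimvS // andbT; apply/eqP => Ed; apply: nf; exists m; apply/eqP.
  by rewrite eqEdim fS Ed /=.
have bound m : (m + \dim (f m) <= \dim (f 0%N))%N.
  elim: m => // m IHm; apply: leq_trans IHm; rewrite addSnnS leq_add2l; exact: lt.
by have := bound (\dim (f 0%N)).+1; rewrite addSn ltnNge leq_addr.
Qed.

End VspaceLemmas.

Section LieIdeals.
Variables (K : fieldType) (g : lieAlgType K).
Implicit Types (V W X I J : {vspace g}) (x y z : g).

Lemma lieb_spaceP V W X :
  (forall x y, x \in V -> y \in W -> lieb x y \in X) <-> (lieb_space V W <= X)%VS.
Proof.
split=> [H|H x y xV yW]; last first.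
  rewrite (coord_vbasis xV) lieb_suml; apply: memv_suml => k _; rewrite liebZl memvZ //.
  rewrite (coord_vbasis yW) lieb_sumr; apply: memv_suml => l _; rewrite liebZr memvZ //.
  apply: (subvP H); apply: memv_span; apply/allpairsP.
  by exists ((vbasis V)`_k, (vbasis W)`_l); split; rewrite // memt_nth.
apply/span_subvP => _ /allpairsP[[x y] [xV yW ->]].
by apply: H; apply: vbasis_mem.
Qed.

Lemma mem_lieb_space V W x y : x \in V -> y \in W -> lieb x y \in lieb_space V W.
Proof. by move: x y; apply/lieb_spaceP; apply: subvv. Qed.

Lemma lieb_space_sum V W z : z \in lieb_space V W ->
  exists r : seq (g * g), (forall xy, xy \in r -> xy.1 \in V /\ xy.2 \in W) /\
    z = \sum_(xy <- r) lieb xy.1 xy.2.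
Proof.
pose P z := exists r : seq (g * g), (forall xy, xy \in r -> xy.1 \in V /\ xy.2 \in W) /\
    z = \sum_(xy <- r) lieb xy.1 xy.2.
have sP : submod P.
  split=> [|a u v [r [rV ->]] [s [sV ->]]]; first by exists [::]; rewrite big_nil.
  exists ([seq (a *: xy.1, xy.2) | xy <- r] ++ s); split=> [xy|].
    rewrite mem_cat => /orP[/mapP[xy' /rV[xV yW] ->]|/sV //]; split=> //=.
    exact: memvZ.
  rewrite big_cat big_map scaler_sumr; congr (_ + _).
  by apply: eq_bigr => xy _; rewrite liebZl.
have [X XP] := vspace_of sP; move=> zVW; apply/XP; apply: subvP z zVW.
apply/lieb_spaceP => x y xV yW; apply/XP; exists [:: (x, y)].
by split=> [xy|]; rewrite ?big_seq1 // inE => /eqP ->.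
Qed.

Lemma lieb_space_ideal I J : lie_ideal I -> lie_ideal J -> lie_ideal (lieb_space I J).
Proof.
move=> iI iJ x y yIJ.
suff : (lieb_space I J <= linfun (adl x) @^-1: lieb_space I J)%VS.
  by move/subvP/(_ y yIJ); rewrite -memv_preim lfunE.
apply/lieb_spaceP => a b aI bJ; rewrite -memv_preim lfunE /= lieb_der.
by rewrite memvD // mem_lieb_space //; [apply: iI|apply: iJ].
Qed.

Lemma ideal_mull I x y : lie_ideal I -> x \in I -> lieb x y \in I.
Proof. by move=> iI xI; rewrite lieb_antisym memvN; apply: iI. Qed.

Lemma derived_series_ideal I m : lie_ideal I -> lie_ideal (derived_series I m).
Proof. by move=> iI; elim: m => //= m IHm; apply: lieb_space_ideal. Qed.

Lemma derived_series_sub I m : lie_ideal I -> (derived_series I m.+1 <= derived_series I m)%VS.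
Proof.
move=> iI; apply/lieb_spaceP => x y xI yI; apply: derived_series_ideal => //.
Qed.

Lemma semisimple_center : lie_semisimple g -> forall x, (forall y, lieb x y = 0) -> x = 0.
Proof.
move=> hg x cx; have sZ : submod (fun x : g => forall y, lieb x y = 0).
  split=> [y|a u v cu cv y]; first exact: lieb0l.
  by rewrite liebDl liebZl cu cv scaler0 addr0.
have [Z ZP] := vspace_of sZ; have : x \in Z by apply/ZP.
rewrite (hg Z) ?memv0 => [/eqP //|y z zZ|].
  by rewrite lieb_antisym (ZP z).1 // oppr0 mem0v.
exists 1; apply/eqP; rewrite -subv0; apply/lieb_spaceP => y z yZ _.
by rewrite (ZP y).1 // mem0v.
Qed.

Lemma adjoin_sub W (y : g) (Q : {vspace g}) : (Q <= W)%VS -> y \in W -> (Q + <[y]> <= W)%VS.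
Proof. by by move=> QW yW; rewrite subv_add QW -memvE. Qed.

(** Engel's theorem for the action of [W] on [B] modulo [A], by induction on the dimension of
    [W]. *)
Lemma engel W A B : lie_subalgebra W ->
    (forall x, x \in W -> exists k, forall z, iter k (lieb x) z = 0) ->
    (A <= B)%VS -> A <> B ->
    (forall x a, x \in W -> a \in A -> lieb x a \in A) ->
    (forall x b, x \in W -> b \in B -> lieb x b \in B) ->
  exists b, [/\ b \in B, b \notin A & forall x, x \in W -> lieb x b \in A].
Proof.
have [m] := ubnP (\dim W); elim: m W A B => // m IHm W A B dW sW nW AB nAB WA WB.
have [W0|/eqP W0] := eqVneq W 0%VS.
  have /subvPn[b bB bA] : ~~ (B <= A)%VS.
    by apply/negP => BA; apply: nAB; apply/eqP; rewrite eqEsubv AB.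
  by exists b; split=> // x; rewrite W0 memv0 => /eqP ->; rewrite lieb0l mem0v.
pose R Q := [/\ lie_subalgebra Q, (Q <= W)%VS & Q <> W].
have R0 : R 0%VS.
  split; [move=> x y; rewrite !memv0 => /eqP -> _; rewrite lieb0l //|exact: sub0v|exact/nesym].
have [Q [[sQ QW nQ] Qmax]] := vspace_max R0.
have dQ : (\dim Q < m)%N.
  have : (\dim Q < \dim W)%N.
    rewrite ltn_neqAle dimvS // andbT; apply/eqP => E; apply: nQ; apply/eqP.
    by rewrite eqEdim QW E /=.
  by move=> /leq_trans; apply.
have nilQ x : x \in Q -> exists k, forall z, iter k (lieb x) z = 0.
  by move=> /(subvP QW)/nW.
(* The induction hypothesis for [Q] acting on [W] modulo [Q] gives an element [y] normalizing [Q];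
   maximality of [Q] then forces [W = Q + <y>]. *)
have [|y [yW yQ Qy]] := IHm Q Q W dQ sQ nilQ QW nQ sQ.
  by move=> x b /(subvP QW) xW; apply: sW.
have EW : (Q + <[y]>)%VS = W.
  apply: contrapT => nE; move/negP: yQ; apply.
  rewrite -(Qmax (Q + <[y]>)%VS) ?addvSl //; last first.
    split=> //; last exact: adjoin_sub.
    move=> _ _ /memv_addP[q qQ [_ /vlineP[c ->] ->]] /memv_addP[q' qQ' [_ /vlineP[c' ->] ->]].
    rewrite !(liebDl, liebDr) !(liebZl, liebZr) liebxx !scaler0 addr0.
    have yq : lieb y q' \in Q by rewrite lieb_antisym memvN Qy.
    have qy := Qy q qQ; have qq := sQ q q' qQ qQ'.
    by apply: (subvP (addvSl Q <[y]>)); rewrite !memvD ?memvZ.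
  by apply: (subvP (addvSr Q <[y]>)); apply: memv_line.
have [||b [bB bA Qb]] := IHm Q A B dQ sQ nilQ AB nAB.
- by move=> x a /(subvP QW); apply: WA.
- by move=> x a /(subvP QW); apply: WB.
have [k yk] := nW y yW.
have {yk} : iter k (lieb y) b \in A by rewrite yk mem0v.
(* Among [b], [[y, b]], and so on, the last vector outside [A] works: [Q] keeps sending these
   vectors into [A] because [y] normalizes [Q]. *)
elim: k b bB bA Qb => [b _ /negP//|k IHk] b bB bA Qb; rewrite iterSr => ybk.
have [yb|yb] := boolP (lieb y b \in A); last first.
  apply: (IHk (lieb y b)) => // [|x xQ]; first exact: WB.
  by rewrite lieb_der memvD //; [apply/Qb/Qy|apply: WA => //; apply: Qb].
exists b; split=> // x; rewrite -EW => /memv_addP[q qQ [_ /vlineP[c ->] ->]].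
rewrite liebDl liebZl; apply: memvD; first exact: Qb.
exact: memvZ.
Qed.

End LieIdeals.

Section CartanCriterion.
Variables (C : numClosedFieldType) (g : lieAlgType C).
Implicit Types (D I : {vspace g}).

(** Take a maximal proper stable subspace [A] of [D]. By Engel it has a one-dimensional supplement
    that [D] brackets into [A], so the derived algebra of [D] lies in [A], contradicting
    perfectness. *)
Lemma perfect_nilpotent D : lie_ideal D -> lieb_space D D = D ->
  (forall x, x \in D -> exists k, forall z, iter k (lieb x) z = 0) -> D = 0%VS.
Proof.
move=> iD DD nD; apply: contrapT => D0.
pose R A := [/\ (A <= D)%VS, A <> D & forall x a, x \in D -> a \in A -> lieb x a \in A].
have R0 : R 0%VS.
  split; [exact: sub0v|exact/nesym|move=> x a _; rewrite !memv0 => /eqP ->].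
  by rewrite lieb0r.
have [A [[AD nA DA] Amax]] := vspace_max R0.
have sD : lie_subalgebra D by move=> x y _; apply: iD.
have [//|b [bD bA Db]] := engel sD nD AD nA DA.
have EA : (A + <[b]>)%VS = D.
  apply: contrapT => nE; move/negP: bA; apply.
  rewrite -(Amax (A + <[b]>)%VS) ?addvSl //.
    by apply: (subvP (addvSr A <[b]>)); apply: memv_line.
  split=> //; first exact: adjoin_sub.
  move=> x _ xD /memv_addP[a aA [_ /vlineP[c ->] ->]]; apply: (subvP (addvSl A <[b]>)).
  by rewrite liebDr liebZr; apply: memvD; [apply: DA|apply/memvZ/Db].
apply: nA; apply/eqP; rewrite eqEsubv AD -{1}DD; apply/lieb_spaceP => x y xD.
rewrite -{1}EA => /memv_addP[a aA [_ /vlineP[c ->] ->]].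
by rewrite liebDr liebZr; apply: memvD; [apply: DA|apply/memvZ/Db].
Qed.

(** Each commutator adds a factor [x] on the left or on the right of [b]; with [2 * k] factors in
    total, one side carries at least [k]. *)
Lemma iter_ad_mul n (x b : 'M[C]_n) k m i j : (2 * k <= m + i + j)%N ->
    iter k (mulmx x) 1%:M = 0 ->
  iter m (fun b => x *m b - b *m x) (iter i (mulmx x) 1%:M *m b *m iter j (mulmx x) 1%:M) = 0.
Proof.
move=> + xk; have xk' l : (k <= l)%N -> iter l (mulmx x) 1%:M = 0.
  by move=> /subnK <-; rewrite iterD xk; elim: (l - k)%N => //= a ->; rewrite mulmx0.
have xC l : iter l (mulmx x) 1%:M *m x = x *m iter l (mulmx x) 1%:M.
  by elim: l => [|l IHl] /=; rewrite ?mul1mx ?mulmx1 // -mulmxA IHl.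
have zero a : iter a (fun b => x *m b - b *m x) 0 = 0.
  by elim: a => //= a ->; rewrite mulmx0 mul0mx subrr.
have add a u v : iter a (fun b => x *m b - b *m x) (u - v) =
    iter a (fun b => x *m b - b *m x) u - iter a (fun b => x *m b - b *m x) v.
  elim: a => //= a ->; rewrite mulmxBr mulmxBl !opprB addrACA [in RHS]addrACA.
  by congr (_ + _); rewrite addrC.
elim: m i j => [|m IHm] i j; rewrite ?add0n => mij.
  rewrite /=; have [ki|ik] := leqP k i; first by rewrite xk' // !mul0mx.
  rewrite (xk' j) ?mulmx0 //; move: mij; rewrite mul2n -addnn.
  by move=> /leq_trans -/(_ (k + j)%N); rewrite leq_add2l; apply; rewrite leq_add2r ltnW.
rewrite iterSr; have -> : x *m (iter i (mulmx x) 1%:M *m b *m iter j (mulmx x) 1%:M) -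
    (iter i (mulmx x) 1%:M *m b *m iter j (mulmx x) 1%:M) *m x =
    iter i.+1 (mulmx x) 1%:M *m b *m iter j (mulmx x) 1%:M -
    iter i (mulmx x) 1%:M *m b *m iter j.+1 (mulmx x) 1%:M.
  by rewrite /= !mulmxA -[X in _ - X]mulmxA xC !mulmxA.
rewrite add !IHm ?subrr //; first by move: mij; rewrite addnS !addSn.
by move: mij; rewrite addnS !addSn.
Qed.

Variables (n : nat) (rho : {linear g -> 'M[C]_n}).
Hypothesis rho_lie : forall x y, rho (lieb x y) = rho x *m rho y - rho y *m rho x.

Lemma ad_nilpotent D x k : lie_ideal D -> (forall y, y \in D -> rho y = 0 -> y = 0) ->
  x \in D -> iter k (mulmx (rho x)) 1%:M = 0 -> exists m, forall z, iter m (lieb x) z = 0.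
Proof.
(* The additional bracket moves an arbitrary [z] into [D], where [rho] is injective. *)
move=> iD rI xD xk; exists (2 * k).+1 => z; rewrite iterSr.
have zD : lieb x z \in D by apply: ideal_mull.
move: (lieb x z) zD => {}z zD; apply: rI.
  by elim: (2 * k)%N => //= m; apply: iD.
have E m : rho (iter m (lieb x) z) = iter m (fun b => rho x *m b - b *m rho x) (rho z).
  by elim: m => //= m <-; rewrite rho_lie.
rewrite E; have := @iter_ad_mul n (rho x) (rho z) k (2 * k) 0 0.
by rewrite !addn0 /= mul1mx mulmx1 => ->.
Qed.

End CartanCriterion.

(** The derived series of [D] stabilizes at a perfect ideal [P]. Its elements are sums of brackets,
    so [trace_nilpotent] makes them act nilpotently; then [P] is zero by [perfect_nilpotent], [D] is
    solvable, and semisimplicity ends the proof. *)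
Theorem cartan_criterion (C : numClosedFieldType) (g : lieAlgType C) n
    (rho : {linear g -> 'M[C]_n}) (D : {vspace g}) :
    lie_semisimple g ->
    (forall x y, rho (lieb x y) = rho x *m rho y - rho y *m rho x) -> lie_ideal D ->
    (forall y, y \in D -> rho y = 0 -> y = 0) ->
    (forall x y, x \in D -> y \in D -> \tr (rho x *m rho y) = 0) ->
  D = 0%VS.
Proof.
move=> hg rho_lie iD rI tr0; case: n rho rho_lie rI tr0 => [|n] rho rho_lie rI tr0.
  apply/eqP; rewrite -subv0; apply/subvP => y yD; rewrite memv0; apply/eqP/rI => //.
  by apply/matrixP => -[].
have [m] := vspace_descending (fun m => derived_series_sub m iD).
set P := derived_series D m => PP.
have iP : lie_ideal P by apply: derived_series_ideal.
have PD : (P <= D)%VS.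
  rewrite /P; elim: m {P PP iP} => [|m IHm]; first exact: subvv.
  exact: subv_trans (derived_series_sub m iD) IHm.
suff P0 : P = 0%VS by apply: hg => //; exists m.
have rPI y : y \in P -> rho y = 0 -> y = 0 by move=> /(subvP PD); apply: rI.
apply: perfect_nilpotent => // x xP.
apply: (ad_nilpotent (k := n.+1) rho_lie iP rPI xP).
have [r [rP Ex]] : exists r : seq (g * g), (forall xy, xy \in r -> xy.1 \in P /\ xy.2 \in P) /\
    x = \sum_(xy <- r) lieb xy.1 xy.2 by apply: lieb_space_sum; rewrite -[lieb_space _ _]/(derived_series D m.+1) PP.
pose L (M : 'M[C]_n.+1) := exists2 y, y \in P & rho y = M.
have := @trace_nilpotent C n L [seq (rho xy.1, rho xy.2) | xy <- r].
have -> : \sum_(uv <- [seq (rho xy.1, rho xy.2) | xy <- r]) (uv.1 * uv.2 - uv.2 * uv.1) = rho x.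
  by rewrite Ex linear_sum big_map; apply: eq_bigr => xy _; rewrite rho_lie.
have Eit k : iter k (mulmx (rho x)) 1%:M = rho x ^+ k.
  by elim: k => //= k ->; rewrite exprS.
rewrite Eit; apply.
- split=> [|a _ _ [u uP <-] [v vP <-]]; first by exists 0; rewrite ?mem0v ?linear0.
  by exists (a *: u + v); rewrite ?linearP // memvD ?memvZ.
- by move=> _ _ [u uP <-] [v vP <-]; exists (lieb u v); rewrite ?iP.
- by move=> _ _ [u /(subvP PD) uP <-] [v /(subvP PD) vP <-]; apply: tr0.
- move=> _ /mapP[xy /rP[xP' yP'] ->] /=.
  by split; [exists xy.1|exists xy.2].
Qed.

(** * Casimir operators and invariant vectors *)

Section AdjointMatrix.
Variables (K : fieldType) (g : lieAlgType K).
Local Notation e := (vbasis {:g}).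
Local Notation N := (\dim {:g}).

Definition ad_mx (x : g) : 'M[K]_N := \matrix_(a, b) coord e a (lieb x e`_b).

Lemma ad_mx_linear : linear ad_mx.
Proof. by move=> c x y; apply/matrixP => a b; rewrite !mxE lieb_linearl linearP. Qed.

Definition ad_rep : {linear g -> 'M[K]_N} := mklin ad_mx_linear.

Lemma ad_mx_mul x y : ad_mx x *m ad_mx y = \matrix_(a, b) coord e a (lieb x (lieb y e`_b)).
Proof.
apply/matrixP => a b; rewrite !mxE {1}(coord_vbasis (memvf (lieb y e`_b))) lieb_sumr linear_sum.
by apply: eq_bigr => c _; rewrite !mxE liebZr linearZ mulrC.
Qed.

Lemma ad_rep_lie x y : ad_rep (lieb x y) = ad_rep x *m ad_rep y - ad_rep y *m ad_rep x.
Proof. by rewrite !ad_mx_mul; apply/matrixP => a b; rewrite !mxE lieb_der linearD addrK. Qed.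

Lemma ad_rep_eq0 x : ad_rep x = 0 -> forall y, lieb x y = 0.
Proof.
move=> x0 y; rewrite (coord_vbasis (memvf y)) lieb_sumr big1 // => b _.
rewrite liebZr (coord_vbasis (memvf (lieb x _))) big1 ?scaler0 // => a _.
by move/matrixP/(_ a b): x0; rewrite !mxE => ->; rewrite scale0r.
Qed.

End AdjointMatrix.

Lemma trace_lie_inv (K : fieldType) (g : lieAlgType K) n (rho : {linear g -> 'M[K]_n}) :
    (forall x y, rho (lieb x y) = rho x *m rho y - rho y *m rho x) ->
  forall z x y, \tr (rho (lieb z x) *m rho y) = - \tr (rho x *m rho (lieb z y)).
Proof.
move=> rho_lie z x y; rewrite !rho_lie mulmxBl mulmxBr.
have -> : \tr (rho z *m rho x *m rho y - rho x *m rho z *m rho y) =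
    \tr (rho x *m (rho y *m rho z)) - \tr (rho x *m (rho z *m rho y)).
  by rewrite raddfB /= -mulmxA mxtrace_mulC !mulmxA.
by rewrite raddfB /= opprB.
Qed.

Section Representation.
Variables (C : numClosedFieldType) (g : lieAlgType C).
Hypothesis hg : lie_semisimple g.
Variables (n : nat) (rho : {linear g -> 'M[C]_n}).
Hypothesis rho_lie : forall x y, rho (lieb x y) = rho x *m rho y - rho y *m rho x.

(** [I] is the orthogonal of the kernel for the Killing form. It meets the kernel trivially by
    Cartan's criterion for the adjoint representation, and a dimension count shows that the sum is
    everything. *)
Lemma ker_complement : exists I : {vspace g}, [/\ lie_ideal I,
  forall b, b \in I -> rho b = 0 -> b = 0 &
  forall x, exists a b, [/\ rho a = 0, b \in I & x = a + b]].
Proof.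
pose k := lker (linfun rho).
have kE x : (x \in k) = (rho x == 0) by rewrite memv_ker lfunE.
pose phi (x : g) : 'rV[C]_(\dim k) := \row_j \tr (ad_rep g x *m ad_rep g (vbasis k)`_j).
have phil : linear phi.
  by move=> a x y; apply/rowP => j; rewrite !mxE linearP mulmxDl -scalemxAl linearP.
pose I := lker (linfun (mklin phil)).
have IE x : x \in I <-> forall y, y \in k -> \tr (ad_rep g x *m ad_rep g y) = 0.
  rewrite memv_ker lfunE; split=> [/eqP/rowP px y yk|H].
    rewrite (coord_vbasis yk) linear_sum mulmx_sumr raddf_sum big1 // => j _.
    by rewrite linearZ /= -scalemxAr linearZ /=; have := px j; rewrite !mxE => ->; rewrite mulr0.
  by apply/eqP/rowP => j; rewrite !mxE H // vbasis_mem ?memt_nth.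
have ik : lie_ideal k.
  move=> x y; rewrite !kE rho_lie => /eqP ->.
  by rewrite mulmx0 mul0mx subrr.
have tr_inv z x y : \tr (ad_rep g (lieb z x) *m ad_rep g y) =
    - \tr (ad_rep g x *m ad_rep g (lieb z y)).
  exact: trace_lie_inv (@ad_rep_lie _ g) z x y.
have iI : lie_ideal I.
  move=> z x /IE xI; apply/IE => y yk; rewrite tr_inv xI ?oppr0 //.
  exact: ik.
have kI0 : (k :&: I)%VS = 0%VS.
  apply: (cartan_criterion hg (@ad_rep_lie _ g)).
  - move=> x y; rewrite !memv_cap => /andP[yk yI]; rewrite ik ?iI //.
  - move=> y _ /ad_rep_eq0; exact: semisimple_center.
  - by move=> x y; rewrite !memv_cap => /andP[_ /IE xI] /andP[yk _]; apply: xI.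
have full : (k + I)%VS = fullv.
  apply/eqP; rewrite eqEdim subvf /= dimv_disjoint_sum //.
  rewrite -(limg_ker_dim (linfun (mklin phil)) fullv) capfv addnC leq_add2r.
  by apply: leq_trans (dimvS (subvf _)) _; rewrite dimvf /dim /= mul1n.
exists I; split=> // [b bI rb|x].
  have : b \in (k :&: I)%VS by rewrite memv_cap kE rb eqxx.
  by rewrite kI0 memv0 => /eqP.
have : x \in (k + I)%VS by rewrite full memvf.
by move=> /memv_addP[a ak [b bI ->]]; exists a, b; split=> //; apply/eqP; rewrite -kE.
Qed.

(** The radical of the trace form on [I] is an ideal on which that form vanishes, so Cartan's
    criterion applies to it. *)
Lemma trace_form_nondeg (I : {vspace g}) : lie_ideal I ->
    (forall b, b \in I -> rho b = 0 -> b = 0) ->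
  forall s, s \in I -> (forall x, x \in I -> \tr (rho s *m rho x) = 0) -> s = 0.
Proof.
move=> iI rI s sI str.
have sP : submod (fun s => s \in I /\ forall x, x \in I -> \tr (rho s *m rho x) = 0).
  split=> [|a u v [uI ut] [vI vt]].
    by split=> [|x _]; rewrite ?mem0v // linear0 mul0mx raddf0.
  split=> [|x xI]; first by rewrite memvD ?memvZ.
  by rewrite linearP mulmxDl -scalemxAl linearP /= ut ?vt // mulr0 addr0.
have [S SP] := vspace_of sP; have : s \in S by apply/SP.
rewrite (cartan_criterion hg rho_lie (D := S)) ?memv0 => [/eqP //|z x|y /SP[yI _]|x y].
- move=> /SP[xI xt]; apply/SP; split=> [|y yI]; first exact: iI.
  by rewrite (trace_lie_inv rho_lie) xt ?oppr0 //; apply: iI.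
- exact: rI.
- by move=> /SP[_ xt] /SP[yI _]; apply: xt.
Qed.

(** The Casimir operator of the trace form on [I], with [H] the inverse of the Gram matrix. Its
    trace is the dimension of [I], nonzero because [rho] is nonzero, and it kills [p] since every
    summand ends with some [rho x]. *)
Lemma casimir : (exists x, rho x != 0) -> exists c : 'M[C]_n,
  [/\ forall x, rho x *m c = c *m rho x, \tr c != 0 &
      forall p : 'cV[C]_n, (forall x, rho x *m p = 0) -> c *m p = 0].
Proof.
move=> [x0 rx0]; have [I [iI rI gI]] := ker_complement.
pose e := vbasis I; pose d := \dim I.
have eI (j : 'I_d) : e`_j \in I by rewrite vbasis_mem ?memt_nth.
pose G := \matrix_(i < d, j < d) \tr (rho e`_i *m rho e`_j).
have Gu : G \in unitmx.
  rewrite -row_free_unit; apply/row_freeP; apply/row_freeP/inj_row_free => v vG.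
  pose s := \sum_i v 0 i *: e`_i.
  have se (j : 'I_d) : \tr (rho s *m rho e`_j) = 0.
    have /rowP/(_ j) := vG; rewrite !mxE => Ej; rewrite -[RHS]Ej.
    rewrite /s linear_sum mulmx_suml raddf_sum; apply: eq_bigr => i _.
    by rewrite linearZ /= -scalemxAl linearZ /= mxE.
  have s0 : s = 0.
    apply: (trace_form_nondeg iI rI) => [|x xI]; first by apply: memv_suml => i _; apply: memvZ.
    rewrite (coord_vbasis xI) [rho (\sum_(j < _) coord _ j x *: _)]linear_sum mulmx_sumr raddf_sum big1 // => j _.
    by rewrite linearZ /= -scalemxAr linearZ /= se mulr0.
  apply/rowP => i; rewrite mxE -(coord_sum_free (fun i => v 0 i) i (basis_free (vbasisP I))).
  by rewrite -[\sum_(_ < _) _]/s s0 linear0.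
pose H := invmx G.
exists (\sum_i \sum_j H i j *: (rho e`_i *m rho e`_j)); split.
- move=> x; apply/eqP; rewrite -subr_eq0; apply/eqP.
  pose M := \matrix_(i < d, a < d) coord e a (lieb x e`_i).
  have xe (i : 'I_d) : rho (lieb x e`_i) = \sum_a M i a *: rho e`_a.
    have -> : lieb x e`_i = \sum_a M i a *: e`_a.
      rewrite {1}(coord_vbasis (iI x _ (eI i))); apply: eq_bigr => a _.
      by rewrite mxE.
    by rewrite linear_sum; apply: eq_bigr => a _; rewrite linearZ.
  (* Invariance of the trace form under [x]. Multiplying by [H] on both sides turns it into [HM],
     which is the commutation of the Casimir operator with [rho x]. *)
  have MG : M *m G + G *m M^T = 0.
    apply/matrixP => i j; rewrite !mxE.
    transitivity (\tr (rho (lieb x e`_i) *m rho e`_j) + \tr (rho e`_i *m rho (lieb x e`_j))).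
      rewrite !xe mulmx_suml mulmx_sumr !raddf_sum /=.
      congr (_ + _); apply: eq_bigr => a _; rewrite !mxE.
        by rewrite -scalemxAl linearZ.
      by rewrite -scalemxAr linearZ /= mulrC.
    by rewrite (trace_lie_inv rho_lie) addNr.
  have HM : M^T *m H + H *m M = 0.
    have := congr1 (fun X => H *m X *m H) MG; rewrite mulmx0 mul0mx mulmxDr mulmxDl.
    by rewrite -!mulmxA mulmxV // mulmx1 !mulmxA mulVmx // mul1mx addrC.
  transitivity (\sum_a \sum_b (M^T *m H + H *m M) a b *: (rho e`_a *m rho e`_b)); last first.
    by rewrite HM big1 // => a _; rewrite big1 // => b _; rewrite mxE scale0r.
  rewrite mulmx_sumr mulmx_suml -sumrB.
  transitivity (\sum_i \sum_j H i j *: (rho (lieb x e`_i) *m rho e`_j) +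
      \sum_i \sum_j H i j *: (rho e`_i *m rho (lieb x e`_j))).
    rewrite -big_split; apply: eq_bigr => i _; rewrite mulmx_sumr mulmx_suml -sumrB -big_split.
    apply: eq_bigr => j _ /=; rewrite -scalemxAr -scalemxAl -scalerBr -scalerDr; congr (_ *: _).
    by rewrite !rho_lie mulmxBl mulmxBr !mulmxA addrA subrK.
  under [RHS]eq_bigr do under eq_bigr do rewrite mxE scalerDl.
  under [RHS]eq_bigr do rewrite big_split.
  rewrite big_split /=; congr (_ + _).
    transitivity (\sum_i \sum_j \sum_a (M^T a i * H i j) *: (rho e`_a *m rho e`_j)).
      apply: eq_bigr => i _; apply: eq_bigr => j _; rewrite xe mulmx_suml scaler_sumr.
      by apply: eq_bigr => a _; rewrite -scalemxAl scalerA [M^T _ _]mxE mulrC.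
    transitivity (\sum_i \sum_a \sum_j (M^T a i * H i j) *: (rho e`_a *m rho e`_j)).
      by apply: eq_bigr => i _; apply: exchange_big.
    rewrite exchange_big; apply: eq_bigr => a _; rewrite exchange_big; apply: eq_bigr => j _.
    by rewrite [(_ *m _) a j]mxE scaler_suml.
  transitivity (\sum_i \sum_j \sum_a (H i j * M j a) *: (rho e`_i *m rho e`_a)).
    apply: eq_bigr => i _; apply: eq_bigr => j _; rewrite xe mulmx_sumr scaler_sumr.
    by apply: eq_bigr => a _; rewrite -scalemxAr scalerA.
  apply: eq_bigr => i _; rewrite exchange_big; apply: eq_bigr => a _.
  by rewrite [(_ *m _) i a]mxE scaler_suml.
- have -> : \tr (\sum_i \sum_j H i j *: (rho e`_i *m rho e`_j)) = \tr (H *m G).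
    rewrite raddf_sum; apply: eq_bigr => i _; rewrite [RHS]mxE [LHS]raddf_sum.
    by apply: eq_bigr => j _; rewrite [LHS]linearZ /= [G _ _]mxE mxtrace_mulC.
  rewrite mulVmx // mxtrace1 pnatr_eq0 /d dimv_eq0; apply: contra rx0 => /eqP I0.
  have [a [b [ra bI ->]]] := gI x0; rewrite linearD ra add0r.
  by move: bI; rewrite I0 memv0 => /eqP ->; rewrite linear0.
- move=> p rp; rewrite mulmx_suml big1 // => i _; rewrite mulmx_suml big1 // => j _.
  by rewrite -scalemxAl -mulmxA rp mulmx0 scaler0.
Qed.

End Representation.

Lemma mx_fitting (K : fieldType) n (c : 'M[K]_n) : exists2 k, (0 < k)%N &
  forall u : 'rV_n, u *m iter k (mulmx c) 1%:M *m iter k (mulmx c) 1%:M = 0 ->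
    u *m iter k (mulmx c) 1%:M = 0.
Proof.
have fl : linear (fun u : 'rV[K]_n => u *m c).
  by move=> a u v; rewrite mulmxDl -scalemxAl.
have cC j : iter j (mulmx c) 1%:M *m c = c *m iter j (mulmx c) 1%:M.
  by elim: j => [|j IHj] /=; rewrite ?mul1mx ?mulmx1 // -mulmxA IHj.
have itE j (u : 'rV_n) : u *m iter j (mulmx c) 1%:M = iter j (mklin fl) u.
  elim: j => [|j IHj]; first by rewrite mulmx1.
  by rewrite !iterS -IHj /= -mulmxA cC.
have nV : noeth 'rV[K]_n.
  by move=> P sP; apply: (noeth_sub_span (@field_noeth K) sP (fun v _ => vect_lspan v)).
have [k fk] := fitting (mklin fl) nV.
(* One more than Fitting's exponent, which makes the exponent positive. *)
exists k.+1 => // u; rewrite !itE -iterD => /fk E.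
by rewrite iterS E (linear0 (mklin fl)).
Qed.

Lemma mxtrace_nilpotent (C : numClosedFieldType) n (c : 'M[C]_n) k :
  iter k (mulmx c) 1%:M = 0 -> \tr c = 0.
Proof.
case: n c => [|n] c ck; first by rewrite /mxtrace big_ord0.
have Eit j : iter j (mulmx c) 1%:M = c ^+ j by elim: j => //= j ->; rewrite exprS.
have [P Pu] := Schur c isT; rewrite /similar_to => Tt.
have Pun : P \in unitmx by apply: unitarymx_unit.
set T := conjmx P c in Tt.
have ET : T = P *m c *m invmx P by rewrite /T conjumx.
have -> : \tr c = \tr T by rewrite ET mxtrace_mulC mulKmx.
have Tk : horner_mx T ('X ^+ k) = 0.
  rewrite ET horner_mx_uconj // rmorphXn /= horner_mx_X -Eit ck.
  by rewrite mulmx0 mul0mx.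
apply: big1 => i _; have [_ /(_ i)] := trig_horner ('X ^+ k) Tt.
rewrite Tk mxE hornerXn => /esym/eqP; rewrite expf_eq0 => /andP[_ /eqP //].
Qed.

(** A consequence of complete reducibility, by induction on the dimension. If [rho] is nonzero, row
    vectors split into the kernel and the range of a power of the Casimir operator [c]. Since [c]
    kills [p], pairing with [p] vanishes on the range, so it is nonzero on the kernel. This is a
    smaller representation because [c], having nonzero trace, is not nilpotent. *)
Theorem invariant_functional (C : numClosedFieldType) (g : lieAlgType C) n
    (rho : {linear g -> 'M[C]_n}) (p : 'cV[C]_n) :
    lie_semisimple g ->
    (forall x y, rho (lieb x y) = rho x *m rho y - rho y *m rho x) ->
    p != 0 -> (forall x, rho x *m p = 0) ->
  exists w : 'rV[C]_n, (forall x, w *m rho x = 0) /\ w *m p != 0.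
Proof.
move=> hg; have [m] := ubnP n; elim: m n rho p => // m IHm n rho p nm rho_lie p0 rp.
have [nz|allz] := pselect (exists x, rho x != 0); last first.
  have /matrix0Pn[i [j pij]] := p0.
  exists (delta_mx 0 i); split=> [x|].
    suff -> : rho x = 0 by rewrite mulmx0.
    by apply/eqP; apply: contrapT => /negP nx; apply: allz; exists x.
  apply: contraNneq pij => /matrixP/(_ 0 j); rewrite -rowE !mxE => ->.
  by rewrite eqxx.
have [c [cC ctr cp]] := casimir hg rho_lie nz.
have [k k0 fk] := mx_fitting c.
pose A := iter k (mulmx c) 1%:M; pose E := kermx A; pose b := row_base E.
have bA : b *m A = 0 by apply/sub_kermxP; rewrite eq_row_base.
have A0 : A != 0 by apply: contra_neq ctr; apply: mxtrace_nilpotent.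
have rE : (\rank E < n)%N.
  rewrite mxrank_ker ltn_subrL lt0n mxrank_eq0 A0 /=.
  by case: (n) (A) A0 => // B; rewrite flatmx0 eqxx.
have AC x : rho x *m A = A *m rho x.
  rewrite /A; elim: (k) => [|j IHj]; first by rewrite /= mulmx1 mul1mx.
  by rewrite /= mulmxA cC -mulmxA IHj mulmxA.
have Est x : (b *m rho x <= b)%MS.
  by rewrite eq_row_base; apply/sub_kermxP; rewrite -mulmxA AC mulmxA bA mul0mx.
have bfree : row_free b := row_base_free E.
pose rho' x := b *m rho x *m pinvmx b.
have rho'E x : rho' x *m b = b *m rho x by rewrite mulmxKpV.
have rho'l : linear rho'.
  by move=> a x y; rewrite /rho' linearP mulmxDr mulmxDl -scalemxAr -scalemxAl.
have Ap : A *m p = 0.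
  rewrite /A -(prednK k0); elim: k.-1 => [|j IHj]; first by rewrite /= mulmx1 cp.
  by rewrite iterS -mulmxA IHj mulmx0.
have pb : b *m p != 0.
  have EA : (E :&: A = 0)%MS.
    apply/eqP; rewrite -submx0; apply/rV_subP => u; rewrite sub_capmx => /andP[uE /submxP[y Ey]].
    by rewrite submx0 Ey fk // -Ey; apply/sub_kermxP.
  have full : (1%:M <= E + A)%MS.
    by rewrite sub1mx /row_full mxrank_disjoint_sum // mxrank_ker subnK // rank_leq_row.
  have /sub_addsmxP[[u v] /= E1] := full.
  apply: contraNneq p0 => bp; rewrite -[p]mul1mx E1 mulmxDl -[v *m A *m p]mulmxA Ap mulmx0 addr0.
  have : (u *m E <= b)%MS by rewrite eq_row_base submxMl.
  by move=> /submxP[w ->]; rewrite -mulmxA bp mulmx0.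
have [||||w [wr wp]] := IHm _ (mklin rho'l) (b *m p).
- exact: leq_trans rE nm.
- move=> x y; apply: (row_free_inj bfree).
  have bE u v : rho' u *m rho' v *m b = b *m rho u *m rho v.
    by rewrite -mulmxA rho'E mulmxA rho'E.
  transitivity (rho' (lieb x y) *m b) => //.
  transitivity (rho' x *m rho' y *m b - rho' y *m rho' x *m b); last by rewrite -mulmxBl.
  by rewrite !bE rho'E rho_lie mulmxBr !mulmxA.
- by [].
- move=> x; transitivity (rho' x *m (b *m p)) => //.
  by rewrite mulmxA rho'E -mulmxA rp mulmx0.
exists (w *m b); split=> [x|]; last by rewrite -mulmxA.
rewrite -mulmxA -rho'E mulmxA.
by have := wr x; rewrite /= => ->; rewrite mul0mx.
Qed.

Lemma fd_basis (K : fieldType) (V : lmodType K) (P : V -> Prop) (s : seq V) :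
    submod P -> (forall v, P v -> lspan s v) ->
  exists m (b : 'I_m -> V), [/\ forall j, P (b j),
    forall v, P v -> exists c : 'I_m -> K, v = \sum_j c j *: b j &
    forall c : 'I_m -> K, \sum_j c j *: b j = 0 -> forall j, c j = 0].
Proof.
move=> sP Ps; have [t [tP Pt]] := noeth_sub_span (@field_noeth K) sP Ps.
have [m] := ubnP (size t); elim: m t tP Pt {s Ps} => // m IHm t tP Pt tm.
have [[c [c0 [j cj]]]|free_t] := pselect (exists c : 'I_(size t) -> K,
    \sum_j c j *: t`_j = 0 /\ exists j, c j != 0); last first.
  exists (size t), (fun j => t`_j); split=> [j|v /Pt/lspanP //|c c0 j].
    by apply: tP; apply: mem_nth.
  by apply/eqP; apply: contrapT => /negP cj; apply: free_t; exists c; split=> //; exists j.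
pose t' := [seq t`_(val k) | k <- enum 'I_(size t) & k != j].
have t't v : v \in t' -> v \in t by case/mapP => k _ ->; apply: mem_nth; apply: ltn_ord.
have tj (k : 'I_(size t)) : k != j -> lspan t' t`_k.
  by move=> kj; apply: lspan_mem; apply/mapP; exists k; rewrite // mem_filter kj mem_enum.
apply: (IHm t') => [v /t't /tP //|v /Pt/lspanP[d ->]|].
  have sL := lspan_submod t'; apply: (submod_sum sL) => k; apply: (submodZ sL).
  have [->|/tj //] := eqVneq k j.
  have Ej : t`_j = - ((c j)^-1 *: \sum_(k | k != j) c k *: t`_k).
    rewrite -[t`_j]scale1r -(mulVf cj) -scalerA -scalerN; congr (_ *: _).
    by move: c0; rewrite (bigD1 j) //= => /eqP; rewrite addr_eq0 => /eqP.
  rewrite Ej; apply: (submodN sL); apply: (submodZ sL).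
  elim/big_rec: _ => [|k' y k'j Ly]; first by case: sL.
  by apply: (submodD sL) => //; apply: (submodZ sL); apply: tj.
have : size t' = (size t).-1.
  rewrite size_map -(@rem_filter _ j) ?enum_uniq // size_rem ?mem_enum // size_enum_ord //.
by move=> ->; rewrite prednK; [rewrite -ltnS|apply: leq_ltn_trans (ltn_ord j)].
Qed.

(** * The center of U(g) is Noetherian and acts through finite-dimensional algebras *)

Lemma double_commutator (V : zmodType) (a b c d e f : V) :
  a - b - (c - d) = a - e - (f - d) - (b - f - (e - c)).
Proof.
rewrite !opprB [RHS]addrACA.
have E u v w : u - v + (v - w) = u - w :> V by rewrite addrA subrK.
by rewrite !E [LHS]addrACA [RHS]addrACA [- b - c]addrC.
Qed.

Section Reynolds.
Variables (C : numClosedFieldType) (g : lieAlgType C) (U : algType C) (i : {linear g -> U}).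
Hypothesis hg : lie_semisimple g.
Hypothesis hU : universal_enveloping i.

Local Notation e := (vbasis {:g}).
Local Notation x := (env_letter i e).
Local Notation n := (\dim {:g}).

Fixpoint short_words k : seq (seq 'I_n) :=
  if k is k'.+1 then [::] :: [seq a :: w | a <- enum 'I_n, w <- short_words k'] else [::].

Lemma mem_short_words k w : (size w < k)%N -> w \in short_words k.
Proof.
elim: k w => // k IHk [|a w] wk; first exact: mem_head.
by rewrite inE; apply/allpairsP; exists (a, w); rewrite /= mem_enum IHk.
Qed.

(** Bracketing with [y] is a derivation sending letters to combinations of letters, so it preserves
    the length filtration. *)
Lemma shorter_ad k y u : shorter x k u -> shorter x k (i y * u - u * i y).
Proof.
have adS k' : @submod C U (fun u => shorter x k' (i y * u - u * i y)).
  have sW := wspan_submod x (fun w => size w < k')%N.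
  split=> [|c v w vs ws]; first by rewrite mulr0 mul0r subrr; case: sW.
  rewrite mulrDr mulrDl -scalerAr -scalerAl opprD addrACA -scalerBr.
  exact: sW.2.
elim: k u => [|k IHk] u us; apply: (wspan_min (adS _)) us => // w wk.
have sW := wspan_submod x (fun w => size w < k.+1)%N.
case: w wk => [|a w] wk.
  by rewrite wmon_nil mulr1 mul1r subrr; case: sW.
have -> : i y * wmon x (a :: w) - wmon x (a :: w) * i y =
    i (lieb y e`_a) * wmon x w + x a * (i y * wmon x w - wmon x w * i y).
  by rewrite hU.1 wmon_cons mulrBl mulrBr !mulrA addrA subrK.
apply: (submodD sW).
  rewrite (env_letter_sum i (vbasisP _)) mulr_suml; apply: (submod_sum sW) => l.
  rewrite -scalerAl; apply: (submodZ sW); rewrite -wmon_cons.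
  exact: wspan_mem.
apply: shorter_mull; apply: IHk; exact: wspan_mem.
Qed.

Lemma shorter_ex u : exists k, shorter x k u.
Proof.
have [s [_ su]] := wspan_full (env_letter_gen hU (vbasisP _)) u.
exists (\max_(w <- s) size w).+1; exists s; split=> // w ws.
by rewrite ltnS; apply: leq_bigmax_seq.
Qed.

Lemma central_gen u : (forall y, i y * u = u * i y) -> central u.
Proof.
move=> uC v; elim: (env_gen hU v) => {v} [_ [y ->]|c|v w _ vC _ wC|v w _ vC _ wC].
- by rewrite uC.
- by rewrite mulr_algr mulr_algl.
- by rewrite mulrDr mulrDl vC wC.
- by rewrite mulrA vC -mulrA wC mulrA.
Qed.

(** Tuples [f] of bounded length whose sum [pi f] is a multiple of [t] form a finite-dimensional
    representation under brackets, with [pi] an invariant functional that is nonzero at [u]. By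
    [invariant_functional], some invariant tuple has nonzero image; its entries are central, and
    rescaling gives [t]. *)
Lemma reynolds r (z u : 'I_r -> U) (t : U) :
    (forall k, central (z k)) -> central t -> t = \sum_k u k * z k ->
  exists2 v : 'I_r -> U, forall k, central (v k) & t = \sum_k v k * z k.
Proof.
move=> zC tC Et; have [t0|t0] := eqVneq t 0.
  exists (fun=> 0) => [k w|]; first by rewrite mul0r mulr0.
  by rewrite big1 // => k _; rewrite mul0r.
pose V : lmodType C := {ffun 'I_r -> U}; pose pi (f : V) := \sum_k f k * z k.
have piP c (f h : V) : pi (c *: f + h) = c *: pi f + pi h.
  rewrite /pi scaler_sumr -big_split; apply: eq_bigr => k _ /=.
  by rewrite !ffunE mulrDl scalerAl.
have [N uN] : exists N, forall k, shorter x N (u k).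
  have [N Nk] : exists N : 'I_r -> nat, forall k, True -> shorter x (N k) (u k).
    by apply: (@choice_on _ _ 0%N (fun _ => True) (fun k N => shorter x N (u k))) => k _; apply: shorter_ex.
  by exists (\max_k N k) => k; apply: shorter_leq (Nk k I); apply: leq_bigmax.
pose P (f : V) := (forall k, shorter x N (f k)) /\ exists c, pi f = c *: t.
have sS := wspan_submod x (fun w => size w < N)%N.
have sP : submod P.
  split=> [|c f h [fN [cf Ef]] [hN [ch Eh]]].
    split=> [k|]; first by have [S0 _] := sS; have -> : (0 : V) k = 0 by rewrite ffunE.
    by exists 0; rewrite /pi scale0r big1 // => k _; rewrite ffunE mul0r.
  split=> [k|].
    have -> : (c *: f + h) k = c *: f k + h k by rewrite !ffunE.
    exact: (sS.2 c _ _ (fN k) (hN k)).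
  by exists (c * cf + ch); rewrite piP Ef Eh scalerDl scalerA.
pose dl k (v : U) : V := [ffun j => if j == k then v else 0].
have dlL k : linear (dl k).
  move=> c v w; apply/ffunP => j; rewrite !ffunE.
  by case: eqP => _; rewrite ?scaler0 ?addr0.
pose s := flatten [seq [seq dl k (wmon x w) | w <- short_words N] | k <- enum 'I_r].
have Ps f : P f -> lspan s f.
  move=> [fN _]; have sL := lspan_submod s.
  have -> : f = \sum_k dl k (f k).
    apply/ffunP => j; rewrite sum_ffunE (bigD1 j) //= ffunE eqxx big1 ?addr0 // => k kj.
    by rewrite ffunE eq_sym (negbTE kj).
  apply: (submod_sum sL) => k.
  apply: (@wspan_min _ _ _ x (fun w => size w < N)%N (fun v => lspan s (dl k v))) => [|w wN|]; last exact: fN.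
    split=> [|c v w vs ws]; last by rewrite dlL; apply: sL.2.
    have -> : dl k 0 = 0 by apply: (linear0 (mklin (dlL k))).
    by case: sL.
  apply: lspan_mem; apply/flattenP; exists [seq dl k (wmon x w) | w <- short_words N].
    by apply: map_f; rewrite mem_enum.
  by apply: map_f; apply: mem_short_words.
have [m [b [bP Pb b0]]] := fd_basis sP Ps.
pose act y (f : V) : V := [ffun k => i y * f k - f k * i y].
have actL y : linear (act y).
  move=> c f h; apply/ffunP => k; rewrite !ffunE mulrDr mulrDl -scalerAr -scalerAl.
  by rewrite opprD addrACA scalerBr.
have actS y I0 (c : 'I_I0 -> C) (f : 'I_I0 -> V) :
    act y (\sum_j c j *: f j) = \sum_j c j *: act y (f j).
  rewrite [LHS](linear_sum (mklin (actL y))); apply: eq_bigr => j _.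
  exact: (linearZ_LR (mklin (actL y))).
have pi_act y f c : pi f = c *: t -> pi (act y f) = 0.
  move=> Ef; transitivity (i y * pi f - pi f * i y).
    rewrite mulr_sumr mulr_suml -sumrB; apply: eq_bigr => k _.
    by rewrite ffunE mulrBl -!mulrA zC !mulrA.
  by rewrite Ef -scalerAr -scalerAl tC subrr.
have actP y f : P f -> P (act y f).
  move=> [fN [c Ef]]; split=> [k|]; first by rewrite ffunE; apply: shorter_ad.
  by exists 0; rewrite scale0r (pi_act y f c).
have [D DP] : exists D : g * 'I_m -> 'I_m -> C, forall yj, True ->
    act yj.1 (b yj.2) = \sum_l D yj l *: b l.
  by apply: (@choice_on _ _ (fun=> 0) (fun _ => True)
    (fun yj d => act yj.1 (b yj.2) = \sum_l d l *: b l)) => yj _; apply/Pb/actP.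
have buniq c d : \sum_j c j *: b j = \sum_j d j *: b j -> c =1 d.
  move=> E j; apply/eqP; rewrite -subr_eq0; apply/eqP; apply: (b0 (fun j => c j - d j)).
  by under eq_bigr do rewrite scalerBl; rewrite sumrB E subrr.
(* Coefficients of iterated brackets multiply in reversed order ([act2]); the sign turns this
   antirepresentation into a representation. *)
pose rho0 y : 'M[C]_m := \matrix_(j, l) - D (y, j) l.
have rho0L : linear rho0.
  move=> c y y'; apply/matrixP => j l; rewrite !mxE mulrN -opprD; congr (- _).
  apply: (buniq (D (c *: y + y', j)) (fun l => c * D (y, j) l + D (y', j) l)).
  rewrite -(DP (_, j) I) /=.
  under eq_bigr do rewrite scalerDl -scalerA.
  rewrite big_split -scaler_sumr /= -(DP (y, j) I) -(DP (y', j) I) /=.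
  apply/ffunP => k; rewrite !ffunE linearP mulrDl mulrDr -scalerAr -scalerAl.
  by rewrite opprD addrACA scalerBr.
pose rho : {linear g -> 'M[C]_m} := mklin rho0L.
have rhoE y j l : rho y j l = - D (y, j) l by rewrite [LHS]mxE.
have act2 y y' j : act y (act y' (b j)) = \sum_l (rho y' *m rho y) j l *: b l.
  rewrite (DP (y', j) I) actS /=.
  transitivity (\sum_l \sum_h (D (y', j) l * D (y, l) h) *: b h).
    apply: eq_bigr => l _; rewrite (DP (y, l) I) scaler_sumr /=.
    by apply: eq_bigr => h _; rewrite scalerA.
  rewrite exchange_big; apply: eq_bigr => h _; rewrite mxE scaler_suml.
  by apply: eq_bigr => l _; rewrite !rhoE mulrNN.
have rho_lie y y' : rho (lieb y y') = rho y *m rho y' - rho y' *m rho y.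
  apply/matrixP => j l; rewrite rhoE; apply/eqP; rewrite eqr_oppLR; apply/eqP.
  apply: (buniq (D (lieb y y', j)) (fun l => - (rho y *m rho y' - rho y' *m rho y) j l)).
  rewrite -(DP (_, j) I) /=.
  transitivity (act y (act y' (b j)) - act y' (act y (b j))).
    apply/ffunP => k; rewrite !ffunE hU.1.
    by rewrite !mulrBr !mulrBl !mulrA; apply: double_commutator.
  rewrite !act2 -sumrB; apply: eq_bigr => h _; rewrite -scalerBl; congr (_ *: _).
  have subE (M1 M2 : 'M[C]_m) : (M1 - M2) j h = M1 j h - M2 j h by rewrite !mxE.
  by rewrite subE opprB.
have [p pP] : exists p : 'I_m -> C, forall j, True -> pi (b j) = p j *: t.
  by apply: (@choice_on _ _ 0 (fun _ => True) (fun j c => pi (b j) = c *: t)) => j _; have [_] := bP j.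
have piS c : pi (\sum_j c j *: b j) = (\sum_j c j * p j) *: t.
  elim/big_rec2: _ => [|j v f _ IH]; last by rewrite piP IH pP // scalerDl scalerA.
  by rewrite /pi scale0r big1 // => k _; rewrite ffunE mul0r.
have tI c : c *: t = 0 -> c = 0.
  by move=> /eqP; rewrite scaler_eq0 (negbTE t0) orbF => /eqP.
pose pc : 'cV[C]_m := \col_j p j.
have [||w [wr wp]] := invariant_functional (rho := rho) (p := pc) hg rho_lie.
- have [|c Eu] := Pb [ffun k => u k].
    split=> [k|]; first by rewrite ffunE.
    by exists 1; rewrite scale1r Et; apply: eq_bigr => k _; rewrite ffunE.
  have : pi [ffun k => u k] = t by rewrite Et; apply: eq_bigr => k _; rewrite ffunE.
  rewrite Eu piS => Ept; apply: contraNneq t0 => /matrixP pc0.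
  rewrite -Ept big1 ?scale0r // => j _; have := pc0 j 0; rewrite !mxE => ->.
  by rewrite mulr0.
- move=> y; apply/matrixP => j k; rewrite ord1 [LHS]mxE [RHS]mxE; apply: tI.
  have [_ [c Ec]] := bP j; have := pi_act y _ _ Ec; rewrite (DP (y, j) I) piS.
  move=> E; rewrite -[RHS]oppr0 -E -scaleNr; congr (_ *: _).
  rewrite -sumrN; apply: eq_bigr => l _.
  by rewrite rhoE mxE mulNr.
pose f : V := \sum_j w 0 j *: b j.
have fC y : act y f = 0.
  rewrite /f actS; transitivity (\sum_j \sum_l (w 0 j * D (y, j) l) *: b l).
    apply: eq_bigr => j _; rewrite (DP (y, j) I) scaler_sumr.
    by apply: eq_bigr => l _; rewrite scalerA.
  rewrite exchange_big big1 // => l _; rewrite -scaler_suml.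
  suff -> : \sum_j w 0 j * D (y, j) l = 0 by rewrite scale0r.
  have /rowP/(_ l) := wr y; rewrite !mxE => /eqP; rewrite -oppr_eq0 -sumrN => /eqP E.
  by rewrite -[RHS]E; apply: eq_bigr => j _; rewrite rhoE mulrN opprK.
pose a := (w *m pc) 0 0.
have a0 : a != 0.
  by apply: contraNneq wp => E; apply/eqP/matrixP => j k; rewrite !ord1 [RHS]mxE.
have pif : pi f = a *: t.
  by rewrite piS /a mxE; congr (_ *: _); apply: eq_bigr => j _; rewrite mxE.
exists (fun k => a^-1 *: f k) => [k|].
  apply: central_gen => y; have /ffunP/(_ k) := fC y; rewrite !ffunE => /eqP.
  by rewrite subr_eq0 -scalerAr -scalerAl => /eqP ->.
transitivity (a^-1 *: pi f); first by rewrite pif scalerA mulVf // scale1r.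
by rewrite scaler_sumr; apply: eq_bigr => k _; rewrite scalerAl.
Qed.

End Reynolds.

(** Noetherian induction: a maximal ideal [J] among those of infinite codimension containing [J0]
    would admit zero divisors modulo [J], and two strictly larger ideals of finite codimension would
    then force finite codimension on [J]. *)
Lemma commutative_cofinite (K : closedFieldType) (Z : algType K) (J0 : Z -> Prop) :
    (forall x y : Z, x * y = y * x) -> noeth (Z : pzRingType)^o ->
    @submod Z (Z : pzRingType)^o J0 ->
    (forall z : Z, exists2 p : {poly K}, p != 0 & J0 (horner_alg z p)) ->
  cofinite J0.
Proof.
move=> ZC nZ sJ0 alg; apply: contrapT => nJ0.
pose F J := [/\ @submod Z (Z : pzRingType)^o J, forall x, J0 x -> J x & ~ cofinite J].
have [J [sJ J0J nJ] Jmax] := @noeth_max _ _ F J0 nZ (fun J FJ => let: And3 s _ _ := FJ in s)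
  (And3 sJ0 (fun _ H => H) nJ0).
have cof (J' : Z -> Prop) a : @submod Z (Z : pzRingType)^o J' -> (forall x, J x -> J' x) ->
    J' a -> ~ J a -> cofinite J'.
  move=> sJ' JJ' J'a nJa; apply: contrapT => nJ'; apply: nJa.
  by apply: (Jmax J') => //; split=> // x /J0J/JJ'.
(* Otherwise [1] would span the algebra modulo [J]. *)
have [z nz] : exists z, forall c : K, ~ J (z - c%:A).
  apply: contrapT => nz; apply: nJ; exists [:: 1] => b.
  apply: contrapT => nb; apply: nz; exists b => c Jc; apply: nb; exists c%:A => //.
  exact: (submodZ (lspan_submod _) c (lspan_head _ _)).
(* Linear factors are split off a polynomial in [z] lying in [J]. No linear factor lies in [J], and
   a nonzero constant cannot either, so at some stage a product lies in [J] while both factors do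
   not. *)
have [a [b [na nb Jab]]] : exists a b, [/\ ~ J a, ~ J b & J (a * b)].
  have [p p0 /J0J Jp] := alg z; have [m] := ubnP (size p).
  elim: m p p0 Jp => // m IHm p p0 Jp pm.
  have [sp1|sp1] := eqVneq (size p) 1.
    have /size_poly1P[c c0 Ep] := introT eqP sp1; case: (nz 0).
    rewrite scale0r subr0; move: Jp; rewrite Ep horner_algC => Jc.
    have -> : z = (c^-1 *: z) * c%:A by rewrite mulr_algr scalerA mulfV // scale1r.
    exact: (submodZ sJ (c^-1 *: z) Jc).
  have [c rc] := closed_rootP p sp1; have [q Ep] := factor_theorem p c rc.
  have q0 : q != 0 by apply: contraNneq p0 => q0; rewrite Ep q0 mul0r.
  have Jq : J (horner_alg z q * (z - c%:A)).
    by move: Jp; rewrite Ep rmorphM rmorphB /= horner_algX horner_algC.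
  have [Jqz|nq] := pselect (J (horner_alg z q)); last first.
    by exists (horner_alg z q), (z - c%:A).
  apply: (IHm q) => //; move: pm; rewrite Ep size_mul ?polyXsubC_eq0 // size_XsubC.
  by rewrite addn2.
(* The ideal generated by [J] and [a], and below it the ideal of those [w] with [w * a] in [J], are
   both larger than [J]. Multiplication by [a] transports the finite codimension of the second
   one. *)
have [t1 Ht1] : cofinite (fun x => exists w, J (x - w * a)).
  apply: (cof _ a) => //; last by exists 1; rewrite mul1r subrr; case: sJ.
    split=> [|c x y [w Jw] [w' Jw']]; first by exists 0; rewrite mul0r subrr; case: sJ.
    exists (c * w + w'); have := sJ.2 c _ _ Jw Jw'.
    by rewrite scalerBr addrACA -opprD mulrDl -mulrA.
  by move=> x Jx; exists 0; rewrite mul0r subr0.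
have [t2 Ht2] : cofinite (fun w => J (w * a)).
  apply: (cof _ b) => //; last by rewrite ZC.
    split=> [|c x y Jx Jy]; first by rewrite mul0r; case: sJ.
    by rewrite mulrDl -mulrA; apply: sJ.2.
  by move=> x Jx; rewrite ZC; apply: (submodZ sJ a Jx).
apply: nJ; exists (t1 ++ [seq u * a | u <- t2]) => x.
have [c1 tc1 [w Jw]] := Ht1 x; have [c2 tc2 Jc2] := Ht2 w.
have ml : linear (fun u : Z => u * a) by move=> c u v; rewrite mulrDl scalerAl.
have sL := @lspan_submod K Z (t1 ++ [seq u * a | u <- t2]).
exists (c1 + c2 * a).
  apply: (submodD sL); first exact: lspan_catl.
  by apply: lspan_catr; apply: (lspan_map (mklin ml)).
have -> : x - (c1 + c2 * a) = (x - c1 - w * a) + (w - c2) * a.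
  by rewrite mulrBl opprD !addrA subrK.
exact: (submodD sJ).
Qed.

Lemma lspan_kres (K : fieldType) (A B : algType K) (f : {lrmorphism B -> A}) (X : lmodType A)
    (s : seq X) (y : X) :
  @lspan K (kmod (res f X)) s y <-> @lspan K (kmod X) s y.
Proof.
have E a (x : X) : (a *: (x : kmod (res f X)) : X) = a *: (x : kmod X).
  by transitivity (f a%:A *: x) => //; rewrite linearZ_LR rmorph1.
elim: s y => [|x s IHs] y //=; split=> -[a sa]; exists a.
  by move/IHs: sa; rewrite E.
by apply/IHs; rewrite E.
Qed.

Lemma lspan_scale (K : fieldType) (A : algType K) (X : lmodType A) (t : seq A) (s : seq X) c y :
  @lspan K A t c -> @lspan K (kmod X) s y ->
  @lspan K (kmod X) [seq u *: v | u <- t, v <- s] (c *: y).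
Proof.
move=> tc sy; have sL := @lspan_submod K (kmod X) [seq u *: v | u <- t, v <- s].
apply: (@lspan_min K A t (fun c => @lspan K (kmod X) _ (c *: y))) tc => [|u ut].
  split=> [|a u v Lu Lv]; first by rewrite scale0r; case: sL.
  by rewrite scalerDl -mulr_algl -scalerA; apply: sL.2.
apply: (@lspan_min K (kmod X) s (fun y => @lspan K (kmod X) _ (u *: (y : X)))) sy => [|v vs].
  split=> [|a v w Lv Lw]; first by rewrite scaler0; case: sL.
  by rewrite scalerDr kmodE scalerA mulr_algr -mulr_algl -scalerA; apply: sL.2.
by apply: lspan_mem; apply/allpairsP; exists (u, v).
Qed.

Section Center.
Variables (C : numClosedFieldType) (g : lieAlgType C) (U : algType C) (i : {linear g -> U}).
Hypothesis hg : lie_semisimple g.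
Hypothesis hU : universal_enveloping i.

Definition center_alg := subalg (@central C U).
Local Notation Z := center_alg.

Lemma center_central (z : Z) : central (val z).
Proof.
rewrite -subalg_inclE; elim: (subalg_incl_gen z) => {z} [u uC|c|u v _ uC _ vC|u v _ uC _ vC] w.
- exact: uC.
- by rewrite mulr_algl mulr_algr.
- by rewrite mulrDl mulrDr uC vC.
- by rewrite -mulrA vC mulrA uC mulrA.
Qed.

(** The left ideal of [U] generated by [P] is generated by finitely many elements [s] of [P]. A
    central element of it is a combination of [s] with central coefficients by [reynolds]. *)
Lemma center_noeth : noeth (Z : pzRingType)^o.
Proof.
pose Uo : lmodType U := (U : pzRingType)^o.
move=> P sP; pose Q (u : Uo) := exists s : seq Z, (forall z, z \in s -> P z) /\
    @lspan U Uo (map val s) u.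
have sQ : submod Q.
  split=> [|a u v [s [sP1 su]] [t [tP tv]]]; first by exists [::]; split.
  exists (s ++ t); split=> [z|]; first by rewrite mem_cat => /orP[/sP1|/tP].
  rewrite map_cat; have sL := @lspan_submod U Uo (map val s ++ map val t).
  by apply: sL.2; [apply: lspan_catl|apply: lspan_catr].
have [gs [gQ Qg]] := noeth_env hU (vbasisP {:g}) sQ.
have [s [sP1 sg]] : exists s : seq Z, (forall z, z \in s -> P z) /\
    forall u, u \in gs -> @lspan U Uo (map val s) u.
  elim: gs gQ {Qg} => [|u gs IHg] gQ; first by exists [::].
  have [s1 [s1P s1u]] := gQ u (mem_head _ _).
  have [|s2 [s2P s2g]] := IHg; first by move=> w wg; apply: gQ; rewrite inE wg orbT.
  exists (s1 ++ s2); split=> [z|w]; first by rewrite mem_cat => /orP[/s1P|/s2P].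
  rewrite inE map_cat => /predU1P[->|/s2g]; first exact: lspan_catl.
  exact: lspan_catr.
exists s; split=> // z Pz.
have Qz : Q (val z).
  exists [:: z]; split=> [w|]; first by rewrite inE => /eqP ->.
  exact: lspan_head.
have /lspanP[c Ez] := lspan_sub sg (Qg _ Qz).
have ss : size (map val s) = size s by rewrite size_map.
pose zk (k : 'I_(size (map val s))) : U := (map val s)`_k.
have zkC k : central (zk k).
  rewrite /zk (nth_map 0) -?ss //; exact: center_central.
have [v vC Ev] := reynolds hg hU zkC (center_central z) Ez.
pose vz k : Z := subalg_in (Gen_in (vC k)).
have -> : z = \sum_k vz k * s`_(val k).
  apply: val_inj; transitivity (subalg_incl _ (\sum_k vz k * s`_(val k))) => //.
  rewrite linear_sum Ev; apply: eq_bigr => k _.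
  transitivity (v k * val (s`_(val k))) => //.
  by rewrite /zk (nth_map 0) -?ss.
have sL := @lspan_submod Z (Z : pzRingType)^o s.
apply: (submod_sum sL) => k; apply: (submodZ sL); apply: lspan_mem; apply: mem_nth.
by rewrite -ss ltn_ord.
Qed.

Definition center_algebraic (X : lmodType U) :=
  forall z : U, central z -> forall x : X, exists2 p : {poly C}, p != 0 & pact z p x = 0.

Lemma horner_alg_central (z : U) p : central z -> central (horner_alg z p).
Proof.
move=> zC; elim/poly_ind: p => [|p c IHp] u; first by rewrite rmorph0 mulr0 mul0r.
rewrite rmorphD rmorphM /= horner_algX horner_algC mulrDl mulrDr mulr_algl mulr_algr.
by rewrite -mulrA zC mulrA IHp mulrA.
Qed.

Lemma center_algebraic_uniform (X : lmodType U) (z : U) : fgmod X -> center_algebraic X -> central z ->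
  exists2 p : {poly C}, p != 0 & forall x : X, pact z p x = 0.
Proof.
move=> [s [_ Xs]] aX zC.
have [p p0 ps] : exists2 p : {poly C}, p != 0 & forall v, v \in s -> pact z p v = 0.
  elim: s {Xs} => [|v s [q q0 qs]]; first by exists 1; rewrite ?oner_eq0.
  have [p p0 pv] := aX z zC v; exists (p * q); first by rewrite mulf_neq0.
  move=> w; rewrite inE pactM => /predU1P[->|/qs ->]; last by rewrite /pact scaler0.
  by rewrite pactC pv /pact scaler0.
exists p => // x; apply: lspan_min ps (Xs x I); split=> [|a u v pu pv].
  by rewrite /pact scaler0.
rewrite /pact scalerDr scalerA horner_alg_central // -scalerA.
by rewrite -!/(pact _ _ _) pu pv scaler0 addr0.
Qed.

(** Finite generation gives each central element one polynomial killing all of [X], so the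
    annihilator of [X] in the center has finite codimension by [commutative_cofinite]. *)
Lemma center_image_fdim (X : lmodType U) : fgmod X -> center_algebraic X ->
  exists t : seq U, forall z, central z ->
    exists2 c, @lspan C U t c & forall x : X, z *: x = c *: x.
Proof.
move=> fX aX; pose J0 (z : Z) := forall x : X, val z *: x = 0.
have hv (z : Z) p : val (horner_alg z p) = horner_alg (val z) p.
  elim/poly_ind: p => [|p c IHp]; first by rewrite !rmorph0.
  rewrite !rmorphD !rmorphM /= !horner_algX !horner_algC -IHp.
  by [].
have [||||t tP] := @commutative_cofinite C Z J0.
- by move=> x y; apply: val_inj; apply: center_central.
- exact: center_noeth.
- split=> [x|a u v Ju Jv x]; first by rewrite scale0r.
  transitivity ((val a * val u + val v) *: x) => //.
  by rewrite scalerDl -scalerA Ju Jv scaler0 addr0.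
- move=> z; have [p p0 pX] := center_algebraic_uniform fX aX (center_central z).
  by exists p => // x; rewrite hv; apply: pX.
exists (map val t) => z zC; have [c tc Jc] := tP (subalg_in (Gen_in zC)).
exists (val c); first exact: (lspan_map (subalg_incl (@central C U)) tc).
move=> x; apply/eqP; rewrite -subr_eq0 -scalerBl; apply/eqP; exact: (Jc x).
Qed.

Variables (n : {vspace g}).
Local Notation io := (env_incl i n).

Definition locally_finite (X : lmodType U) := forall x : res io X, locfin x.

(** If [R v] is finite-dimensional, it contains U(n) [v] and is stable under the center. Conversely
    the center acts like the span of a finite list [t], so [R v] lies in the span of [t] applied to
    a finite-dimensional space containing U(n) [v]. *)
Lemma whittakerE (X : lmodType U) :
  (finitely_generated X /\ forall v : X, finite_dim
    (fun w => exists2 r, center_times_env i n r & w = r *: v)) <->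
  [/\ fgmod X, locally_finite X & center_algebraic X].
Proof.
have fgE : finitely_generated X <-> fgmod X.
  split=> [[s sX]|[s [_ sX]]]; exists s; first by split=> // v _; apply/lspanP.
  by move=> v; apply/lspanP/sX.
pose P (v w : X) := exists2 r, center_times_env i n r & w = r *: v.
have sP v : @submod C (kmod X) (P v).
  split=> [|a u w [r [s [sr Er]] Eu] [r' [s' [sr' Er']] Ew]].
    by exists 0; [exists [::]; rewrite big_nil|rewrite scale0r].
  exists (a *: r + r'); last by rewrite scalerDl -[a *: r]mulr_algl -scalerA -Eu -Ew.
  exists ([seq (a *: p.1, p.2) | p <- s] ++ s'); split=> [p|].
    rewrite mem_cat => /orP[/mapP[q /sr[q1 q2] ->]|/sr' //]; split=> //= u'.
    by rewrite -scalerAl q1 scalerAr.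
  rewrite big_cat big_map Er Er' scaler_sumr; congr (_ + _).
  by apply: eq_bigr => p _; rewrite scalerAl.
have cte z b : central z -> env_of i n b -> center_times_env i n (z * b).
  by move=> zC nb; exists [:: (z, b)]; rewrite big_seq1; split=> // p; rewrite inE => /eqP ->.
have c1 : central (1 : U) by move=> u; rewrite mul1r mulr1.
have e1 : env_of i n 1 by rewrite -[1]scale1r; apply: Gen_scalar.
have Pv v : P v v by exists (1 * 1); [apply: cte|rewrite mulr1 scale1r].
split=> [[/fgE fX fdX]|[fX lX aX]].
  have fP v : fdim (P v).
    by have [s [_ sX]] := fdX v; exists s => w /sX Ew; apply/lspanP.
  split=> // [v|z zC v].
    apply: (fdim_sub (A := env_sub i n) (M := res io X) (Q := P v)) => [w [b ->]|].
      exists (1 * io b); last by rewrite mul1r.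
      by apply: cte => //; apply: subalg_incl_gen.
    have [s sX] := fP v; exists s => w Pw; apply/(lspan_kres io); exact: sX.
  apply: (pact_root (P := P v)) => // _ [r [s [sr Er]] ->].
  exists (z * r); last by rewrite scalerA.
  exists [seq (z * p.1, p.2) | p <- s]; split=> [_ /mapP[q /sr[q1 q2] ->]|].
    by split=> //= u; rewrite -mulrA q1 !mulrA zC.
  by rewrite Er mulr_sumr big_map; apply: eq_bigr => p _; rewrite mulrA.
split=> [|v]; first exact/fgE.
have [t tP] := center_image_fdim fX aX; have [s0 s0P] := lX v.
pose S := [seq (u *: (y : X)) | u <- t, y <- s0].
have sL := @lspan_submod C (kmod X) S.
have fP : fdim (P v).
  exists S => _ [r [s [sr ->]] ->]; rewrite scaler_suml big_seq.
  elim/big_rec: _ => [|p w /sr[p1 p2] Lw]; first by case: sL.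
  apply: (submodD sL) => //; rewrite -scalerA.
  have [c tc ->] := tP _ p1.
  apply: lspan_scale tc _; apply/(lspan_kres io).
  exact: (s0P _ (ex_intro _ (subalg_in p2) erefl)).
have [s [sPv Ps]] := kspan_fingen (sP v) fP.
by exists s; split=> // w /Ps/lspanP.
Qed.

End Center.

(** * A central series of the positive part *)

Section PositivePart.
Variables (K : numFieldType) (g : lieAlgType K) (T : triangular_decomposition g).
Local Notation H := (cartan T).
Local Notation h := (subvs_of H).
Local Notation D := (simple_roots T).
Local Notation weight := 'Hom(h, K^o).
Implicit Types (a b : weight) (x y : g).

Lemma root_spaceP a x : reflect
  (forall t, t \in vbasis {:h} -> lieb (vsval t) x = a t *: x) (x \in root_space a).
Proof.
have mem_big (s : seq h) : (x \in (\bigcap_(t <- s) passmx.leigenspace (ad (vsval t)) (a t))%VS) =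
    all (fun t => lieb (vsval t) x == a t *: x) s.
  elim: s => [|t s IHs]; first by rewrite big_nil memvf.
  rewrite big_cons memv_cap IHs /=; congr (_ && _).
  have adE : ad (vsval t) x = lieb (vsval t) x by exact: (lfunE (adl (vsval t)) x).
  rewrite /passmx.leigenspace memv_ker add_lfunE opp_lfunE scale_lfunE id_lfunE adE.
  by rewrite subr_eq0.
rewrite /root_space mem_big; apply: (iffP allP) => H1 t tB; first exact/eqP/H1.
by apply/eqP/H1.
Qed.

Lemma root_space_bracket a b x y :
  x \in root_space a -> y \in root_space b -> lieb x y \in root_space (a + b).
Proof.
move=> /root_spaceP xa /root_spaceP yb; apply/root_spaceP => t tB.
by rewrite lieb_der xa // yb // liebZl liebZr -scalerDl add_lfunE.
Qed.

(** The height of a root, valued in [K] since it is defined by coordinates on the simple roots; on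
    nonnegative combinations it is a natural number. *)
Definition weight_height a : K := \sum_k coord (in_tuple D) k a.

Lemma weight_heightD a b : weight_height (a + b) = weight_height a + weight_height b.
Proof. by rewrite /weight_height -big_split; apply: eq_bigr => k _; rewrite linearD. Qed.

Lemma nonneg_height a : nonneg_comb D a -> exists m : nat, weight_height a = m%:R /\
  (m = 0%N -> a = 0).
Proof.
move=> [c Ea]; exists (\sum_k c k)%N; split=> [|c0]; last first.
  rewrite Ea big1 // => k _; suff -> : c k = 0%N by rewrite mulr0n.
  by apply/eqP; move/eqP: c0; rewrite sum_nat_eq0 => /forallP/(_ k).
rewrite natr_sum; apply: eq_bigr => k _.
have -> : a = \sum_k (c k)%:R *: (in_tuple D)`_k.
  by rewrite Ea; apply: eq_bigr => j _; rewrite scaler_nat.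
exact: (@coord_sum_free _ _ _ (in_tuple D) (fun k => (c k)%:R) k (simple_roots_free T)).
Qed.

Lemma nonneg_combD a b : nonneg_comb D a -> nonneg_comb D b -> nonneg_comb D (a + b).
Proof.
move=> [c ->] [d ->]; exists (fun k => (c k + d k)%N); rewrite -big_split.
by apply: eq_bigr => k _; rewrite mulrnDr.
Qed.

Lemma positive_root_height a : a \in positive_roots T ->
  exists2 m : nat, weight_height a = m%:R & (0 < m)%N.
Proof.
move=> /positive_rootsP[/andP[a0 _] na]; have [m [Em m0]] := nonneg_height na.
by exists m => //; rewrite lt0n; apply: contra_neqN a0 => /eqP.
Qed.

(** Heights of positive roots are positive and add up, so [a + b] is nonzero; the nonzero bracket
    lies in its root space. *)
Lemma positive_rootD a b x y : a \in positive_roots T -> b \in positive_roots T ->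
  x \in root_space a -> y \in root_space b -> lieb x y != 0 -> a + b \in positive_roots T.
Proof.
move=> aP bP xa yb xy0; have [m Em m0] := positive_root_height aP.
have [m' Em' _] := positive_root_height bP.
have [/positive_rootsP[_ na] /positive_rootsP[_ nb]] := (aP, bP).
apply/positive_rootsP; split; last exact: nonneg_combD.
apply/andP; split.
  apply/eqP => ab0; have := weight_heightD a b; rewrite ab0 Em Em' -natrD.
  rewrite /weight_height big1 => [|k _]; last exact: linear0.
  by move/eqP; rewrite eq_sym pnatr_eq0 addn_eq0 (gtn_eqF m0).
apply/eqP => E; have := root_space_bracket xa yb; rewrite E memv0.
by rewrite (negbTE xy0).
Qed.

Definition height_ge k a := `[< exists2 m : nat, weight_height a = m%:R & (k <= m)%N >].

Definition height_part k : {vspace g} :=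
  (\sum_(a <- positive_roots T | height_ge k a) root_space a)%VS.

Lemma height_part1 : height_part 1 = n_plus T.
Proof.
rewrite /height_part n_plusE big_seq_cond [RHS]big_seq; apply: eq_bigl => a.
case: (boolP (a \in positive_roots T)) => //= aP; apply/asboolP.
by have [m Em m0] := positive_root_height aP; exists m.
Qed.

Lemma height_part_big : exists k, height_part k = 0%VS.
Proof.
have [k kP] : exists k, forall a, a \in positive_roots T -> ~~ height_ge k a.
  elim: (positive_roots T) (@positive_root_height) => [_|a s IHs sP]; first by exists 0%N.
  have [|k kP] := IHs; first by move=> b bs; apply: sP; rewrite inE bs orbT.
  have [m Em _] := sP a (mem_head _ _); exists (maxn k m.+1) => b.
  rewrite inE => /predU1P[->|/kP].
    apply/asboolPn => -[m']; rewrite Em => /eqP; rewrite eqr_nat => /eqP <-.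
    by rewrite geq_max ltnn andbF.
  apply: contra => /asboolP[m' Em' km']; apply/asboolP; exists m' => //.
  by apply: leq_trans km'; apply: leq_maxl.
exists k; rewrite /height_part big_seq_cond big1 // => a /andP[/kP/negbTE ->].
by [].
Qed.

Lemma root_sum_ind (P : pred weight) (Q : g -> Prop) : submod Q ->
    (forall a x, a \in positive_roots T -> P a -> x \in root_space a -> Q x) ->
  forall x, x \in (\sum_(a <- positive_roots T | P a) root_space a)%VS -> Q x.
Proof.
move=> sQ aQ x; have [W WP] := vspace_of sQ.
suff : (\sum_(a <- positive_roots T | P a) root_space a <= W)%VS by move=> /subvP sW /sW/WP.
rewrite big_seq_cond; elim/big_ind: _ => [|U V UW VW|a /andP[aP Pa]]; first exact: sub0v.
  by rewrite subv_add UW.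
by apply/subvP => y ya; apply/WP; apply: aQ ya.
Qed.

Lemma root_space_sub (P : pred weight) a : a \in positive_roots T -> P a ->
  (root_space a <= \sum_(a <- positive_roots T | P a) root_space a)%VS.
Proof.
elim: (positive_roots T) => // b s IHs; rewrite inE big_cons.
have [->|ab] /= := eqVneq a b; first by move=> _ ->; apply: addvSl.
move=> /IHs{}IHs /IHs aS; case: ifP => // _.
exact: subv_trans aS (addvSr _ _).
Qed.

Lemma height_part_bracket k x y :
  x \in n_plus T -> y \in height_part k -> lieb x y \in height_part k.+1.
Proof.
move=> xn; apply: (@root_sum_ind (height_ge k) (fun y => lieb x y \in height_part k.+1)) => [|b {}y bP /asboolP[m' Em' km'] yb].
  split=> [|c u v cu cv]; first by rewrite lieb0r mem0v.
  by rewrite liebDr liebZr memvD ?memvZ.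
move: x xn; rewrite n_plusE.
apply: (@root_sum_ind xpredT (fun x => lieb x y \in height_part k.+1)) => [|a x aP _ xa].
  split=> [|c u v cu cv]; first by rewrite lieb0l mem0v.
  by rewrite liebDl liebZl memvD ?memvZ.
have [->|xy0] := eqVneq (lieb x y) 0; first exact: mem0v.
have abP := positive_rootD aP bP xa yb xy0.
apply: (subvP (root_space_sub (P := height_ge k.+1) abP _)); last exact: root_space_bracket.
apply/asboolP; have [m Em m0] := positive_root_height aP.
exists (m + m')%N; first by rewrite weight_heightD Em Em' natrD.
by rewrite -add1n leq_add.
Qed.

Lemma height_part_sub k : (height_part k.+1 <= height_part k)%VS.
Proof.
apply/subvP.
apply: (@root_sum_ind (height_ge k.+1) (fun x => x \in height_part k)) => [|a x aP /asboolP[m Em km] xa].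
  by split=> [|c u v cu cv]; rewrite ?mem0v ?memvD ?memvZ.
apply: (subvP (root_space_sub (P := height_ge k) aP _)) xa.
by apply/asboolP; exists m => //; apply: ltnW.
Qed.

Lemma n_plus_subalgebra : lie_subalgebra (n_plus T).
Proof.
move=> x y xn yn; rewrite -height_part1; apply: (subvP (height_part_sub 1)).
by apply: height_part_bracket; rewrite ?height_part1.
Qed.

(** Bases of the terms of the height filtration are concatenated with the deepest term first.
    Bracketing with the positive part raises the height, hence falls into the span of earlier
    vectors. *)
Lemma n_plus_central_series : exists s : seq g,
  [/\ forall y, y \in s -> y \in n_plus T,
      forall x, x \in n_plus T -> x \in <<s>>%VS &
      forall s1 z s2, s = s1 ++ z :: s2 -> forall y, y \in n_plus T -> lieb z y \in <<s1>>%VS].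
Proof.
have [k0 Hk0] := height_part_big.
(* Descending induction on the height [k], where [j] is the distance to the height [k0] at which the
   filtration has become zero. *)
suff main j k : (k + j = k0)%N -> exists s : seq g, [/\ forall y, y \in s -> y \in height_part k,
      forall x, x \in height_part k -> x \in <<s>>%VS &
      forall s1 z s2, s = s1 ++ z :: s2 -> forall y, y \in n_plus T -> lieb z y \in <<s1>>%VS].
  case: k0 Hk0 main => [H0 _|k0 _ main].
    have n0 : n_plus T = 0%VS.
      by apply/eqP; rewrite -subv0 -H0 -height_part1; apply: height_part_sub.
    exists [::]; split=> // [x|[]//].
    by rewrite n0 span_nil.
  by have [s] := main k0 1%N (add1n _); rewrite height_part1 => sP; exists s.
elim: j k => [|j IHj] k kj.
  exists [::]; split=> // [x|[]//].
  by move: kj; rewrite addn0 => ->; rewrite Hk0 span_nil.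
have [|s [s1 s2 s3]] := IHj k.+1; first by rewrite addSnnS.
exists (s ++ vbasis (height_part k)); split=> [y|x xk|t1 z t2 Et y yn].
- rewrite mem_cat => /orP[/s1|/vbasis_mem //]; exact: (subvP (height_part_sub k)).
- by rewrite span_cat (subvP (addvSr _ _)) // (span_basis (vbasisP _)).
have [ts|st] := ltnP (size t1) (size s).
  have Es : s = t1 ++ z :: take (size s - size t1).-1 t2.
    have := congr1 (take (size s)) Et; rewrite take_size_cat // => {1}->.
    rewrite take_cat ltnNge (ltnW ts) /=; move: ts; rewrite -subn_gt0.
    by case: (size s - size t1)%N.
  exact: s3 Es y yn.
have zk : z \in height_part k.
  have : z \in s ++ vbasis (height_part k) by rewrite Et mem_cat mem_head orbT.
  rewrite mem_cat => /orP[/s1|/vbasis_mem //]; exact: (subvP (height_part_sub k)).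
have st1 : (<<s>> <= <<t1>>)%VS.
  have := congr1 (take (size s)) Et; rewrite take_size_cat // take_cat.
  have [|_] := ltnP (size s) (size t1).
    by move=> _ ->; apply: sub_span => v; apply: mem_take.
  have -> : (size s - size t1)%N = 0%N by apply/eqP; rewrite subn_eq0.
  by rewrite take0 cats0 => ->; apply: subvv.
apply: (subvP st1); apply: s2; rewrite lieb_antisym memvN; exact: height_part_bracket.
Qed.

End PositivePart.

Lemma lspan_subalgebra_gen (K : fieldType) (A : algType K) (zs : seq A) a :
  @lspan K A zs a -> subalgebra_gen (fun u => u \in zs) a.
Proof.
apply: lspan_min => [|u uz]; last exact: Gen_in.
split=> [|c u v su sv]; first by rewrite -[0](scale0r 1); apply: Gen_scalar.
apply: Gen_add => //; rewrite -mulr_algl; apply: Gen_mul => //; exact: Gen_scalar.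
Qed.

(** * The three inclusions between Whittaker modules and all modules *)

Section WhittakerModules.
Variables (C : numClosedFieldType) (g : lieAlgType C) (U : algType C) (i : {linear g -> U}).
Hypothesis hg : lie_semisimple g.
Hypothesis hU : universal_enveloping i.
Variable T : triangular_decomposition g.
Local Notation n := (n_plus T).
Local Notation B := (env_sub i n).
Local Notation io := (env_incl i n).

Lemma env_sub_central_sequence : exists zs : seq B,
  (forall a, subalgebra_gen (fun u => u \in zs) a) /\
  (forall s1 z s2, zs = s1 ++ z :: s2 ->
    forall y, y \in zs -> @lspan C B s1 (z * y - y * z)).
Proof.
have [s [sn ns sC]] := n_plus_central_series T.
(* A linear map defined on all of [g] that agrees with the inclusion of the positive part. *)
pose j (x : g) : B := \sum_k coord (vbasis n) k x *: sub_letter i k.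
have jl : linear j.
  move=> a u v; rewrite scaler_sumr -big_split; apply: eq_bigr => k _ /=.
  by rewrite linearP scalerDl scalerA.
have jE x : x \in n -> io (j x) = i x by move=> xn; rewrite (sub_letter_sum i xn).
have j_span (t : seq g) x : x \in <<t>>%VS -> @lspan C B (map j t) (j x).
  move=> xt; apply: (lspan_map (mklin jl)).
  rewrite (coord_span (X := in_tuple t) xt); have sL := @lspan_submod C g t.
  apply: (submod_sum sL) => k; apply: (submodZ sL); apply: lspan_mem.
  exact: mem_nth.
exists (map j s); split=> [a|s1 z s2 Es y /mapP[y0 y0s ->]].
  elim: (subalg_gen a) => {a} [u [x xn Eu]|c|u v _ su _ sv|u v _ su _ sv].
  - have -> : u = j x by apply: val_inj; rewrite Eu -(jE x xn).
    exact/lspan_subalgebra_gen/j_span/ns.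
  - exact: Gen_scalar.
  - exact: Gen_add.
  - exact: Gen_mul.
have E1 : map j (take (size s1) s) = s1 by rewrite map_take Es take_size_cat.
have E2 : map j (drop (size s1) s) = z :: s2 by rewrite map_drop Es drop_size_cat.
case Ed : (drop (size s1) s) E2 => [//|z0 t0] /= [Ez _].
have Es0 : s = take (size s1) s ++ z0 :: t0 by rewrite -Ed cat_take_drop.
have z0n : z0 \in n by apply: sn; rewrite Es0 mem_cat mem_head orbT.
have y0n := sn y0 y0s.
have -> : z * j y0 - j y0 * z = j (lieb z0 y0).
  apply: val_inj; rewrite -Ez; apply: etrans (esym (jE _ (n_plus_subalgebra z0n y0n))).
  by rewrite hU.1 -(jE _ z0n) -(jE _ y0n).
by rewrite -E1; apply/j_span/(sC _ _ _ Es0).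
Qed.

Let noethU : noeth (U : pzRingType)^o := noeth_env hU (vbasisP {:g}).
Let noethB : noeth (B : pzRingType)^o := noeth_env_sub hU (@n_plus_subalgebra _ _ T).

Let fdim_essentialB (X : lmodType B) (N : X -> Prop) :
  noeth X -> submod N -> fdim N -> essential N -> fdim (fun _ : X => True).
Proof. by have [zs [zs_gen zs_central]] := env_sub_central_sequence; apply: fdim_of_essential zs_gen zs_central X N. Qed.

Definition env_locfin (X : lmodType U) (x : X) := locfin (x : res io X).

(** If [s] spans U(n) [u], then [s] together with the products of elements of [g] with [s] spans a
    space stable under [n], because [x (a v) = [x, a] v + a (x v)]. Hence the locally finite vectors
    form a submodule over [U]. *)
Lemma env_locfin_lie (X : lmodType U) y (u : X) : env_locfin u -> env_locfin (i y *: u).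
Proof.
move=> lu; pose P (w : X) := exists b : B, w = io b *: u.
have sP : @submod C (kmod X) P.
  split=> [|c v w [b Ev] [b' Ew]]; first by exists 0; rewrite rmorph0 scale0r.
  exists (c *: b + b'); rewrite linearP scalerDl -Ew; congr (_ + _).
  by transitivity ((c%:A * io b) *: u); [rewrite -scalerA -Ev|rewrite mulr_algl].
have [s0 s0P] := lu; have [|s [sP' Ps]] := kspan_fingen sP.
  by exists s0 => w [b Ew]; apply/(lspan_kres io); apply: s0P; exists b.
pose t := [seq env_letter i (vbasis {:g}) k | k <- enum 'I_(\dim {:g})].
have ti x : @lspan C U t (i x).
  have sT := @lspan_submod C U t; rewrite (env_letter_sum i (vbasisP {:g})).
  apply: (submod_sum sT) => k; apply: (submodZ sT); apply: lspan_mem.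
  by apply: map_f; rewrite mem_enum.
pose S : seq X := [seq a *: (v : X) | a <- t, v <- (s : seq X)] ++ s.
have sS := @lspan_submod C (kmod X) S.
have stab x (v : X) : x \in n -> v \in (s : seq X) -> @lspan C (kmod X) s (i x *: v).
  move=> xn /sP'[b Ev]; apply: Ps.
  have xB : subalgebra_gen (env_pred i n) (i x) by apply: Gen_in; exists x.
  by exists (subalg_in xB * b); rewrite Ev scalerA.
have stabS x (w : X) : x \in n -> @lspan C (kmod X) S w -> @lspan C (kmod X) S (i x *: w).
  move=> xn; apply: (@lspan_min C (kmod X) S (fun w => @lspan C (kmod X) S (i x *: (w : X)))).
    split=> [|c v v' Lv Lv']; first by rewrite scaler0; case: sS.
    by rewrite scalerDr kmodE scalerA mulr_algr -mulr_algl -scalerA; apply: sS.2.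
  move=> v; rewrite mem_cat => /orP[/allpairsP[[a v'] /= [/mapP[k _ ->] v's ->]]|vs].
    have -> : i x *: (env_letter i (vbasis {:g}) k *: v') =
        i (lieb x (vbasis {:g})`_k) *: v' + env_letter i (vbasis {:g}) k *: (i x *: v').
      by rewrite hU.1 !scalerA -scalerDl subrK.
    apply: (submodD sS); apply: lspan_catl; apply: lspan_scale.
    - exact: ti.
    - exact: lspan_mem.
    - exact: ti.
    - exact: stab.
  by apply: lspan_catr; apply: stab.
have stabB (b : B) (w : X) : @lspan C (kmod X) S w -> @lspan C (kmod X) S (io b *: w).
  elim: (subalg_gen b) w => {b} [b [x xn Eb]|c|a b _ IHa _ IHb|a b _ IHa _ IHb] w Sw.
  - by have -> : io b = i x by []; apply: stabS.
  - have -> : io c%:A *: w = c%:A *: w by rewrite linearZ_LR rmorph1.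
    exact: (submodZ sS).
  - by rewrite rmorphD scalerDl; apply: (submodD sS); [apply: IHa|apply: IHb].
  - by rewrite rmorphM -scalerA; apply/IHa/IHb.
exists S => _ [b ->]; apply/(lspan_kres io); apply: stabB; apply: lspan_catl.
apply: lspan_scale; first exact: ti.
by apply: Ps; exists 1; rewrite rmorph1 scale1r.
Qed.

Lemma env_locfin_submod (X : lmodType U) : submod (@env_locfin X).
Proof.
have sL := @locfin_submod C B (res io X); split=> [|a u v lu lv]; first by case: sL.
apply: (submodD sL) => //; elim: (env_gen hU a) u lu => {a v lv}
    [_ [y ->]|c|a b _ IHa _ IHb|a b _ IHa _ IHb] u lu.
- exact: env_locfin_lie.
- have -> : c%:A *: u = (c%:A : B) *: (u : res io X).
    by transitivity (io c%:A *: u); first by rewrite linearZ_LR rmorph1.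
  exact: (submodZ sL).
- by rewrite scalerDl; apply: (submodD sL); [apply: IHa|apply: IHb].
- by rewrite -scalerA; apply/IHa/IHb.
Qed.

Lemma env_locfin_map (X Y : lmodType U) (f : {linear X -> Y}) x :
  env_locfin x -> env_locfin (f x).
Proof. exact: (locfin_map (resl io f)). Qed.

Lemma env_locfin_inj (X Y : lmodType U) (f : {linear X -> Y}) x :
  injective f -> env_locfin (f x) -> env_locfin x.
Proof. by move=> fI; apply: (locfin_inj (f := resl io f)). Qed.

(** Acyclicity concerns the structure over [B], whereas the sequences live over [U]; the [B]-module
    [E] presents [P]. *)
Definition env_acyclic (X : lmodType U) (P : X -> Prop) :=
  exists (E : lmodType B) (a : {linear E -> res io X}),
    [/\ injective a, forall x, P x <-> exists e, a e = x & acyclic E].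

Lemma torsion_full (M N : lmodType U) d : locally_finite i n M -> locally_finite i n N ->
  zz_full (@ladder U M d.+1 N N (fun x => x))
    (fun c => exact_after (fun x => x = 0) c /\ terms_in (locally_finite i n) c)
    (fun c => exact_after (fun x => x = 0) c /\ terms_in (@all_modules U) c).
Proof.
apply: (@zz_full_torsion U M (fun X => coind X) (fun X => coind_unit X)
  (fun X Y f => coind_map f) (@coind_unit_natural C U) (@coind_unit_inj C U)
  env_locfin env_locfin_submod env_locfin_map env_locfin_inj env_acyclic).
- move=> X Y f [E [a [aI aE aE']]] x fx.
  apply: (acyclic_lift noethB (a := a) (q := resl io f) aI _ aE' fx).
  exact: aE.
- move=> X Y f [E [a [aI aE aE']]].
  pose sR := submod_range (resl io f : {linear res io (coind X) -> res io Y}).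
  exists (subT sR), (sub_incl sR); split=> [|y|].
  + exact: sub_incl_inj.
  + by split=> [/(sub_incl_ex sR)//|[e <-]]; apply: (sub_inclP e).
  have qP x : exists x', (resl io f : {linear res io (coind X) -> res io Y}) x' = resl io f x.
    by exists x.
  apply: (acyclic_quotient noethB fdim_essentialB (a := a) (q := sub_lift sR qP) aI) => //.
  + move=> y; have [x Ex] := sub_inclP y; exists x; apply: (@sub_incl_inj _ _ _ sR).
    by rewrite sub_liftE.
  + move=> x; split=> [q0|[e Ee]].
      apply/aE; have := congr1 (sub_incl sR) q0.
      by rewrite sub_liftE linear0.
    apply: (@sub_incl_inj _ _ _ sR); rewrite sub_liftE linear0.
    by apply/aE; exists e.
  exact: (env_coind_baer hU (semisimple_center hg) (@n_plus_subalgebra _ _ T)).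
- move=> X X' Y f j jI [E [a [aI aE aE']]].
  exists E, (lcomp (resl io j) a); split=> // [x y /jI/aI //|x'].
  split=> [[x <-]|[e <-]].
    have [e Ee] : exists e, a e = f x by apply/aE; exists x.
    by exists e; rewrite /= Ee.
  have [x Ex] : exists x, f x = a e by apply/aE; exists e.
  by exists x; rewrite /= Ex.
- move=> X Y f GX fI; exists (res io X), (resl io f); split=> //.
  exact: acyclic_locfin.
Qed.

Definition fg_locfin (X : lmodType U) := fgmod X /\ locally_finite i n X.
Definition whittaker_alg (X : lmodType U) :=
  [/\ fgmod X, locally_finite i n X & center_algebraic X].

Lemma fgmod_noeth (X : lmodType U) : fgmod X -> noeth X.
Proof. exact: noeth_fg. Qed.

Lemma fgmod_sub (X Y : lmodType U) (f : {linear X -> Y}) : injective f -> fgmod Y -> fgmod X.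
Proof. by move=> fI /fgmod_noeth/(noeth_sub fI)/noeth_fgmod. Qed.

Lemma locally_finite_sub (X Y : lmodType U) (f : {linear X -> Y}) :
  injective f -> locally_finite i n Y -> locally_finite i n X.
Proof. by move=> fI lY x; apply: (env_locfin_inj fI); apply: lY. Qed.

Lemma locally_finite_img (X Y : lmodType U) (f : {linear X -> Y}) :
  (forall y, exists x, f x = y) -> locally_finite i n X -> locally_finite i n Y.
Proof. by move=> fS lX y; have [x <-] := fS y; apply: env_locfin_map; apply: lX. Qed.

Lemma locally_finite_prod (X Y : lmodType U) : locally_finite i n X -> locally_finite i n Y ->
  locally_finite i n (X * Y)%type.
Proof.
move=> lX lY [x y].
pose f : {linear X -> (X * Y)%type} := lpair (lid X) (lzero X Y).
pose h : {linear Y -> (X * Y)%type} := lpair (lzero Y X) (lid Y).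
have -> : (x, y) = f x + h y by congr (_, _); rewrite /= ?addr0 ?add0r.
apply: (submodD (@env_locfin_submod _)); first exact: (env_locfin_map f (lX x)).
exact: (env_locfin_map h (lY y)).
Qed.

(** The left ideal of those [b] with [h (b y) = 0] has finite codimension and moves [y] into the
    image of [X], so [locfin_cofinite] applies. *)
Lemma locally_finite_ext (X Y Z : lmodType U) (f : {linear X -> Y}) (h : {linear Y -> Z}) :
    (forall y, h y = 0 -> exists x, f x = y) ->
  locally_finite i n X -> locally_finite i n Z -> locally_finite i n Y.
Proof.
move=> ex lX lZ y; have hy : locfin (resl io h (y : res io Y)) by apply: lZ.
apply: (locfin_cofinite noethB _ (locfin_ann hy)) => [|b /ex[x Ex]].
  split=> [|b u v hu hv]; first by rewrite scale0r linear0.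
  rewrite scalerDl linearD -[(b * u) *: _]scalerA.
  by rewrite [X in X + _]linearZ [X in X + _](congr1 (fun w => b *: w) hu) hv scaler0 addr0.
have -> : b *: (y : res io Y) = resl io f (x : res io X) by [].
by apply: locfin_map; apply: lX.
Qed.

Lemma pact_linear (X Y : lmodType U) (f : {linear X -> Y}) z (p : {poly C}) x :
  f (pact z p x) = pact z p (f x).
Proof. exact: linearZ_LR. Qed.

Lemma center_algebraic_sub (X Y : lmodType U) (f : {linear X -> Y}) :
  injective f -> center_algebraic Y -> center_algebraic X.
Proof.
move=> fI aY z zC x; have [p p0 px] := aY z zC (f x); exists p => //.
by apply: fI; rewrite pact_linear px linear0.
Qed.

Lemma center_algebraic_img (X Y : lmodType U) (f : {linear X -> Y}) :
  (forall y, exists x, f x = y) -> center_algebraic X -> center_algebraic Y.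
Proof.
move=> fS aX z zC y; have [x <-] := fS y; have [p p0 px] := aX z zC x.
by exists p; rewrite // -pact_linear px linear0.
Qed.

Lemma center_algebraic_ext (X Y Z : lmodType U) (f : {linear X -> Y}) (h : {linear Y -> Z}) :
    (forall y, h y = 0 -> exists x, f x = y) ->
  center_algebraic X -> center_algebraic Z -> center_algebraic Y.
Proof.
move=> ex aX aZ z zC y; have [p p0 py] := aZ z zC (h y).
have [x Ex] : exists x, f x = pact z p y by apply: ex; rewrite pact_linear.
have [q q0 qx] := aX z zC x; exists (q * p); first by rewrite mulf_neq0.
by rewrite pactM -Ex -pact_linear qx linear0.
Qed.

Lemma whittaker_alg_sub (X Y : lmodType U) (f : {linear X -> Y}) :
  injective f -> whittaker_alg Y -> whittaker_alg X.
Proof.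
move=> fI [fY lY aY]; split; [exact: fgmod_sub fI fY|exact: locally_finite_sub fI lY|].
exact: center_algebraic_sub fI aY.
Qed.

Lemma whittaker_alg_img (X Y : lmodType U) (f : {linear X -> Y}) :
  (forall y, exists x, f x = y) -> whittaker_alg X -> whittaker_alg Y.
Proof.
move=> fS [fX lX aX]; split; [exact: fgmod_img fS fX|exact: locally_finite_img fS lX|].
exact: center_algebraic_img fS aX.
Qed.

Lemma whittaker_alg_ext (X Y Z : lmodType U) (f : {linear X -> Y}) (h : {linear Y -> Z}) :
    (forall y, h y = 0 -> exists x, f x = y) ->
  whittaker_alg X -> whittaker_alg Z -> whittaker_alg Y.
Proof.
move=> ex [fX lX aX] [fZ lZ aZ]; split.
- by apply: (fgmod_ext ex fX); apply: fgmod_noeth.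
- exact: locally_finite_ext ex lX lZ.
- exact: center_algebraic_ext ex aX aZ.
Qed.

Lemma whittaker_alg_prod (X Y : lmodType U) :
  whittaker_alg X -> whittaker_alg Y -> whittaker_alg (X * Y)%type.
Proof.
pose f : {linear X -> (X * Y)%type} := lpair (lid X) (lzero X Y).
pose h : {linear (X * Y)%type -> Y} := lcopair (lzero X Y) (lid Y).
move=> wX wY; apply: (@whittaker_alg_ext X _ Y f h) => // -[x y] /= E.
by exists x; congr (_, _); rewrite -E add0r.
Qed.

Lemma fg_locfin_sub (X Y : lmodType U) (f : {linear X -> Y}) :
  injective f -> fg_locfin Y -> fg_locfin X.
Proof. by move=> fI [fY lY]; split; [apply: fgmod_sub fI fY|apply: locally_finite_sub fI lY]. Qed.

Lemma fg_locfin_img (X Y : lmodType U) (f : {linear X -> Y}) :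
  (forall y, exists x, f x = y) -> fg_locfin X -> fg_locfin Y.
Proof. by move=> fS [fX lX]; split; [apply: fgmod_img fS fX|apply: locally_finite_img fS lX]. Qed.

Lemma fg_locfin_prod (X Y : lmodType U) :
  fg_locfin X -> fg_locfin Y -> fg_locfin (X * Y)%type.
Proof.
by move=> [fX lX] [fY lY]; split; [apply: fgmod_prod|apply: locally_finite_prod].
Qed.

(** Divide [Y] by a maximal submodule meeting the range of [f] trivially, so that the range becomes
    essential. A polynomial in a central [z] killing [X] kills this range, and by
    [central_pact_nilpotent] some power of it kills the quotient. *)
Lemma whittaker_alg_stable (X Y : lmodType U) (f : {linear X -> Y}) :
    whittaker_alg X -> fg_locfin Y ->
  exists K (sK : submod K), (forall x, K (f x) -> f x = 0) /\ whittaker_alg (quoT sK).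
Proof.
move=> [fX lX aX] [fY lY]; have nY := fgmod_noeth fY.
have [K [sK [KN eN]]] := essential_quotient nY (submod_range f).
exists K, sK; split=> [x Kx|]; first by apply: KN Kx _; exists x.
have fQ : fgmod (quoT sK) := fgmod_img (@quo_pi_surj _ _ _ sK) fY.
split=> //; first exact: (locally_finite_img (@quo_pi_surj _ _ _ sK) lY).
move=> z zC y; have [p p0 pX] := center_algebraic_uniform fX aX zC.
have zQ : central_on (quoT sK) z by move=> a x; rewrite !scalerA zC.
have [|k Hk] := central_pact_nilpotent (p := p) (fgmod_noeth fQ) eN zQ.
  by move=> _ [_ [x <-] <-]; rewrite -!pact_linear pX !linear0.
by exists (p ^+ k); rewrite ?expf_neq0.
Qed.

(** The submodule generated by preimages of finitely many generators of [Y]. *)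
Lemma fg_locfin_lift (X Y : lmodType U) (f : {linear X -> Y}) :
    (forall y, exists x, f x = y) -> locally_finite i n X -> fg_locfin Y ->
  exists (Z : lmodType U) (t : {linear Z -> X}), fg_locfin Z /\ forall y, exists z, f (t z) = y.
Proof.
move=> fS lX [[s [_ Ys]] lY].
have [r Er] : exists r, map f r = s by apply: map_preimage1 => y _.
pose sL := lspan_submod r; exists (subT sL), (sub_incl sL); split.
  split; last exact: (locally_finite_sub (@sub_incl_inj _ _ _ sL) lX).
  have [t Et] : exists t, map (sub_incl sL) t = r.
    by apply: map_preimage1 => x xr; apply: sub_incl_ex; apply: lspan_mem.
  exists t; split=> // x _; have : lspan (map (sub_incl sL) t) (sub_incl sL x).
    by rewrite Et; apply: sub_inclP.
  by move=> /lspan_map_ex[x' tx' /sub_incl_inj <-].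
move=> y; have := Ys y I; rewrite -Er => /lspan_map_ex[x rx <-].
by have [z <-] := sub_incl_ex sL rx; exists z.
Qed.

Lemma whittaker_full (M N : lmodType U) d : whittaker_alg M -> whittaker_alg N ->
  zz_full (@ladder U M d.+1 N N (fun x => x))
    (fun c => exact_after (fun x => x = 0) c /\ terms_in whittaker_alg c)
    (fun c => exact_after (fun x => x = 0) c /\ terms_in (@all_modules U) c).
Proof.
have PQ X : whittaker_alg X -> fg_locfin X by case.
have QR X : fg_locfin X -> locally_finite i n X by case.
move=> PM PN; have [QM QN] := (PQ _ PM, PQ _ PN).
have full1 := zz_full_quotient PQ whittaker_alg_sub whittaker_alg_prod whittaker_alg_ext
  fg_locfin_img fg_locfin_prod whittaker_alg_stable d PM PN.
have full2 := zz_full_subobject QR fg_locfin_sub fg_locfin_img fg_locfin_prod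
  locally_finite_sub fg_locfin_lift d QM QN.
have full3 := torsion_full d (QR _ QM) (QR _ QN).
have up1 (c : chain M d.+1 N) : exact_after (fun x => x = 0) c /\ terms_in whittaker_alg c ->
    exact_after (fun x => x = 0) c /\ terms_in fg_locfin c.
  by move=> [ec Tc]; split=> //; apply: terms_in_sub Tc.
have up2 (c : chain M d.+1 N) : exact_after (fun x => x = 0) c /\ terms_in fg_locfin c ->
    exact_after (fun x => x = 0) c /\ terms_in (locally_finite i n) c.
  by move=> [ec Tc]; split=> //; apply: terms_in_sub Tc.
have up3 (c : chain M d.+1 N) :
    exact_after (fun x => x = 0) c /\ terms_in (locally_finite i n) c ->
    exact_after (fun x => x = 0) c /\ terms_in (@all_modules U) c.
  by move=> [ec Tc]; split=> //; apply: terms_in_sub Tc.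
apply: zz_full_trans up1 _ full1 _ => [c /up2/up3 //|].
exact: zz_full_trans up2 up3 full2 full3.
Qed.

Lemma whittaker_alg_zero (Z : lmodType U) : (forall z : Z, z = 0) -> whittaker_alg Z.
Proof.
move=> Z0; split; first by exists [::]; split=> // z _; apply: Z0.
  by move=> z; exists [::] => y _; apply: Z0.
by move=> z _ x; exists 1; rewrite ?oner_eq0 //; apply: Z0.
Qed.

Lemma whittaker_alg_abelian : abelian_subcategory whittaker_alg.
Proof.
split.
- exists (quoT (@submod_true U (U : pzRingType)^o)).
    apply: whittaker_alg_zero => z; have [x <-] := quo_pi_surj z.
    exact/quo_pi_eq0.
  by move=> z; have [x <-] := quo_pi_surj z; apply/quo_pi_eq0.
- move=> X Y wX wY; exists (X * Y)%type; split; first exact: whittaker_alg_prod.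
  by exists (lid _), id.
- move=> X Y f wX wY; exists (subT (submod_ker f)); split.
    exact: (whittaker_alg_sub (@sub_incl_inj _ _ _ (submod_ker f)) wX).
  exists (sub_incl (submod_ker f)); split=> [|x]; first exact: sub_incl_inj.
  by split=> [/(sub_incl_ex (submod_ker f))//|[z <-]]; apply: (sub_inclP z).
- move=> X Y f wX wY; exists (quoT (submod_range f)); split.
    exact: (whittaker_alg_img (@quo_pi_surj _ _ _ (submod_range f)) wY).
  exists (quo_pi (submod_range f)); split; [exact: quo_pi_surj|exact: quo_pi_eq0].
Qed.

End WhittakerModules.

(** * From zigzags of chains to bijectivity on Ext *)

Section ExtensionFullness.
Variables (A : pzRingType) (P : lmodType A -> Prop).
Implicit Types (Q : lmodType A -> Prop) (M N : lmodType A).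

Definition ok_chain (Q : lmodType A -> Prop) (M N : lmodType A) d (c : chain M d N) :=
  exact_after (fun x => x = 0) c /\ terms_in Q c.

Lemma yseq_ok Q M N d (E : yseq Q M N d) : ok_chain Q (yseq_chain E).
Proof. by case: E. Qed.

(** By proof irrelevance a Yoneda sequence is its chain, so equivalence of sequences and zigzags of
    chains can be exchanged. *)
Lemma yseq_chain_inj Q M N d (E E' : yseq Q M N d) : yseq_chain E = yseq_chain E' -> E = E'.
Proof.
case: E E' => [c e t] [c' e' t'] /= Ec; subst c'.
by congr YSeq; apply: Prop_irrelevance.
Qed.

Lemma yseq_equiv_zigzag Q M N d (E E' : yseq Q M N d) : yseq_equiv E E' ->
  zigzag (@ladder A M d N N (fun x => x)) (ok_chain Q (d := d)) (yseq_chain E) (yseq_chain E').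
Proof.
elim=> {E E'} [E E' EE'|E|E E' _ IH|E F G _ IH1 _ IH2].
- by apply: zigzag_step => //; apply: yseq_ok.
- exact: rst_refl.
- exact: rst_sym.
- exact: rst_trans IH1 IH2.
Qed.

Lemma zigzag_yseq_equiv Q M N d (a b : chain M d N) :
    zigzag (@ladder A M d N N (fun x => x)) (ok_chain Q (d := d)) a b ->
  forall E E' : yseq Q M N d, yseq_chain E = a -> yseq_chain E' = b -> yseq_equiv E E'.
Proof.
elim=> {a b} [a b [_ _ ab]|a|a b _ IH|a b c ab IHab bc IHbc] E E' Ea Eb.
- by apply: rst_step; rewrite /yseq_morphism Ea Eb.
- by rewrite (@yseq_chain_inj _ _ _ _ E E') ?Ea ?Eb //; apply: rst_refl.
- by apply: rst_sym; apply: IH.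
have [eb tb] : ok_chain Q b by apply/(zigzag_ok ab); rewrite -Ea; apply: yseq_ok.
by apply: (@rst_trans _ _ _ (YSeq eb tb)); [apply: IHab|apply: IHbc].
Qed.

Lemma yseq_class_eq Q M N d (x y : yseq_class Q M N d) : sval x = sval y -> x = y.
Proof.
by case: x y => [p hp] [q hq] /= Epq; subst q; congr exist; apply: Prop_irrelevance.
Qed.

Lemma yseq_equiv_eq Q M N d (E E' : yseq Q M N d) : yseq_equiv E E' -> yseq_equiv E = yseq_equiv E'.
Proof.
move=> EE'; apply/funext => F; apply/propext; split; last exact: rst_trans EE'.
exact: rst_trans (rst_sym _ _ _ _ EE').
Qed.

Lemma class_incl_predE M N d (E : yseq P M N d) :
  class_incl_pred (yseq_equiv E) = yseq_equiv (yseq_incl E).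
Proof.
apply/funext => F; apply/propext; split => [[E' EE' E'F]|EF].
  by apply: rst_trans E'F; apply: yseq_incl_equiv.
by exists E => //; apply: rst_refl.
Qed.

(** Degree zero is the identity on Hom. In positive degree the two halves of [zz_full] are
    surjectivity and injectivity on classes, and choice supplies the inverse. *)
Lemma Ext_incl_bijective (M N : lmodType A) d :
    (forall d, zz_full (@ladder A M d.+1 N N (fun x => x)) (ok_chain P (d := d.+1))
      (ok_chain (@all_modules A) (d := d.+1))) ->
  bijective (@Ext_incl A P d M N).
Proof.
case: d => [|d] full; first by exists id.
have [approx faithful] := full d.
have inj (x y : yseq_class P M N d.+1) : class_incl x = class_incl y -> x = y.
  case: x y => [p [E Ep]] [q [E' Eq]] /(congr1 (fun z => sval z)) /= Exy.
  apply: yseq_class_eq => /=; rewrite Ep Eq; apply: yseq_equiv_eq.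
  move: Exy; rewrite Ep Eq !class_incl_predE => EE'.
  have {}EE' : yseq_equiv (yseq_incl E) (yseq_incl E') by rewrite EE'; apply: rst_refl.
  apply: (zigzag_yseq_equiv (a := yseq_chain E) (b := yseq_chain E')) => //.
  apply: faithful; try exact: yseq_ok.
  exact: (yseq_equiv_zigzag EE').
have surj (y : yseq_class (@all_modules A) M N d.+1) :
    exists x : yseq_class P M N d.+1, class_incl x = y.
  case: y => q [F Eq]; have [b [eb tb] Fb] := approx _ (yseq_ok F).
  exists (exist _ (yseq_equiv (YSeq eb tb)) (ex_intro _ (YSeq eb tb) erefl)).
  apply: yseq_class_eq; rewrite /= class_incl_predE Eq; apply: yseq_equiv_eq.
  by apply: rst_sym; apply: (zigzag_yseq_equiv Fb).
have [f fP] := choice surj.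
by exists f => x; [apply: inj; apply: fP|apply: fP].
Qed.

End ExtensionFullness.

Theorem theoremB (R : realType) (g : lieAlgType (complex R))
    (hg : lie_semisimple g) (T : triangular_decomposition g)
    (U : algType (complex R)) (i : {linear g -> U})
    (hU : universal_enveloping i) :
  extension_full (whittaker i T).
Proof.
have -> : whittaker i T = whittaker_alg i T.
  apply/funext => X; apply/propext; exact: (whittakerE hg hU (n_plus T) X).
split; first exact: (whittaker_alg_abelian hU T).
move=> d M N wM wN; apply: Ext_incl_bijective => d'.
exact: (whittaker_full hg hU d' wM wN).
Qed.
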